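(* Let $N\ge1$, $m\ge1$ be integers. If $f\in L_2(\mathbb{R}^N)$ and $f(x)=0$ for almost every $x$ with $|x|<3$, then for every $r<3$ there exists a constant $c_r$ (independent of $f$) such that $$\int_{|x|\le r}\{E_*f(x)\}^2\,dx\le c_r\int_{|x|\ge3}|f(x)|^2\,dx,$$ where $E_*f(x)=\sup_{\lambda>0}|E_\lambda f(x)|$.
   Context: $\hat f(\xi)=(2\pi)^{-N/2}\int_{\mathbb{R}^N}f(x)e^{-i(x,\xi)}dx$ is the unitary Fourier transform, extended to $L_2$. For $f\in L_2(\mathbb{R}^N)$ and $\lambda>0$, $E_\lambda f(x)=(2\pi)^{-N/2}\int_{|\xi|^{2m}<\lambda}\hat f(\xi)e^{i(x,\xi)}d\xi$ (the spectral expansion of $f$ with respect to the polyharmonic operator $(-\Delta)^m$), which is defined for every $x$. *)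

(* Defs.v *)
From HB Require Import structures.
From mathcomp Require Import all_boot all_order all_algebra.
From mathcomp Require Import all_classical all_reals all_analysis.
From mathcomp Require Import complex.
Import Order.TTheory GRing.Theory Num.Theory.
Import numFieldNormedType.Exports.

Set Implicit Arguments.
Unset Strict Implicit.
Unset Printing Implicit Defensive.

Local Open Scope classical_set_scope.
Local Open Scope ring_scope.

Section Defs.
Variable R : realType.

(** Points of R^n are n-tuples of reals (with the product Borel sigma-algebra
    provided by MathComp-Analysis). *)

Definition dotp n (x y : n.-tuple R) : R := \sum_(i < n) tnth x i * tnth y i.
Definition enorm n (x : n.-tuple R) : R := Num.sqrt (dotp x x).

Fixpoint lebN (n : nat) : set (n.-tuple R) -> \bar R :=
  match n with
  | 0 => fun A => \d_([tuple] : 0.-tuple R) A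
  | n'.+1 => pushforward (product_measure1 (@lebesgue_measure R) (@lebN n'))
               (fun p : R * n'.-tuple R => [tuple of p.1 :: p.2])
  end.
Arguments lebN n : clear implicits.

Definition cnorm (z : R[i]) : R :=
  Num.sqrt (complex.Re z ^+ 2 + complex.Im z ^+ 2).

Definition cexpi (t : R) : R[i] := Complex (cos t) (sin t).

Definition cint d (T : measurableType d) (mu : set T -> \bar R)
  (D : set T) (h : T -> R[i]) : R[i] :=
  Complex (fine (\int[mu]_(x in D) (complex.Re (h x))%:E)%E)
          (fine (\int[mu]_(x in D) (complex.Im (h x))%:E)%E).

Definition cmeasurable n (f : n.-tuple R -> R[i]) :=
  measurable_fun setT (fun x => complex.Re (f x)) /\
  measurable_fun setT (fun x => complex.Im (f x)).

Definition L2 n (f : n.-tuple R -> R[i]) :=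
  cmeasurable f /\
  (\int[lebN n]_x ((cnorm (f x)) ^+ 2)%:E < +oo)%E.

Definition fnorm_const (n : nat) : R := (Num.sqrt (2 * pi)) ^- n.

Definition fourier1 n (f : n.-tuple R -> R[i]) (xi : n.-tuple R) : R[i] :=
  ((fnorm_const n)%:C)%C * cint (lebN n) setT (fun x => f x * cexpi (- dotp x xi)).

Definition trunc n (k : nat) (f : n.-tuple R -> R[i]) : n.-tuple R -> R[i] :=
  fun x => ((\1_[set y | enorm y < k%:R] x)%:C)%C * f x.

Definition is_L2_fourier n (f g : n.-tuple R -> R[i]) :=
  L2 g /\
  ((fun k : nat => (\int[lebN n]_xi ((cnorm (fourier1 (trunc k f) xi - g xi)) ^+ 2)%:E)%E)
     @ \oo --> 0%E).

Definition fourierL2 n (f : n.-tuple R -> R[i]) : n.-tuple R -> R[i] :=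
  xget (fun _ => 0) [set g | is_L2_fourier f g].

(** Spectral expansion with respect to (-Delta)^m:
    E_lambda f(x) = (2 pi)^{-n/2} \int_{|xi|^{2m} < lambda} fhat(xi) e^{i(x,xi)} dxi *)
Definition Elam n (m : nat) (lam : R) (f : n.-tuple R -> R[i]) (x : n.-tuple R) : R[i] :=
  ((fnorm_const n)%:C)%C *
  cint (lebN n) [set xi | enorm xi ^+ (2 * m) < lam]
       (fun xi => fourierL2 f xi * cexpi (dotp x xi)).

Definition Estar n (m : nat) (f : n.-tuple R -> R[i]) (x : n.-tuple R) : \bar R :=
  ereal_sup [set (cnorm (Elam m lam f x))%:E | lam in [set lam : R | 0 < lam]].

End Defs.
Arguments lebN {R} n.

(* Main.v *)
Require Import Defs.
From HB Require Import structures.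
From mathcomp Require Import all_boot all_order all_algebra.
From mathcomp Require Import all_classical all_reals all_analysis.
From mathcomp Require Import measurable_realfun complex ring lra.
Import Order.TTheory GRing.Theory Num.Theory.
Import numFieldNormedType.Exports.
Local Open Scope classical_set_scope.
Local Open Scope ring_scope.

(** Write S_rho f for the integral of fhat e^{i(x,xi)} over |xi| < rho.  Two estimates
    on the ball |x| <= r give the maximal inequality.

    (1) Localization at integer radii.  If k >= 0 has a Fourier transform supported
    near 0, the multiplier 1_{|xi| < j} * k produces a function vanishing on
    |x| <= r, because f lives on |y| >= 3.  Hence S_j f has, up to normalization, the
    multiplier m_j = (int k) 1_{|xi| < j} - 1_{|xi| < j} * k there, and sum_j m_j^2 is
    bounded because at most 1 + |u| integers lie between |xi| and |xi - u|.

    (2) Thin annuli.  By Schur's test, the part of fhat carried by an annulus of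
    width h <= 1 has L2-norm on |x| <= 3 at most C sqrt h times its L2-norm: an
    annulus of width h meets a unit cube in volume O(h).  Expanding rho in binary
    and chaining over dyadic annuli bounds sup_rho |S_rho f - S_[rho] f|.

    All kernels are products of the Fejer kernel (1 - cos(a t)) / t^2, whose cosine
    transform follows from scaling alone: int (1 - cos(a t)) / t^2 dt = |a| C.  The
    same kernel yields Plancherel's inequality up to a constant.  If f has no
    [is_L2_fourier] transform, [fourierL2 f] is 0 and the claim is trivial. *)

(** The transform fhat is known only as an L2 limit of transforms of truncations of f, whereas the
    localization argument needs integrable data. So a majorant [GM p q M] made of finitely many
    balls and annuli is estimated first: for fixed [M] the truncation error carries a constant that
    grows with [M], but it tends to 0, and only afterwards does [M] grow. The majorant is
    measurable, so [Estar], a supremum over uncountably many lambda, only ever has to be bounded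
    from above.

    The support of f is used for balls alone; the annulus bound holds for arbitrary data. It gains
    2^-l in the square at level l, which beats the weight (3/2)^l spent in the chaining and leaves
    the convergent series of (3/4)^l. This is why all annuli of a level can be summed, whichever one
    a given rho meets.

    In the localization an unweighted Cauchy-Schwarz would leave the integral of k(u)|u|, which
    diverges because the Fejer kernel decays only like t^-2; a weight of order 1/2 per coordinate
    repairs this. *)

Set Implicit Arguments.
Unset Strict Implicit.
Unset Printing Implicit Defensive.

(** * Lebesgue measure on R^n *)

Section LebesgueRn.
Context {R : realType}.
Implicit Types n : nat.

Lemma measurable_consp n :
  measurable_fun setT (fun p : measurableTypeR R * n.-tuple R =>
    [tuple of (p.1 : R) :: p.2] : n.+1.-tuple R).
Proof. exact: (measurable_cons measurable_fst measurable_snd). Qed.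

(** The product measure of the next dimension needs a sigma-finite second factor, so the measure
    structure and sigma-finiteness are carried through one induction. The canonical instances on
    [lebN] are read off from it. *)
Lemma lebN_sigma_finite_measure n :
  exists m : {sigma_finite_measure set (n.-tuple R) -> \bar R},
    lebN n = m :> (set (n.-tuple R) -> \bar R).
Proof.
elim: n => [|n [m mE]]; first by exists (@dirac _ _ [tuple] R).
pose p : {measure set (n.+1.-tuple R) -> \bar R} :=
  measure_function_pushforward__canonical__measure_function_Measure
    (product_measure1 (@lebesgue_measure R) m) (@measurable_consp n).
(* [q] inverts the cons map; the sigma-finite cover of the product is pulled back along it. *)
pose q (x : n.+1.-tuple R) : R * n.-tuple R := (tnth x ord0, [tuple of behead x]).
have mq : measurable_fun setT q.
  apply/measurable_fun_pairP; split; first exact: measurable_tnth.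
  exact: measurable_behead.
have qc (z : R * n.-tuple R) : q [tuple of z.1 :: z.2] = z.
  by case: z => a b; rewrite /q /=; congr pair; apply/val_inj.
have sp : sigma_finite setT p.
  have [F FT Foo] : sigma_finite setT (product_measure1 (@lebesgue_measure R) m).
    have /sigma_finiteP[F [TF ndF Foo]] := sigma_finiteT (@lebesgue_measure R).
    have /sigma_finiteP[G [TG ndG Goo]] := sigma_finiteT m.
    exists (fun k => F k `*` G k).
      rewrite -setXTT TF TG predeqE => -[x y]; split => [[/= [i _ Fx] [j _ Gy]]|].
        exists (maxn i j) => //; split.
          by move: x Fx; exact/subsetPset/ndF/leq_maxl.
        by move: y Gy; exact/subsetPset/ndG/leq_maxr.
      by move=> [i _ []/= ? ?]; split; exists i.
    move=> k; have [? ?] := Foo k; have [? ?] := Goo k.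
    split; first exact: measurableX.
    by rewrite [ltLHS]product_measure1E// lte_mul_pinfty// ge0_fin_numE.
  exists (fun k => q @^-1` F k).
    by rewrite -preimage_bigcup -FT preimage_setT.
  move=> k; have [mF Fk] := Foo k; split.
    by rewrite -[X in measurable X]setTI; exact: mq.
  rewrite /p/= /pushforward/= (_ : _ @^-1` _ = F k)//.
  by apply/seteqP; split => z /=; rewrite /preimage/= qc.
pose sp' := @Measure_isSigmaFinite.Build _ _ _ p sp.
pose P : {sigma_finite_measure set (n.+1.-tuple R) -> \bar R} := HB.pack (Measure.sort p) sp'.
by exists P; rewrite /= mE.
Qed.

Fact lebN_0 n : @lebN R n set0 = 0%E.
Proof. by have [m ->] := lebN_sigma_finite_measure n. Qed.

Fact lebN_ge0 n A : (0 <= @lebN R n A)%E.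
Proof. by have [m ->] := lebN_sigma_finite_measure n. Qed.

Fact lebN_sigma_additive n : semi_sigma_additive (@lebN R n).
Proof.
by have [m ->] := lebN_sigma_finite_measure n; exact: measure_semi_sigma_additive.
Qed.

HB.instance Definition _ n := isMeasure.Build _ _ _ (@lebN R n)
  (lebN_0 n) (@lebN_ge0 n) (@lebN_sigma_additive n).

Fact lebN_sigma_finite n : sigma_finite setT (@lebN R n).
Proof. by have [m ->] := lebN_sigma_finite_measure n; exact: sigma_finiteT. Qed.

HB.instance Definition _ n := Measure_isSigmaFinite.Build _ _ _ (@lebN R n)
  (lebN_sigma_finite n).

Local Notation leb := (@lebesgue_measure R).

Lemma integral_lebN_cons n (f : n.+1.-tuple R -> \bar R) :
  measurable_fun setT f -> (forall x, 0 <= f x)%E ->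
  (\int[lebN n.+1]_x f x = \int[leb]_t \int[lebN n]_x f (cons_tuple (t : R) x))%E.
Proof.
move=> mf f0.
rewrite (ge0_integral_pushforward (@measurable_consp n)
  (product_measure1 leb (lebN n)))//=.
rewrite preimage_setT (fubini_tonelli1 (f \o _))//.
  by apply: measurableT_comp => //; exact: measurable_consp.
by move=> x; exact: f0.
Qed.

Lemma integral_lebN_cons_swap n (f : n.+1.-tuple R -> \bar R) :
  measurable_fun setT f -> (forall x, 0 <= f x)%E ->
  (\int[lebN n.+1]_x f x = \int[lebN n]_x \int[leb]_t f (cons_tuple (t : R) x))%E.
Proof.
move=> mf f0.
rewrite (ge0_integral_pushforward (@measurable_consp n)
  (product_measure1 leb (lebN n)))//=.
rewrite preimage_setT (fubini_tonelli2 (f \o _))//.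
  by apply: measurableT_comp => //; exact: measurable_consp.
by move=> x; exact: f0.
Qed.

Lemma integral_lebN0 (f : 0.-tuple R -> \bar R) :
  measurable_fun setT f -> (\int[lebN 0]_x f x = f [tuple])%E.
Proof. by move=> mf; rewrite integral_dirac ?diracT ?mul1e. Qed.

Lemma measurable_dotp d (T : measurableType d) n (f g : T -> n.-tuple R) :
  measurable_fun setT f -> measurable_fun setT g ->
  measurable_fun setT (fun x => dotp (f x) (g x)).
Proof.
move=> mf mg; apply: measurable_sum => i; apply: measurable_funM.
  by apply: (measurableT_comp (measurable_tnth i)).
by apply: (measurableT_comp (measurable_tnth i)).
Qed.

Lemma measurable_enorm n : measurable_fun setT (@enorm R n).
Proof.
apply: (measurableT_comp (@continuous_measurable_fun R Num.sqrt _)).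
  exact: sqrt_continuous.
exact: measurable_dotp.
Qed.

Lemma measurable_tuple d (T : measurableType d) n (F : 'I_n -> T -> R) :
  (forall i, measurable_fun setT (F i)) ->
  measurable_fun setT (fun x => [tuple F i x | i < n]).
Proof.
move=> mF; apply/measurable_fun_tnthP => i.
by rewrite (_ : _ \o _ = F i)//; apply/funext => x /=; rewrite tnth_mktuple.
Qed.

End LebesgueRn.

(** * Integrability of real-valued functions *)

Section Integrability.
Context d (T : measurableType d) (R : realType).
Variable mu : {measure set T -> \bar R}.
Implicit Types f g h : T -> R.

Definition intg f := mu.-integrable setT (EFin \o f).

Lemma intg_measurable f : intg f -> measurable_fun setT f.
Proof. by move=> /measurable_int/measurable_EFinP. Qed.

Lemma le_intg f g : measurable_fun setT f -> (forall x, `|f x| <= g x) ->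
  intg g -> intg f.
Proof.
move=> mf fg; apply: le_integrable => //; first exact/measurable_EFinP.
by move=> x _ /=; rewrite lee_fin (le_trans (fg x))// ler_norm.
Qed.

Lemma ge0_intg f : measurable_fun setT f -> (forall x, 0 <= f x) ->
  (\int[mu]_x (f x)%:E < +oo)%E -> intg f.
Proof.
move=> mf f0 fy; apply/integrableP; split; first exact/measurable_EFinP.
by under eq_integral do rewrite /= ger0_norm//.
Qed.

Lemma intg_EFin f : intg f -> (\int[mu]_x (f x)%:E = (\int[mu]_x f x)%R%:E)%E.
Proof. by move=> fi; rewrite fineK//; exact: integrable_fin_num. Qed.

Lemma intgD f g : intg f -> intg g -> intg (fun x => f x + g x).
Proof. exact: integrableD. Qed.

Lemma intgB f g : intg f -> intg g -> intg (fun x => f x - g x).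
Proof. exact: integrableB. Qed.

Lemma intgZl k f : intg f -> intg (fun x => k * f x).
Proof. exact: integrableZl. Qed.

Lemma intg_norm f : intg f -> intg (fun x => `|f x|).
Proof. exact: integrable_norm. Qed.

Lemma intg_sum (I : Type) (s : seq I) (F : I -> T -> R) :
  (forall i, intg (F i)) -> intg (fun x => \sum_(i <- s) F i x).
Proof.
move=> Fi; elim: s => [|i s ih].
  by apply: eq_integrable (integrable0 mu setT) => // x _ /=; rewrite big_nil.
apply: eq_integrable (intgD (Fi i) ih) => // x _ /=; by rewrite big_cons.
Qed.

Lemma intgM_bd f h (M : R) : intg f -> measurable_fun setT h ->
  (forall x, `|h x| <= M) -> intg (fun x => f x * h x).
Proof.
move=> fi mh hM.
apply: (@le_intg _ (fun x => M * `|f x|)); last exact/intgZl/intg_norm.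
  by apply: measurable_funM => //; exact: intg_measurable.
by move=> x; rewrite normrM mulrC ler_wpM2r.
Qed.

Lemma Rintegral_sum (I : Type) (s : seq I) (F : I -> T -> R) :
  (forall i, intg (F i)) ->
  \int[mu]_x (\sum_(i <- s) F i x) = \sum_(i <- s) \int[mu]_x F i x.
Proof.
move=> Fi; elim: s => [|i s ih].
  rewrite big_nil /Rintegral integral0_eq// => x _; by rewrite big_nil.
rewrite big_cons -ih -RintegralD//; [|exact: Fi|exact: intg_sum].
by apply: eq_Rintegral => x _; rewrite big_cons.
Qed.

(** The integral of a nonnegative function is a supremum over the simple functions below it, so
    monotonicity holds for arbitrary functions. This matters for [Estar], whose measurability is not
    established. *)
Lemma sup_le_integral (f g : T -> \bar R) (D : set T) :
  (forall x, D x -> 0 <= f x)%E -> (forall x, D x -> f x <= g x)%E ->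
  (\int[mu]_(x in D) f x <= \int[mu]_(x in D) g x)%E.
Proof.
move=> f0 fg; rewrite !ge0_integralE//; last first.
  by move=> x Dx; exact: le_trans (f0 _ Dx) (fg _ Dx).
apply: le_ereal_sup => _ [h hf <-]; exists h => // x.
apply: le_trans (hf x) _; rewrite !patchE; case: ifPn => // /set_mem.
exact: fg.
Qed.

End Integrability.

(** * Fubini for real-valued kernels *)

Section Fubini.
Context d1 d2 (X : measurableType d1) (Y : measurableType d2) (R : realType).
Variable m1 : {sigma_finite_measure set X -> \bar R}.
Variable m2 : {sigma_finite_measure set Y -> \bar R}.

Lemma Rfubini (K : X * Y -> R) : measurable_fun setT K ->
  (\int[m1]_x \int[m2]_y `|K (x, y)|%:E < +oo)%E ->
  (forall x, intg m2 (fun y => K (x, y))) ->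
  (forall y, intg m1 (fun x => K (x, y))) ->
  \int[m1]_x (\int[m2]_y K (x, y)) = \int[m2]_y (\int[m1]_x K (x, y)).
Proof.
move=> mK Ky K1 K2.
have iK : (m1 \x m2)%E.-integrable setT (EFin \o K).
  by apply/integrable12ltyP => //; exact/measurable_EFinP.
rewrite /Rintegral; congr fine.
rewrite (eq_integral (fun x => \int[m2]_y (K (x, y))%:E)%E); last first.
  by move=> x _; rewrite intg_EFin.
rewrite [RHS](eq_integral (fun y => \int[m1]_x (K (x, y))%:E)%E); last first.
  by move=> x _; rewrite intg_EFin.
exact: Fubini iK.
Qed.

Lemma measurable_Rintegral (K : X * Y -> R) : measurable_fun setT K ->
  (forall x, intg m2 (fun y => K (x, y))) ->
  measurable_fun setT (fun x => \int[m2]_y K (x, y)).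
Proof.
move=> mK K1.
have E x : \int[m2]_y K (x, y) =
    fine (\int[m2]_y ((EFin \o K)^\+ (x, y)))%E - fine (\int[m2]_y ((EFin \o K)^\- (x, y)))%E.
  rewrite /Rintegral integralE fineB.
  - by congr (fine _ - fine _); apply: eq_integral => y _; rewrite ?funeposE ?funenegE.
  - exact: (integrable_pos_fin_num _ (K1 x)).
  - exact: (integrable_neg_fin_num _ (K1 x)).
under eq_fun do rewrite E.
have mEK : measurable_fun setT (EFin \o K) by exact/measurable_EFinP.
apply: measurable_funB; apply: (measurableT_comp (fine_measurable measurableT)).
  apply: (@measurable_fun_fubini_tonelli_F _ _ _ _ _ m2 ((EFin \o K)^\+)%E).
    exact: measurable_funepos.
  by move=> z; exact: funepos_ge0.
apply: (@measurable_fun_fubini_tonelli_F _ _ _ _ _ m2 ((EFin \o K)^\-)%E).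
  exact: measurable_funeneg.
by move=> z; exact: funeneg_ge0.
Qed.

(** The form that suits oscillatory integrals: [f] and [g] supply the integrability and the
    trigonometric kernel [K] is merely bounded, so the integrand is dominated by M |f| |g|. *)
Lemma Rfubini_bd (f : X -> R) (g : Y -> R) (K : X * Y -> R) (M : R) :
  intg m1 f -> intg m2 g -> measurable_fun setT K -> (forall z, `|K z| <= M) ->
  \int[m1]_x (f x * \int[m2]_y (g y * K (x, y))) =
  \int[m2]_y (g y * \int[m1]_x (f x * K (x, y))).
Proof.
move=> fi gi mK KM.
have gK x : intg m2 (fun y => g y * K (x, y)).
  apply: intgM_bd gi _ (fun y => KM (x, y)).
  by apply: measurableT_comp => //; exact: pair1_measurable.
have fK y : intg m1 (fun x => f x * K (x, y)).
  apply: intgM_bd fi _ (fun x => KM (x, y)).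
  by apply: measurableT_comp => //; exact: pair2_measurable.
have mf := intg_measurable fi.
have mg := intg_measurable gi.
have mfx : measurable_fun setT (fun z : X * Y => f z.1) by exact: measurableT_comp.
have mgy : measurable_fun setT (fun z : X * Y => g z.2) by exact: measurableT_comp.
transitivity (\int[m1]_x (\int[m2]_y (fun z => f z.1 * (g z.2 * K z)) (x, y))).
  by apply: eq_Rintegral => x _; rewrite /= RintegralZl//; exact: gK.
rewrite (@Rfubini (fun z => f z.1 * (g z.2 * K z))).
- apply: eq_Rintegral => y _; rewrite -RintegralZl//; last exact: fK.
  by apply: eq_Rintegral => x _ /=; ring.
- by apply: measurable_funM => //; exact: measurable_funM.
- apply: (@le_lt_trans _ _ (\int[m1]_x \int[m2]_y (M * `|f x| * `|g y|)%:E)%E).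
    apply: sup_le_integral => [x _|x _]; first exact: integral_ge0.
    apply: sup_le_integral => [y _//|y _].
    rewrite lee_fin !normrM /= -mulrA mulrA [leLHS]mulrC.
    by rewrite ler_wpM2r ?mulr_ge0.
  under eq_integral => x _.
    rewrite (eq_integral (fun y => (M * `|f x|)%:E * `|g y|%:E)%E)//.
    rewrite ge0_integralZl_EFin//; last 2 first.
      by apply/measurable_EFinP; exact: measurableT_comp.
      by rewrite mulr_ge0// (le_trans _ (KM (x, point))).
    rewrite (intg_EFin (intg_norm gi)) -EFinM; over.
  have /integrable_lty : intg m1 (fun x => M * `|f x| * \int[m2]_y `|g y|).
    apply: eq_integrable (intgZl (\int[m2]_y `|g y|) (intgZl M (intg_norm fi))) => //.
    by move=> x _ /=; rewrite mulrC.
  exact.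
- by move=> x; exact: (intgZl (f x) (gK x)).
- move=> y; apply: eq_integrable (intgZl (g y) (fK y)) => // x _ /=.
  by rewrite mulrCA.
Qed.

End Fubini.

(** * Integrals of products over coordinates *)

Section ProductIntegrals.
Context {R : realType}.
Local Notation leb := (@lebesgue_measure R).
Implicit Types n : nat.

Lemma measurable_fun_coord n (f : 'I_n -> R -> R) :
  (forall i, measurable_fun setT (f i)) ->
  measurable_fun setT (fun x : n.-tuple R => \prod_(i < n) f i (tnth x i)).
Proof.
move=> mf; apply: measurable_prod => i _.
by apply: (measurableT_comp (mf i)); exact: measurable_tnth.
Qed.

Lemma tnth_cons0 n (t : R) (x : n.-tuple R) : tnth (cons_tuple t x) ord0 = t.
Proof. by []. Qed.

Lemma tnth_consS n (t : R) (x : n.-tuple R) (i : 'I_n) :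
  tnth (cons_tuple t x) (lift ord0 i) = tnth x i.
Proof. exact: tnthS. Qed.

Lemma prod_cons n (f : 'I_n.+1 -> R -> R) t (x : n.-tuple R) :
  \prod_(i < n.+1) f i (tnth (cons_tuple t x) i) =
  f ord0 t * \prod_(i < n) f (lift ord0 i) (tnth x i).
Proof.
rewrite big_ord_recl tnth_cons0; congr (_ * _).
by apply: eq_bigr => i _; rewrite tnth_consS.
Qed.

Lemma integral_prod_coord n (f : 'I_n -> R -> R) (c : 'I_n -> R) :
  (forall i, measurable_fun setT (f i)) -> (forall i t, 0 <= f i t) ->
  (forall i, \int[leb]_t (f i t)%:E = (c i)%:E)%E ->
  (\int[lebN n]_x (\prod_(i < n) f i (tnth x i))%:E = (\prod_(i < n) c i)%:E)%E.
Proof.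
elim: n f c => [|n ih] f c mf f0 fc.
  rewrite integral_lebN0 ?big_ord0//.
  by apply/measurable_EFinP; exact: measurable_fun_coord.
rewrite integral_lebN_cons; last 2 first.
- by apply/measurable_EFinP; exact: measurable_fun_coord.
- by move=> x; rewrite lee_fin prodr_ge0.
rewrite (eq_integral (fun t : measurableTypeR R => (\prod_(i < n) c (lift ord0 i))%:E * (f ord0 t)%:E)%E).
  rewrite ge0_integralZl_EFin ?fc//; last 3 first.
  - by move=> t _; rewrite lee_fin.
  - by apply/measurable_EFinP; exact: mf.
  - apply: prodr_ge0 => i _; rewrite -lee_fin -fc.
    by apply: integral_ge0 => t _; rewrite lee_fin.
  by rewrite big_ord_recl mulrC.
move=> t _; under eq_integral do rewrite prod_cons EFinM.
rewrite ge0_integralZl_EFin//; last 2 first.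
- by move=> x _; rewrite lee_fin prodr_ge0.
- apply/measurable_EFinP.
  by apply: (@measurable_fun_coord n (fun i => f (lift ord0 i))) => i.
rewrite (ih (fun i => f (lift ord0 i)) (fun i => c (lift ord0 i)))//.
by rewrite muleC.
Qed.

(** The signed counterpart of the induction step of [integral_prod_coord], for factors that contain
    sines and cosines. *)
Lemma intg_cons n (a : R -> R) (b : n.-tuple R -> R) :
  intg leb a -> intg (lebN n) b ->
  intg (lebN n.+1) (fun x => a (tnth x ord0) * b [tuple of behead x]) /\
  \int[lebN n.+1]_x (a (tnth x ord0) * b [tuple of behead x]) =
    \int[leb]_t a t * \int[lebN n]_x b x.
Proof.
move=> ai bi; set g := fun x : n.+1.-tuple R => _.
have mg : measurable_fun setT g.
  apply: measurable_funM.
    apply: (measurableT_comp (intg_measurable ai)); exact: measurable_tnth.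
  apply: (measurableT_comp (intg_measurable bi)); exact: measurable_behead.
have gE t (x : n.-tuple R) : g (cons_tuple t x) = a t * b x.
  by rewrite /g tnth_cons0; congr (_ * b _); exact/val_inj.
have iab' : (product_measure1 leb (lebN n)).-integrable setT
    (EFin \o (fun z : measurableTypeR R * n.-tuple R => a z.1 * b z.2)).
  apply/integrable12ltyP.
    apply/measurable_EFinP/measurable_funM.
      exact: (measurableT_comp (intg_measurable ai)).
    exact: (measurableT_comp (intg_measurable bi)).
  rewrite (eq_integral (fun t : measurableTypeR R =>
      (\int[lebN n]_x `|b x|)%:E * `|a t|%:E)%E); last first.
    move=> t _; rewrite -intg_EFin; last exact: intg_norm.
    rewrite [LHS](eq_integral (fun x => `|a t|%:E * `|b x|%:E)%E); last first.
      by move=> x _; rewrite -EFinM -normrM.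
    have -> : (\int[lebN n]_x (`|a t|%:E * `|b x|%:E) =
        `|a t|%:E * \int[lebN n]_x `|b x|%:E)%E.
      apply: ge0_integralZl_EFin => //.
      by apply/measurable_EFinP/measurableT_comp => //; exact: (intg_measurable bi).
    exact: muleC.
  rewrite ge0_integralZl_EFin ?Rintegral_ge0//.
    by rewrite (intg_EFin (intg_norm ai)) -EFinM ltry.
  apply/measurable_EFinP/measurableT_comp => //; exact: (intg_measurable ai).
have iab'' : (product_measure1 leb (lebN n)).-integrable setT
    ((EFin \o g) \o (fun p => cons_tuple (p.1 : R) p.2)).
  by apply: eq_integrable iab' => // z _ /=; rewrite gE.
split.
  apply: (integrable_pushforward (@measurable_consp R n)
    (mu := product_measure1 leb (lebN n)) (D := setT) (f := EFin \o g)) => //.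
  exact/measurable_EFinP.
have := integral_pushforward (@measurable_consp R n)
  (mu := product_measure1 leb (lebN n)) (D := setT) (f := EFin \o g).
rewrite preimage_setT => H.
rewrite {1}/Rintegral H//; last exact/measurable_EFinP.
transitivity (fine (\int[product_measure1 leb (lebN n)]_z
    (EFin \o (fun z : measurableTypeR R * n.-tuple R => a z.1 * b z.2)%R) z)%E).
  by congr fine; apply: eq_integral => z _ /=; rewrite gE.
rewrite -(integral12_prod_meas1 iab') /fubini_F /=.
rewrite (eq_integral (fun t : measurableTypeR R =>
    ((\int[lebN n]_x b x) * a t)%:E)); last first.
  move=> t _; rewrite (intg_EFin (intgZl (a t) bi)) RintegralZl//.
  by rewrite mulrC.
by rewrite -/(Rintegral leb setT _) RintegralZl// mulrC.
Qed.
End ProductIntegrals.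

(** * The Fejer kernel on the line *)

Section Lebesgue1D.
Context {R : realType}.
Local Notation leb := (@lebesgue_measure R).

(** The left side is a measure in [A] that agrees with Lebesgue measure on half-open intervals, and
    uniqueness does the rest. *)
Lemma lebesgue_measure_affine (a b : R) (A : set R) : 0 < a -> measurable A ->
  (a%:E * leb ((fun t => a * t + b)%R @^-1` A) = leb A)%E.
Proof.
move=> a0 mA.
have mf : measurable_fun setT (fun t : measurableTypeR R => a * t + b : measurableTypeR R).
  by apply: measurable_funD => //; exact: measurable_funM.
pose p : {measure set (measurableTypeR R) -> \bar R} :=
  mscale (NngNum (ltW a0))
  (measure_function_pushforward__canonical__measure_function_Measure leb mf).
transitivity (p A) => //.
apply/esym/lebesgue_measure_unique => //= _ [[x y]] _ <-.
rewrite /p /= /mscale /= /pushforward.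
rewrite (_ : _ @^-1` _ = `](x - b) / a, (y - b) / a]%classic); last first.
  apply/seteqP; split => t /=; rewrite !in_itv/= ltr_pdivrMr// ler_pdivlMr// ltrBlDr lerBrDr ![t * a]mulrC//.
rewrite /= !lebesgue_measure_itv/= !lte_fin ltr_pM2r ?invr_gt0// ltrD2r.
case: ifPn => _; last by rewrite mule0.
rewrite -!EFinD -EFinM; congr EFin; field; exact: lt0r_neq0.
Qed.

Lemma integral_leb_affine (a b : R) (h : R -> \bar R) : 0 < a ->
  measurable_fun setT h -> (forall t, 0 <= h t)%E ->
  (a%:E * \int[leb]_t h (a * t + b)%R = \int[leb]_t h t)%E.
Proof.
move=> a0 mh h0.
have mf : measurable_fun setT (fun t : measurableTypeR R => a * t + b : measurableTypeR R).
  by apply: measurable_funD => //; exact: measurable_funM.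
have := ge0_integral_pushforward mf leb (D := setT) measurableT mh (fun t _ => h0 t).
rewrite preimage_setT => /= <-.
rewrite -(@ge0_integral_mscale _ _ _ (measure_function_pushforward__canonical__measure_function_Measure leb mf) _ measurableT (NngNum (ltW a0)))//.
apply: eq_measure_integral => A mA _.
exact: lebesgue_measure_affine.
Qed.

Lemma integral_leb_opp (h : R -> \bar R) :
  measurable_fun setT h -> (forall t, 0 <= h t)%E ->
  (\int[leb]_t h (- t)%R = \int[leb]_t h t)%E.
Proof.
move=> mh h0.
have mf : measurable_fun setT (fun t : measurableTypeR R => - t : measurableTypeR R).
  exact: measurable_funN.
have := ge0_integral_pushforward mf leb (D := setT) measurableT mh (fun t _ => h0 t).
rewrite preimage_setT => /= <-.
apply: eq_measure_integral => A mA _; exact: lebesgue_measureN.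
Qed.

(** Reflection exchanges the positive and negative parts, so their integrals coincide. If both are
    infinite, [fine] sends the difference to its default 0. *)
Lemma Rintegral_odd (f : R -> R) : measurable_fun setT f ->
  (forall t, f (- t) = - f t) -> \int[leb]_t f t = 0.
Proof.
move=> mf fN; rewrite /Rintegral integralE.
have mE : measurable_fun [set: measurableTypeR R] (EFin \o f).
  exact/measurable_EFinP.
have <- : (\int[leb]_x (EFin \o f)^\+ x = \int[leb]_x (EFin \o f)^\- x)%E.
  rewrite -integral_leb_opp//; last exact: measurable_funepos.
  by apply: eq_integral => t _; rewrite funeposE funenegE /= fN EFinN.
set I := (\int[_]_x _)%E; case: I => //= r; by rewrite subrr.
Qed.

End Lebesgue1D.

Section Fejer.
Context {R : realType}.
Local Notation leb := (@lebesgue_measure R).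
Implicit Types a t u : R.

(** The value at 0 is the limit, so that the scaling and product-to-sum identities hold at every
    [t]. *)
Definition fej a t : R := if t == 0 then a ^+ 2 / 2 else (1 - cos (a * t)) / t ^+ 2.

Lemma fej_ge0 a t : 0 <= fej a t.
Proof.
rewrite /fej; case: ifPn => _; first by rewrite mulr_ge0 ?sqr_ge0// invr_ge0.
by rewrite mulr_ge0 ?invr_ge0 ?sqr_ge0// subr_ge0 cos_le1.
Qed.

Lemma fejN a t : fej (- a) t = fej a t.
Proof. by rewrite /fej sqrrN mulNr cosN. Qed.

Lemma fej_even a t : fej a (- t) = fej a t.
Proof. by rewrite /fej oppr_eq0 mulrN cosN sqrrN. Qed.

Lemma fej_scale a t : fej a t = a ^+ 2 * fej 1 (a * t).
Proof.
rewrite /fej mulf_eq0; have [->|t0] := eqVneq t 0; first by rewrite orbT expr1n mulrA mulr1.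
have [->|a0] /= := eqVneq a 0.
  by rewrite mul0r cos0 subrr expr0n/= !mul0r.
rewrite mul1r; field; exact/andP.
Qed.

(** Product-to-sum turns modulation by a frequency into a second difference in the parameter of the
    kernel, so the cosine transform needs nothing beyond the integrals of unmodulated kernels. *)
Lemma fej_cos d u t :
  fej d t * cos (t * u) = (fej (u + d) t + fej (u - d) t) / 2 - fej u t.
Proof.
rewrite /fej; have [->|t0] := eqVneq t 0; first by rewrite mul0r cos0; field.
by rewrite [t * u]mulrC [(u + d) * t]mulrDl [(u - d) * t]mulrBl cosD cosB; field.
Qed.

Lemma measurable_inv : measurable_fun [set: R] (@GRing.inv R).
Proof.
rewrite -(setvU [set 0 : R]); apply/measurable_funU => //.
  exact: measurableC.
split; last exact: measurable_fun_set1.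
apply: open_continuous_measurable_fun.
  rewrite openC; apply: accessible_closed_set1; apply: hausdorff_accessible.
  exact: Rhausdorff.
move=> x /[!inE] /= x0; apply: inv_continuous; exact/eqP.
Qed.

Lemma measurable_fej a : measurable_fun setT (fej a).
Proof.
rewrite /fej; apply: measurable_fun_ifT.
- exact: measurable_fun_eqr.
- exact: measurable_cst.
- apply: measurable_funM.
    apply: measurable_funB => //; apply: measurableT_comp; last exact: measurable_funM.
    by apply: continuous_measurable_fun; exact: continuous_cos.
  apply: measurableT_comp; last exact: measurable_funX.
  exact: measurable_inv.
Qed.

Lemma sin_le_id t : 0 <= t -> sin t <= t.
Proof.
move=> t0.
have [->|tn0] := eqVneq t 0; first by rewrite sin0.
have tp : 0 < t by rewrite lt_neqAle eq_sym tn0.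
have [|c _] := @MVT R sin cos 0 t tp (fun x _ => is_derive_sin x).
  by apply: continuous_subspaceT; exact: continuous_sin.
rewrite sin0 !subr0 => ->; by rewrite ler_piMl// cos_le1.
Qed.

Lemma sin_sqr_le t : sin t ^+ 2 <= t ^+ 2.
Proof.
wlog t0 : t / 0 <= t => [H|].
  have [/H//|/ltW t0] := leP 0 t.
  by have := H (- t); rewrite oppr_ge0 sinN !sqrrN => /(_ t0).
have [t1|t1] := leP t 1; last first.
  rewrite sin2cos2 (@le_trans _ _ 1)//; first by rewrite gerBl sqr_ge0.
  by rewrite exprn_ege1// ltW.
rewrite ler_sqr ?nnegrE//; first exact: sin_le_id.
by rewrite sin_ge0_pi// t0/= (le_trans t1)// (le_trans _ (pi_ge2 R))// ler1n.
Qed.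

Lemma one_sub_cos t : 1 - cos t = 2 * sin (t / 2) ^+ 2.
Proof.
have {1}-> : t = (t / 2) *+ 2 by rewrite -mulr_natr divfK.
by rewrite cos_mulr2n sin2cos2 mulr2n; ring.
Qed.

Lemma one_sub_cos_le t : 1 - cos t <= t ^+ 2 / 2.
Proof.
rewrite one_sub_cos; have := sin_sqr_le (t / 2); rewrite expr_div_n => h.
by rewrite (@le_trans _ _ (2 * (t ^+ 2 / 2 ^+ 2)))//; lra.
Qed.

Lemma sin_ge_half t : 0 <= t <= 1 -> t / 2 <= sin t.
Proof.
move=> /andP[t0 t1].
have [->|tn0] := eqVneq t 0; first by rewrite sin0 mul0r.
have tp : 0 < t by rewrite lt_neqAle eq_sym tn0.
have [|c /[!in_itv]/= /andP[c0 ct]] := @MVT R sin cos 0 t tp (fun x _ => is_derive_sin x).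
  by apply: continuous_subspaceT; exact: continuous_sin.
rewrite sin0 !subr0 => ->; rewrite mulrC ler_wpM2r//.
have := one_sub_cos_le c.
have : c ^+ 2 <= 1 by rewrite expr_le1 ?(ltW c0)// (le_trans (ltW ct)).
lra.
Qed.

Lemma one_sub_cos_ge t : `|t| <= 1 -> t ^+ 2 / 8 <= 1 - cos t.
Proof.
wlog t0 : t / 0 <= t => [H|].
  have [/H//|/ltW t0] := leP 0 t.
  by have := H (- t); rewrite oppr_ge0 cosN sqrrN normrN => /(_ t0).
rewrite ger0_norm// => t1; rewrite one_sub_cos.
have : t / 2 / 2 <= sin (t / 2).
  by apply: sin_ge_half; lra.
rewrite -(@ler_sqr _ (t / 2 / 2)) ?nnegrE; [|lra|]; last first.
  rewrite (@le_trans _ _ (t / 2 / 2))//; first lra.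
  by apply: sin_ge_half; lra.
rewrite !expr_div_n; lra.
Qed.

Lemma fej_ge a t : 0 < a -> a * `|t| <= 1 -> a ^+ 2 / 8 <= fej a t.
Proof.
move=> a0 at1; rewrite /fej; have [_|t0] := eqVneq t 0.
  by rewrite ler_wpM2l ?sqr_ge0// lef_pV2 ?posrE// ler_nat.
rewrite ler_pdivlMr ?exprn_even_gt0// mulrAC -exprMn.
by apply: one_sub_cos_ge; rewrite normrM gtr0_norm.
Qed.

(** Combine (1 + |t|)^2 <= 2 (1 + t^2) with the two bounds a^2 / 2 on the kernel and 2 on t^2 times
    the kernel. *)
Lemma fej_le a t : fej a t <= (a ^+ 2 + 4) / (1 + `|t|) ^+ 2.
Proof.
have t1 : 0 < (1 + `|t|) ^+ 2 by rewrite exprn_gt0// ltr_pwDl.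
rewrite ler_pdivlMr//.
have h1 : (1 + `|t|) ^+ 2 <= 2 * (1 + t ^+ 2).
  rewrite -[t ^+ 2]real_normK ?num_real//.
  have := sqr_ge0 (1 - `|t|); rewrite !expr2; lra.
have h2 : fej a t <= a ^+ 2 / 2.
  rewrite /fej; case: ifPn => // t0; rewrite ler_pdivrMr ?exprn_even_gt0// mulrAC -exprMn.
  exact: one_sub_cos_le.
have h3 : fej a t * t ^+ 2 <= 2.
  rewrite /fej; case: ifPn => [/eqP->|t0]; first by rewrite expr0n/= mulr0.
  rewrite divfK ?sqrf_eq0//; have := cos_geN1 (a * t); lra.
rewrite (le_trans (ler_wpM2l (fej_ge0 a t) h1))//.
rewrite mulrCA mulrDr mulr1; lra.
Qed.

(** The kernel has no first moment but does have one of order 1/2. The square of this weight is 1 +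
    |t|, the growth produced by counting integers between two radii. *)
Definition wgt t : R := Num.sqrt (1 + `|t|).

Lemma wgt_ge1 t : 1 <= wgt t.
Proof. by rewrite -[leLHS]sqrtr1 ler_wsqrtr// lerDl. Qed.

Lemma measurable_wgt : measurable_fun setT wgt.
Proof.
apply: (measurableT_comp (@continuous_measurable_fun R Num.sqrt _)).
  exact: sqrt_continuous.
by apply: measurable_funD => //; exact: measurable_normr.
Qed.

(** The power (1 + t)^(-3/2), which dominates the weighted kernel up to a constant and has the
    explicit antiderivative -2 (1 + t)^(-1/2). *)
Let G t : R := ((1 + t) * Num.sqrt (1 + t))^-1.

Let dF (x : R) : 0 <= x ->
  is_derive x 1 (fun t => - 2 * (Num.sqrt (1 + t))^-1) (G x).
Proof.
move=> x0; have x1 : 0 < 1 + x by rewrite ltr_pwDl.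
have s0 : (Num.sqrt \o (fun t => 1 + t)) x != 0 by rewrite /= gt_eqF// sqrtr_gt0.
have d1 : is_derive x 1 (fun t : R => 1 + t) 1.
  by have := is_deriveD (is_derive_cst (1 : R) x 1) (is_derive_id x 1); rewrite add0r.
have d2 := @is_derive1_comp _ Num.sqrt (fun t => 1 + t) x _ _ (is_derive1_sqrt x1) d1.
have d3 := is_deriveZ (- 2) (is_deriveV s0 d2).
have E : - 2 *: (- ((Num.sqrt \o (fun t => 1 + t)) x) ^- 2 *: ((2 * Num.sqrt (1 + x))^-1 * 1)) = G x.
  have -> : G x = (Num.sqrt (1 + x) ^+ 2 * Num.sqrt (1 + x))^-1 by rewrite /G sqr_sqrtr// ltW.
  by rewrite /GRing.scale /=; field.
by rewrite -E; exact: d3.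
Qed.

Lemma integral_G : (\int[leb]_(t in `[0%R, +oo[) (G t)%:E < +oo)%E.
Proof.
rewrite (@ge0_continuous_FTC2y R G (fun t => - 2 * (Num.sqrt (1 + t))^-1) 0 0).
- by rewrite -EFinB ltry.
- by move=> x x0; rewrite invr_ge0 mulr_ge0 ?sqrtr_ge0// addr_ge0.
- apply: continuous_in_subspaceT => x /[!inE] /=; rewrite in_itv/= andbT => x0.
  have x1 : 0 < 1 + x by rewrite ltr_pwDl.
  have c1 : {for x, continuous (fun t : R => 1 + t)} by apply: cvgD; [exact: cvg_cst|exact: cvg_id].
  apply: (@continuous_comp _ _ _ (fun t => (1 + t) * Num.sqrt (1 + t)) (@GRing.inv R)).
    apply: cvgM => //; apply: continuous_comp => //; exact: sqrt_continuous.
  by apply: inv_continuous; rewrite mulf_neq0// gt_eqF// sqrtr_gt0.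
- apply/cvgrPdist_lt => e e0; near=> x.
  have x0 : 0 < x by near: x; exact: nbhs_pinfty_gt.
  rewrite sub0r normrN normrM normrN ger0_norm// ger0_norm ?invr_ge0//.
  rewrite ltr_pdivrMr ?sqrtr_gt0 ?ltr_pwDl ?ltW// mulrC -ltr_pdivrMr//.
  rewrite -(@ltr_sqr _ (2 / e)) ?nnegrE ?sqrtr_ge0 ?divr_ge0 ?ltW// sqr_sqrtr ?addr_ge0 ?ltW//.
  apply: (@lt_trans _ _ x); last by rewrite ltrDr.
  by near: x; apply: nbhs_pinfty_gt; exact: num_real.
- by move=> x x0; have [] := dF (ltW x0).
- have [d0 _] := dF (lexx 0).
  apply: cvg_at_right_filter.
  by have /derivable1_diffP/differentiable_continuous := d0.
- by move=> x; rewrite in_itv/= andbT => x0; rewrite derive1E; have [_] := dF (ltW x0).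
Unshelve. all: by end_near. Qed.

Lemma intg_fej_wgt a : intg leb (fun t => fej a t * wgt t).
Proof.
have mG : measurable_fun setT (fun t => G `|t|).
  apply: (measurableT_comp measurable_inv); apply: measurable_funM.
    by apply: measurable_funD => //; exact: measurable_normr.
  exact: measurable_wgt.
apply: (@le_intg _ (measurableTypeR R) R leb _ (fun t => (a ^+ 2 + 4) * G `|t|)).
- by apply: measurable_funM; [exact: measurable_fej|exact: measurable_wgt].
- move=> t; rewrite ger0_norm ?mulr_ge0 ?fej_ge0 ?sqrtr_ge0//.
  have t1 : 0 < 1 + `|t| by rewrite ltr_pwDl.
  have s0 : 0 < wgt t by rewrite sqrtr_gt0.
  apply: le_trans (ler_wpM2r (ltW s0) (fej_le a t)) _.
  rewrite le_eqVlt; apply/orP; left; apply/eqP; rewrite /G -/(wgt t).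
  have -> : 1 + `|t| = wgt t ^+ 2 by rewrite sqr_sqrtr// ltW.
  field; exact: lt0r_neq0.
apply: intgZl; apply: ge0_intg => //.
  by move=> t; rewrite invr_ge0 mulr_ge0 ?sqrtr_ge0// addr_ge0.
have G0 t : (0 <= (G `|t|)%:E)%E.
  by rewrite lee_fin invr_ge0 mulr_ge0 ?sqrtr_ge0// addr_ge0.
apply: (@le_lt_trans _ _ (\int[leb]_(t in `[0%R, +oo[) (G t)%:E +
    \int[leb]_(t in `[0%R, +oo[) (G t)%:E)%E); last first.
  by rewrite lte_add_pinfty// integral_G.
have mGE : measurable_fun setT (fun t : measurableTypeR R => (G `|t|)%:E).
  exact/measurable_EFinP.
have E : (\int[leb]_(t in `[0%R, +oo[) (G t)%:E = \int[leb]_(t in `[0%R, +oo[) (G `|t|)%:E)%E.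
  by apply: eq_integral => t; rewrite inE/= in_itv/= andbT => t0; rewrite ger0_norm.
have E2 : (\int[leb]_(t in `[0%R, +oo[) (G `|t|)%:E =
    \int[leb]_(t in `]-oo, 0%R]) (G `|t|)%:E)%E.
  rewrite ge0_integration_by_substitution0//.
  by apply: eq_integral => t _; rewrite normrN.
rewrite E {2}E2.
have m0 : measurable (`[0%R, +oo[%classic : set (measurableTypeR R)).
  exact: measurable_itv.
have -> : [set: measurableTypeR R] = `[0%R, +oo[%classic `|` ~` `[0%R, +oo[%classic.
  by rewrite setUv.
have mC := measurableC m0.
rewrite (ge0_integral_setU leb m0 mC); last 3 first.
- exact: measurable_funTS.
- by move=> t _; exact: G0.
- by apply/disj_set2P; rewrite setICr.
rewrite leeD2l//; apply: ge0_subset_integral => //.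
- exact: measurable_funTS.
- by move=> t /=; rewrite !in_itv/= andbT => /negP; rewrite -ltNge => /ltW.
Qed.

Lemma intg_fej a : intg leb (fej a).
Proof.
apply: le_intg (intg_fej_wgt a); first exact: measurable_fej.
by move=> t; rewrite ger0_norm ?fej_ge0// ler_peMr ?fej_ge0// wgt_ge1.
Qed.

(** The classical value is pi; the argument only uses that it is positive. *)
Definition fejC : R := \int[leb]_t fej 1 t.

Lemma Rintegral_fej a : \int[leb]_t fej a t = `|a| * fejC.
Proof.
wlog a0 : a / 0 <= a => [H|].
  have [/H//|/ltW a0] := leP 0 a.
  rewrite -normrN -H ?oppr_ge0//; apply: eq_Rintegral => t _; by rewrite fejN.
have [->|an0] := eqVneq a 0.
  rewrite normr0 mul0r /Rintegral integral0_eq// => t _.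
  by rewrite /fej mul0r cos0 subrr expr0n/= !mul0r if_same.
have ap : 0 < a by rewrite lt_neqAle eq_sym an0.
apply: EFin_inj; rewrite -intg_EFin; last exact: intg_fej.
rewrite (eq_integral (fun t : measurableTypeR R => (a ^+ 2)%:E * (fej 1 (a * t + 0))%:E)%E); last first.
  by move=> t _; rewrite addr0 fej_scale EFinM.
have mE : measurable_fun setT (fun t : measurableTypeR R => (fej 1 t)%:E).
  by apply/measurable_EFinP; exact: measurable_fej.
rewrite ge0_integralZl_EFin ?sqr_ge0//; last 2 first.
- by move=> t _; rewrite lee_fin fej_ge0.
- apply: (@measurableT_comp _ _ _ _ _ _ (fun t : measurableTypeR R => (fej 1 t)%:E)) => //.
  by apply: measurable_funD => //; exact: measurable_funM.
rewrite expr2 EFinM -muleA.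
have := @integral_leb_affine _ a 0 (fun t => (fej 1 t)%:E) ap mE.
rewrite /= => ->; last by move=> t; rewrite lee_fin fej_ge0.
by rewrite gtr0_norm// EFinM intg_EFin//; exact: intg_fej.
Qed.

Lemma fejC_gt0 : 0 < fejC.
Proof.
rewrite -lte_fin -intg_EFin; last exact: intg_fej.
have mE : measurable_fun setT (fun t : measurableTypeR R => (fej 1 t)%:E).
  by apply/measurable_EFinP; exact: measurable_fej.
apply: (@lt_le_trans _ _ (\int[leb]_(t in `[0%R, 1%R]) (8^-1)%:E)%E).
  rewrite integral_cst//= lebesgue_measure_itv/= lte_fin ltr01.
  by rewrite -EFinB -EFinM lte_fin subr0 mulr1 invr_gt0.
apply: (@le_trans _ _ (\int[leb]_(t in `[0%R, 1%R]) (fej 1 t)%:E)%E).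
  apply: sup_le_integral => t /=; rewrite in_itv/= => /andP[t0 t1].
    by rewrite lee_fin invr_ge0.
  rewrite lee_fin; have := @fej_ge 1 t ltr01.
  by rewrite expr1n !mul1r ger0_norm//; apply.
apply: ge0_subset_integral => //.
- by move=> t _; rewrite lee_fin fej_ge0.
Qed.

(** For d >= 0 this is a tent of height [fejC * d] supported on [-d, d]. The compact support serves
    both the localization and the Schur bound. *)
Definition fejF d u : R := fejC * ((`|u + d| + `|u - d|) / 2 - `|u|).

Lemma measurable_sinM u : measurable_fun setT (fun t : R => sin (t * u)).
Proof.
apply: measurableT_comp; last exact: measurable_funM.
by apply: continuous_measurable_fun; exact: continuous_sin.
Qed.

Lemma Rintegral_fej_cos d u : \int[leb]_t (fej d t * cos (t * u)) = fejF d u.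
Proof.
rewrite (@eq_Rintegral _ _ _ leb setT (fun t : measurableTypeR R =>
   2^-1 * (fej (u + d) t + fej (u - d) t) - fej u t)); last first.
  by move=> t _; rewrite fej_cos mulrC.
have i1 := intgZl 2^-1 (intgD (intg_fej (u + d)) (intg_fej (u - d))).
rewrite RintegralB//; last exact: intg_fej.
rewrite RintegralZl//; last exact: (intgD (intg_fej (u + d)) (intg_fej (u - d))).
rewrite RintegralD//; [|exact: intg_fej|exact: intg_fej].
by rewrite !Rintegral_fej /fejF; field.
Qed.

Lemma Rintegral_fej_sin d u : \int[leb]_t (fej d t * sin (t * u)) = 0.
Proof.
apply: Rintegral_odd; last by move=> t; rewrite fej_even mulNr sinN mulrN.
by apply: measurable_funM; [exact: measurable_fej|exact: measurable_sinM].
Qed.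

Lemma fejF_eq0 d u : 0 <= d -> d <= `|u| -> fejF d u = 0.
Proof.
move=> d0; rewrite ler_normr /fejF => /orP[] h.
  rewrite !ger0_norm; [|lra..].
  by rewrite (_ : _ - _ = 0) ?mulr0//; field.
rewrite !ler0_norm; [|lra..].
by rewrite (_ : _ - _ = 0) ?mulr0//; field.
Qed.

Lemma fejF_ge0 d u : 0 <= fejF d u.
Proof.
rewrite mulr_ge0 ?(ltW fejC_gt0)// subr_ge0 ler_pdivlMr//.
have := ler_normD (u + d) (u - d); rewrite addrACA subrr addr0 => h.
by rewrite mulr_natr -normrMn mulr2n.
Qed.

Lemma fejF_le d u : 0 <= d -> fejF d u <= fejC * d.
Proof.
move=> d0; rewrite ler_wpM2l ?(ltW fejC_gt0)//.
have := ler_normD u d; have := ler_normB u d; rewrite (ger0_norm d0); lra.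
Qed.

Lemma fejF0 d : 0 <= d -> fejF d 0 = fejC * d.
Proof.
by move=> d0; rewrite /fejF add0r sub0r normrN normr0 ger0_norm//; congr (_ * _); field.
Qed.

End Fejer.

(** * The product Fejer kernel *)

Section Trig.
Context {R : realType}.

(** Real and imaginary parts of e^{it}, indexed by a boolean so that one statement serves both. *)
Definition cs (b : bool) (t : R) : R := if b then cos t else sin t.

Lemma cs_le1 b t : `|cs b t| <= 1.
Proof. by case: b; [exact: cos_max|exact: sin_max]. Qed.

Lemma measurable_cs d (T : measurableType d) b (f : T -> R) :
  measurable_fun setT f -> measurable_fun setT (fun x => cs b (f x)).
Proof.
move=> mf; apply: (@measurableT_comp _ _ _ _ _ _ (cs b)) => //.
apply: continuous_measurable_fun.
by case: b; [exact: continuous_cos|exact: continuous_sin].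
Qed.

End Trig.

Section KernelRn.
Context {R : realType}.
Local Notation leb := (@lebesgue_measure R).
Implicit Types n : nat.

Lemma behead_cons n (t : R) (x : n.-tuple R) : [tuple of behead (cons_tuple t x)] = x.
Proof. exact/val_inj. Qed.

Lemma tuple_consE n (x : n.+1.-tuple R) :
  x = cons_tuple (tnth x ord0) [tuple of behead x].
Proof. by case/tupleP: x => t x; rewrite behead_cons tnth_cons0. Qed.

Lemma tnth_beheadE n (x : n.+1.-tuple R) i :
  tnth [tuple of behead x] i = tnth x (lift ord0 i).
Proof. by rewrite [in RHS](tuple_consE x) tnth_consS. Qed.

Lemma dotp_behead n (x u : n.+1.-tuple R) :
  dotp x u = tnth x ord0 * tnth u ord0 +
             dotp [tuple of behead x] [tuple of behead u].
Proof.
rewrite /dotp big_ord_recl; congr (_ + _).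
by apply: eq_bigr => i _; rewrite !tnth_beheadE.
Qed.

(** A product kernel rather than a radial one: its transform factors into tents and is supported in
    a cube, and every computation reduces to the line. *)
Definition phi n d (x : n.-tuple R) : R := \prod_(i < n) fej d (tnth x i).

Definition phiF n d (u : n.-tuple R) : R := \prod_(i < n) fejF d (tnth u i).

Lemma phi_behead n d (x : n.+1.-tuple R) :
  phi d x = fej d (tnth x ord0) * phi d [tuple of behead x].
Proof.
rewrite /phi big_ord_recl; congr (_ * _).
by apply: eq_bigr => i _; rewrite tnth_beheadE.
Qed.

Lemma phi_ge0 n d (x : n.-tuple R) : 0 <= phi d x.
Proof. by apply: prodr_ge0 => i _; exact: fej_ge0. Qed.

Lemma measurable_phi n d : measurable_fun setT (@phi n d).
Proof.
by apply: (@measurable_fun_coord R n (fun=> fej d)) => i; exact: measurable_fej.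
Qed.

Lemma intg_phi n d : intg (lebN n) (@phi n d).
Proof.
apply: ge0_intg; [exact: measurable_phi|exact: phi_ge0|].
have mf (i : 'I_n) : measurable_fun setT (fej d) by exact: measurable_fej.
have f0 (i : 'I_n) t : 0 <= fej d t by exact: fej_ge0.
have fc (i : 'I_n) : (\int[leb]_t (fej d t)%:E = (`|d| * fejC)%:E)%E.
  by rewrite (intg_EFin (intg_fej d)) Rintegral_fej.
by rewrite (integral_prod_coord mf f0 fc) ltry.
Qed.

Lemma intg_phi_wgt n d :
  intg (lebN n) (fun x => phi d x * \prod_(i < n) wgt (tnth x i)).
Proof.
rewrite (_ : (fun x => _) = (fun x : n.-tuple R => \prod_(i < n) (fej d (tnth x i) * wgt (tnth x i)))).
  apply: ge0_intg.
  - apply: (@measurable_fun_coord _ n (fun _ t => fej d t * wgt t)) => i.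
    by apply: measurable_funM; [exact: measurable_fej|exact: measurable_wgt].
  - by move=> x; apply: prodr_ge0 => i _; rewrite mulr_ge0 ?fej_ge0 ?sqrtr_ge0.
  have mf (i : 'I_n) : measurable_fun setT (fun t => fej d t * wgt t).
    by apply: measurable_funM; [exact: measurable_fej|exact: measurable_wgt].
  have f0 (i : 'I_n) t : 0 <= fej d t * wgt t by rewrite mulr_ge0 ?fej_ge0 ?sqrtr_ge0.
  have fc (i : 'I_n) := intg_EFin (intg_fej_wgt d).
  by rewrite (integral_prod_coord mf f0 fc) ltry.
by apply/funext => x; rewrite -big_split.
Qed.

Lemma intg_phi_cs n d b (u : n.-tuple R) :
  intg (lebN n) (fun x => phi d x * cs b (dotp x u)).
Proof.
apply: (intgM_bd (M := 1)); first exact: intg_phi.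
  by apply: measurable_cs; apply: measurable_dotp.
by move=> x; exact: cs_le1.
Qed.

(** The addition formulas split off the first coordinate, and every term with a sine factor vanishes
    by parity. *)
Lemma Rintegral_phi_cs n d b (u : n.-tuple R) :
  \int[lebN n]_x (phi d x * cs b (dotp x u)) = if b then phiF d u else 0.
Proof.
elim: n u b => [|n ih] u b.
  rewrite /Rintegral integral_lebN0; last first.
    by apply/measurable_EFinP; exact: (intg_measurable (intg_phi_cs d b u)).
  by rewrite /phi /phiF /dotp !big_ord0 mul1r; case: b; rewrite /cs ?cos0 ?sin0.
pose u' := [tuple of behead u]; pose u0 := tnth u ord0.
have i1 b' : intg leb (fun t => fej d t * cs b' (t * u0)).
  apply: (intgM_bd (M := 1)); first exact: intg_fej.
    by apply: measurable_cs; apply: measurable_funM.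
  by move=> t; exact: cs_le1.
have i2 b' : intg (lebN n) (fun x => phi d x * cs b' (dotp x u')) by exact: intg_phi_cs.
have H b1 b2 := intg_cons (i1 b1) (i2 b2).
have E b1 : \int[leb]_t (fej d t * cs b1 (t * u0)) = if b1 then fejF d u0 else 0.
  by case: b1; [exact: Rintegral_fej_cos|exact: Rintegral_fej_sin].
have FE : phiF d u = fejF d u0 * phiF d u'.
  rewrite /phiF big_ord_recl; congr (_ * _).
  by apply: eq_bigr => i _; rewrite tnth_beheadE.
case: b.
- rewrite (@eq_Rintegral _ _ _ _ _ (fun x : n.+1.-tuple R =>
   (fej d (tnth x ord0) * cs true (tnth x ord0 * u0)) *
   (phi d [tuple of behead x] * cs true (dotp [tuple of behead x] u')) -
   (fej d (tnth x ord0) * cs false (tnth x ord0 * u0)) *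
   (phi d [tuple of behead x] * cs false (dotp [tuple of behead x] u')))); last first.
    by move=> x _; rewrite phi_behead dotp_behead /cs cosD; ring.
  rewrite RintegralB//; [|exact: (H true true).1|exact: (H false false).1].
  by rewrite (H true true).2 (H false false).2 !E !ih mul0r subr0 FE.
- rewrite (@eq_Rintegral _ _ _ _ _ (fun x : n.+1.-tuple R =>
   (fej d (tnth x ord0) * cs false (tnth x ord0 * u0)) *
   (phi d [tuple of behead x] * cs true (dotp [tuple of behead x] u')) +
   (fej d (tnth x ord0) * cs true (tnth x ord0 * u0)) *
   (phi d [tuple of behead x] * cs false (dotp [tuple of behead x] u')))); last first.
    by move=> x _; rewrite phi_behead dotp_behead /cs sinD; ring.
  rewrite RintegralD//; [|exact: (H false true).1|exact: (H true false).1].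
  by rewrite (H false true).2 (H true false).2 !E !ih mul0r mulr0 addr0.
Qed.

Definition tadd n (x y : n.-tuple R) := [tuple tnth x i + tnth y i | i < n].
Definition tsub n (x y : n.-tuple R) := [tuple tnth x i - tnth y i | i < n].

Lemma dotpDl n (x y z : n.-tuple R) : dotp (tadd x y) z = dotp x z + dotp y z.
Proof.
by rewrite /dotp -big_split; apply: eq_bigr => i _; rewrite tnth_mktuple mulrDl.
Qed.

Lemma dotpBl n (x y z : n.-tuple R) : dotp (tsub x y) z = dotp x z - dotp y z.
Proof.
by rewrite /dotp -sumrB; apply: eq_bigr => i _; rewrite tnth_mktuple mulrBl.
Qed.

Lemma dotpC n (x y : n.-tuple R) : dotp x y = dotp y x.
Proof. by apply: eq_bigr => i _; rewrite mulrC. Qed.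

Lemma measurable_tadd d (T : measurableType d) n (f g : T -> n.-tuple R) :
  measurable_fun setT f -> measurable_fun setT g ->
  measurable_fun setT (fun x => tadd (f x) (g x)).
Proof.
move=> mf mg; apply: measurable_tuple => i; apply: measurable_funD.
  by apply: (measurableT_comp (measurable_tnth i)).
by apply: (measurableT_comp (measurable_tnth i)).
Qed.

Lemma measurable_tsub d (T : measurableType d) n (f g : T -> n.-tuple R) :
  measurable_fun setT f -> measurable_fun setT g ->
  measurable_fun setT (fun x => tsub (f x) (g x)).
Proof.
move=> mf mg; apply: measurable_tuple => i; apply: measurable_funB.
  by apply: (measurableT_comp (measurable_tnth i)).
by apply: (measurableT_comp (measurable_tnth i)).
Qed.

Lemma tadd_cons n (t : R) (x : n.-tuple R) (v : n.+1.-tuple R) :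
  tadd (cons_tuple t x) v = cons_tuple (t + tnth v ord0) (tadd x [tuple of behead v]).
Proof.
apply: eq_from_tnth => i; rewrite tnth_mktuple.
case: (unliftP ord0 i) => [j ->|->]; last by rewrite !tnth_cons0.
by rewrite !tnth_consS tnth_mktuple tnth_beheadE.
Qed.

Lemma integral_lebN_shift n (v : n.-tuple R) (h : n.-tuple R -> \bar R) :
  measurable_fun setT h -> (forall x, 0 <= h x)%E ->
  (\int[lebN n]_x h (tadd x v) = \int[lebN n]_x h x)%E.
Proof.
elim: n v h => [|n ih] v h mh h0.
  by apply: eq_integral => x _; congr h; apply: eq_from_tnth => -[].
have mhc t : measurable_fun setT (fun x => h (cons_tuple t x)).
  by apply: (measurableT_comp mh); apply: measurable_cons.
rewrite integral_lebN_cons//; last first.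
  by apply: (measurableT_comp mh); exact: measurable_tadd.
rewrite integral_lebN_cons//.
pose H (t : R) := (\int[lebN n]_x h (cons_tuple t x))%E.
rewrite (eq_integral (fun t : measurableTypeR R => H (1 * t + tnth v ord0))); last first.
  move=> t _; under eq_integral do rewrite tadd_cons.
  rewrite (ih _ (fun x => h (cons_tuple (t + tnth v ord0) x)))//.
  by rewrite mul1r.
have := @integral_leb_affine _ 1 (tnth v ord0) H ltr01.
rewrite mul1e; apply; last by move=> t; apply: integral_ge0.
apply: (@measurable_fun_fubini_tonelli_F _ _ _ _ _ (lebN n)
  (fun z : measurableTypeR R * n.-tuple R => h (cons_tuple (z.1 : R) z.2))) => //.
by apply: (measurableT_comp mh); exact: measurable_consp.
Qed.

Lemma intg_shift n (v : n.-tuple R) (f : n.-tuple R -> R) : intg (lebN n) f ->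
  intg (lebN n) (fun x => f (tadd x v)) /\
  \int[lebN n]_x f (tadd x v) = \int[lebN n]_x f x.
Proof.
move=> fi; have mf := intg_measurable fi.
have mEf : measurable_fun setT (EFin \o f) by exact/measurable_EFinP.
have mfv : measurable_fun setT (fun x => f (tadd x v)).
  by apply: (measurableT_comp mf); exact: measurable_tadd.
split.
  apply/integrableP; split; first exact/measurable_EFinP.
  rewrite (@integral_lebN_shift n v (fun x => `|(f x)%:E|)%E)//.
    by case/integrableP: fi.
  exact: measurableT_comp.
rewrite /Rintegral integralE [in RHS]integralE.
congr (fine (_ - _)%E).
  rewrite -[RHS](@integral_lebN_shift n v)//; last exact: measurable_funepos.
  by apply: eq_integral => x _; rewrite !funeposE.
rewrite -[RHS](@integral_lebN_shift n v)//; last exact: measurable_funeneg.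
by apply: eq_integral => x _; rewrite !funenegE.
Qed.

End KernelRn.

(** * Volume of annuli in cubes *)

Section Annulus.
Context {R : realType}.
Local Notation leb := (@lebesgue_measure R).
Implicit Types n : nat.

Lemma measurable_boolR d (T : measurableType d) (b : T -> bool) :
  measurable_fun setT b -> measurable_fun setT (fun x => (b x)%:R : R).
Proof.
move=> mb; rewrite (_ : (fun x => _) = (fun x => if b x then 1 else 0)).
  exact: measurable_fun_ifT.
by apply/funext => x; case: (b x).
Qed.

Lemma integral_boolR (b : R -> bool) : measurable_fun setT b ->
  (\int[leb]_t ((b t)%:R)%:E = leb [set t | b t])%E.
Proof.
move=> mb; have mB : measurable ([set t | b t] : set (measurableTypeR R)).
  by rewrite -[X in measurable X]setTI; exact: mb.
rewrite -[RHS]mul1e -[RHS](@integral_cst _ _ _ leb [set t | b t] mB 1%E).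
rewrite [RHS]integral_mkcond; apply: eq_integral => t _.
rewrite patchE; case: ifPn => [/set_mem/= ->//|/negP tb].
by rewrite (_ : b t = false)//; apply/negP => bt; apply: tb; exact/mem_set.
Qed.

Definition cubeI n (d : R) (x y : n.-tuple R) : R :=
  \prod_(i < n) (`|tnth x i - tnth y i| <= d)%R%:R.

Lemma cubeI_ge0 n d (x y : n.-tuple R) : 0 <= cubeI d x y.
Proof. by apply: prodr_ge0 => i _; rewrite ler0n. Qed.

Lemma measurable_cubeI1 d (a : R) :
  measurable_fun setT (fun t : R => (`|a - t| <= d)%R%:R : R).
Proof.
apply: measurable_boolR; apply: measurable_fun_ler => //.
by apply: measurableT_comp => //; apply: measurable_funB.
Qed.

Lemma measurable_cubeI n d (x : n.-tuple R) : measurable_fun setT (cubeI d x).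
Proof.
apply: (@measurable_fun_coord R n (fun i t => (`|tnth x i - t| <= d)%R%:R)) => i.
exact: measurable_cubeI1.
Qed.

Lemma integral_cubeI1 d (a : R) : 0 <= d ->
  (\int[leb]_t ((`|a - t| <= d)%R%:R)%:E = (2 * d)%:E)%E.
Proof.
move=> d0; rewrite integral_boolR; last first.
  apply: measurable_fun_ler => //.
  by apply: measurableT_comp => //; apply: measurable_funB.
rewrite (_ : [set t | _] = `[a - d, a + d]%classic); last first.
  by apply/seteqP; split => t /=; rewrite in_itv/= ler_distlC.
rewrite lebesgue_measure_itv/= lte_fin; case: ifPn => h.
  by rewrite -EFinB; congr EFin; ring.
by rewrite (_ : d = 0) ?mulr0//; lra.
Qed.

Lemma integral_cubeI n d (x : n.-tuple R) : 0 <= d ->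
  (\int[lebN n]_y (cubeI d x y)%:E = ((2 * d) ^+ n)%:E)%E.
Proof.
move=> d0.
have mf (i : 'I_n) := measurable_cubeI1 d (tnth x i).
have f0 (i : 'I_n) (t : R) : 0 <= (`|tnth x i - t| <= d)%R%:R :> R by rewrite ler0n.
have fc (i : 'I_n) := integral_cubeI1 (tnth x i) d0.
by rewrite (integral_prod_coord mf f0 fc) prodr_const card_ord.
Qed.

Lemma measurable_sqr_itv (a b : R) :
  measurable_fun [set: measurableTypeR R] (fun t : R => (a <= t ^+ 2) && (t ^+ 2 < b)).
Proof.
have m2 : measurable_fun [set: measurableTypeR R] (fun t : R => t ^+ 2 : R).
  by apply: measurable_funX; exact: measurable_id.
by apply: measurable_and; [apply: measurable_fun_ler|apply: measurable_fun_ltr].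
Qed.

(** Since [Num.sqrt] is 0 on negative reals, the bound also covers negative [a], where the two
    intervals meet at 0. *)
Lemma sqrt_itv_le (a b : R) : a <= b ->
  (leb [set t | (a <= t ^+ 2 < b)%R] <= (2 * (Num.sqrt b - Num.sqrt a))%:E)%E.
Proof.
move=> ab; set X := Num.sqrt b; set Y := Num.sqrt a.
have YX : Y <= X by exact: ler_wsqrtr.
apply: (@le_trans _ _ (leb (`[Y, X]%classic `|` `[- X, - Y]%classic))).
  apply: le_measure; rewrite ?inE.
  - have := measurable_sqr_itv a b.
    by move=> /(_ measurableT [set true]); rewrite setTI; exact.
  - by apply: measurableU; exact: measurable_itv.
  move=> t /= /andP[h1 h2]; rewrite !in_itv/=.
  have Yt : Y <= `|t| by rewrite -sqrtr_sqr; exact: ler_wsqrtr.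
  have tX : `|t| <= X by rewrite -sqrtr_sqr; apply: ler_wsqrtr; exact: ltW.
  have [t0|t0] := leP 0 t.
    by left; rewrite -(ger0_norm t0) Yt tX.
  by right; rewrite -[t]opprK -(ltr0_norm t0) !lerN2 Yt tX.
have m1 : measurable (`[Y, X]%classic : set (measurableTypeR R)) by exact: measurable_itv.
have m2 : measurable (`[- X, - Y]%classic : set (measurableTypeR R)) by exact: measurable_itv.
apply: le_trans (measureU2 leb m1 m2) _.
have e (u v : R) : u <= v -> leb `[u, v]%classic = (v - u)%:E.
  move=> uv; rewrite lebesgue_measure_itv/= lte_fin; case: ifPn => h.
    by rewrite -EFinB.
  by congr EFin; move: h; rewrite -leNgt; lra.
rewrite [X in (X + _)%E](e _ _ YX) [X in (_ + X)%E](e _ _ _) ?lerN2//.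
rewrite -EFinD lee_fin; lra.
Qed.

(** A difference of roots is b - a divided by the sum of the roots. Subtracting [s] from both
    arguments keeps b - a, and it shrinks each root by a factor of at most 2 because s is at most
    half of either argument. *)
Lemma sqrt_sub_le (a b s : R) : a <= b -> 0 <= s -> s <= a / 2 ->
  Num.sqrt (b - s) - Num.sqrt (a - s) <= 2 * (Num.sqrt b - Num.sqrt a).
Proof.
move=> ab s0 sa.
have Hs c : s <= c / 2 -> Num.sqrt c <= 2 * Num.sqrt (c - s).
  move=> sc; rewrite -[2]ger0_norm// -sqrtr_sqr -sqrtrM ?sqr_ge0//.
  apply: ler_wsqrtr; lra.
have hb := Hs b; have ha := Hs a sa.
have {}hb : Num.sqrt b <= 2 * Num.sqrt (b - s) by apply: hb; lra.
have eb : Num.sqrt b ^+ 2 = b by rewrite sqr_sqrtr//; lra.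
have ea : Num.sqrt a ^+ 2 = a by rewrite sqr_sqrtr//; lra.
have ebs : Num.sqrt (b - s) ^+ 2 = b - s by rewrite sqr_sqrtr//; lra.
have eas : Num.sqrt (a - s) ^+ 2 = a - s by rewrite sqr_sqrtr//; lra.
have YX : Num.sqrt a <= Num.sqrt b by exact: ler_wsqrtr.
have yx : Num.sqrt (a - s) <= Num.sqrt (b - s) by apply: ler_wsqrtr; lra.
have := sqrtr_ge0 a; have := sqrtr_ge0 (a - s).
move: YX yx ha hb eb ea ebs eas.
move: (Num.sqrt a) (Num.sqrt b) (Num.sqrt (a - s)) (Num.sqrt (b - s)) => Y X y x.
move=> YX yx ha hb eb ea ebs eas y0 Y0.
have [XY0|XY0] := eqVneq (X + Y) 0.
  have -> : X = 0 by lra.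
  have -> : Y = 0 by lra.
  have -> : x = 0 by have : X = 0 by [lra]; nra.
  lra.
have XYp : 0 < X + Y by rewrite lt_neqAle eq_sym XY0/=; lra.
rewrite -(ler_pM2r XYp) -mulrA.
have -> : (X - Y) * (X + Y) = (x - y) * (x + y) by ring: eb ea ebs eas.
rewrite mulrCA ler_wpM2l; lra.
Qed.

(** Along a coordinate that carries at least half of the inner squared radius the spheres are
    crossed transversally, so the slice is not much thicker than the annulus. *)
Lemma annulus_section_le (a b s : R) : a <= b -> 0 <= s ->
  (\int[leb]_t (((a / 2 <= t ^+ 2) && (a <= t ^+ 2 + s < b))%R%:R)%:E
    <= (4 * (Num.sqrt b - Num.sqrt a))%:E)%E.
Proof.
move=> ab s0.
have D0 : 0 <= Num.sqrt b - Num.sqrt a by rewrite subr_ge0 ler_wsqrtr.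
(* Both lower bounds on t^2, namely a / 2 and a - s, merge into [a']. *)
pose a' := Num.max (a / 2) (a - s).
have [ba|ab'] := leP (b - s) a'.
  rewrite integral0_eq ?lee_fin ?mulr_ge0// => t _.
  case: andP => // -[h1 /andP[h2 h3]]; exfalso.
  by move: ba; rewrite le_max => /orP[]; lra.
apply: (@le_trans _ _ (\int[leb]_t (((a' <= t ^+ 2 < b - s)%R)%:R)%:E)%E).
  apply: sup_le_integral => t _; first by rewrite lee_fin ler0n.
  rewrite lee_fin ler_nat; case: andP => // -[h1 /andP[h2 h3]].
  by rewrite ge_max h1 lerBlDr h2 ltrBrDr h3.
rewrite integral_boolR; last first.
  exact: measurable_sqr_itv.
apply: le_trans (sqrt_itv_le (ltW ab')) _.
suff : Num.sqrt (b - s) - Num.sqrt a' <= 2 * (Num.sqrt b - Num.sqrt a).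
  by rewrite lee_fin; lra.
have [sa|sa] := leP s (a / 2).
  by rewrite /a' max_r; [exact: sqrt_sub_le|lra].
rewrite /a' max_l; last lra.
have [a0|a0] := leP 0 a.
  have := @sqrt_sub_le a b (a / 2) ab.
  have -> : a - a / 2 = a / 2 by lra.
  have : Num.sqrt (b - s) <= Num.sqrt (b - a / 2) by apply: ler_wsqrtr; lra.
  by move=> h /(_ _ (lexx _)) h'; have : 0 <= a / 2 by [lra]; move=> /h'; lra.
rewrite [Num.sqrt a]ltr0_sqrtr// [Num.sqrt (a / 2)]ltr0_sqrtr; last lra.
have := sqrtr_ge0 b.
have : Num.sqrt (b - s) <= Num.sqrt b by apply: ler_wsqrtr; lra.
lra.
Qed.

(** Here [a] and [b] are squared radii: fixing one coordinate t then just shifts both by t^2, which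
    suits induction on the dimension. *)
Definition annI n (d a b : R) (x y : n.-tuple R) : R :=
  (a <= dotp y y < b)%R%:R * cubeI d x y.

Lemma annI_ge0 n d a b (x y : n.-tuple R) : 0 <= annI d a b x y.
Proof. by rewrite mulr_ge0 ?ler0n ?cubeI_ge0. Qed.

Lemma dotp_ge0 n (x : n.-tuple R) : 0 <= dotp x x.
Proof. by apply: sumr_ge0 => i _; rewrite -expr2 sqr_ge0. Qed.

Lemma cubeI_behead n d (x y : n.+1.-tuple R) :
  cubeI d x y = (`|tnth x ord0 - tnth y ord0| <= d)%R%:R *
    cubeI d [tuple of behead x] [tuple of behead y].
Proof.
rewrite /cubeI big_ord_recl; congr (_ * _).
by apply: eq_bigr => i _; rewrite !tnth_beheadE.
Qed.

Lemma measurable_annI n d (x : n.-tuple R) d' (T : measurableType d')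
    (a b : T -> R) (f : T -> n.-tuple R) :
  measurable_fun setT a -> measurable_fun setT b -> measurable_fun setT f ->
  measurable_fun setT (fun y => annI d (a y) (b y) x (f y)).
Proof.
move=> ma mb mf; apply: measurable_funM.
  apply: measurable_boolR; apply: measurable_and.
    by apply: measurable_fun_ler => //; exact: measurable_dotp.
  by apply: measurable_fun_ltr => //; exact: measurable_dotp.
exact: (measurableT_comp (measurable_cubeI d x)).
Qed.

(** Where the first coordinate t satisfies t^2 < a / 2, the slice in the other coordinates is an
    annulus whose thickness at most doubles, which gives 2 C; elsewhere the slice is taken along t
    itself, which gives 4. In the first case a - t^2 is positive, so the induction hypothesis is
    only asked for positive inner radii. *)
Lemma annulus_step n (C d a b : R) (x : n.+1.-tuple R) :
  0 <= C -> 0 <= d -> 2 * d <= 1 -> a <= b ->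
  (forall (a b : R) (x : n.-tuple R), 0 < a -> a <= b ->
    (\int[lebN n]_y (annI d a b x y)%:E <= (C * (Num.sqrt b - Num.sqrt a))%:E)%E) ->
  (\int[lebN n.+1]_y (annI d a b x y)%:E <=
    ((2 * C + 4) * (Num.sqrt b - Num.sqrt a))%:E)%E.
Proof.
move=> C0 d0 d1 ab ih.
have D0 : 0 <= Num.sqrt b - Num.sqrt a by rewrite subr_ge0 ler_wsqrtr.
set D := Num.sqrt b - Num.sqrt a in D0 *.
pose x0 := tnth x ord0; pose x' := [tuple of behead x].
pose f1 (y : n.+1.-tuple R) : R := ((tnth y ord0) ^+ 2 < a / 2)%R%:R *
  (`|x0 - tnth y ord0| <= d)%R%:R *
  annI d (a - (tnth y ord0) ^+ 2) (b - (tnth y ord0) ^+ 2) x' [tuple of behead y].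
pose f2 (y : n.+1.-tuple R) : R := cubeI d x' [tuple of behead y] *
  ((a / 2 <= (tnth y ord0) ^+ 2) &&
   (a <= (tnth y ord0) ^+ 2 + dotp [tuple of behead y] [tuple of behead y] < b))%R%:R.
have f10 y : 0 <= f1 y by apply: mulr_ge0; [apply: mulr_ge0; exact: ler0n|exact: annI_ge0].
have f20 y : 0 <= f2 y by apply: mulr_ge0; [exact: cubeI_ge0|exact: ler0n].
have mt : measurable_fun setT (fun y : n.+1.-tuple R => tnth y ord0 ^+ 2).
  by apply: measurable_funX; exact: measurable_tnth.
have mbh := @measurable_behead _ R n.
have mf1 : measurable_fun setT f1.
  apply: measurable_funM.
    apply: measurable_funM.
      by apply: measurable_boolR; apply: measurable_fun_ltr.
    by apply: (measurableT_comp (measurable_cubeI1 d x0)); exact: measurable_tnth.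
  by apply: measurable_annI => //; apply: measurable_funB.
have mf2 : measurable_fun setT f2.
  apply: measurable_funM.
    exact: (measurableT_comp (measurable_cubeI d x')).
  have md : measurable_fun setT (fun y : n.+1.-tuple R => tnth y ord0 ^+ 2 +
      dotp [tuple of behead y] [tuple of behead y]).
    by apply: measurable_funD => //; exact: measurable_dotp.
  apply: measurable_boolR; apply: measurable_and; first exact: measurable_fun_ler.
  by apply: measurable_and; [exact: measurable_fun_ler|exact: measurable_fun_ltr].
apply: (@le_trans _ _ (\int[lebN n.+1]_y ((f1 y)%:E + (f2 y)%:E))%E).
  apply: sup_le_integral => y _; first by rewrite lee_fin annI_ge0.
  rewrite -EFinD lee_fin /annI dotp_behead cubeI_behead /f1 /f2 /annI -/x0 -/x' -expr2.
  set t2 := tnth y ord0 ^+ 2; set s := dotp _ _; set c := cubeI _ _ _.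
  have c0 : 0 <= c by exact: cubeI_ge0.
  have -> : (a - t2 <= s < b - t2) = (a <= t2 + s < b).
    by rewrite lerBlDl ltrBrDl.
  rewrite [a / 2 <= t2]leNgt.
  case: (a <= t2 + s < b); case: (`|_| <= d); case: (t2 < a / 2) => /=; lra.
rewrite ge0_integralD//; last 4 first.
- by move=> y _; rewrite lee_fin.
- exact/measurable_EFinP.
- by move=> y _; rewrite lee_fin.
- exact/measurable_EFinP.
have -> : (2 * C + 4) * D = 2 * C * D + 4 * D by ring.
rewrite EFinD; apply: leeD.
- rewrite integral_lebN_cons//; last exact/measurable_EFinP.
  apply: (@le_trans _ _ (\int[lebesgue_measure]_t
      ((2 * C * D)%:E * ((`|x0 - t| <= d)%R%:R)%:E))%E); last first.
    rewrite ge0_integralZl_EFin ?mulr_ge0//; last first.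
      by apply/measurable_EFinP; exact: measurable_cubeI1.
    by rewrite integral_cubeI1// -EFinM lee_fin ler_piMr// !mulr_ge0.
  apply: sup_le_integral => t _; first by apply: integral_ge0 => y _; rewrite lee_fin.
  pose q : R := (t ^+ 2 < a / 2)%R%:R * (`|x0 - t| <= d)%R%:R.
  rewrite (eq_integral (fun y => q%:E * (annI d (a - t ^+ 2) (b - t ^+ 2) x' y)%:E)%E); last first.
    by move=> y _; rewrite /f1 tnth_cons0 behead_cons EFinM.
  rewrite ge0_integralZl_EFin ?mulr_ge0 ?ler0n//; last 2 first.
  + by move=> y _; rewrite lee_fin annI_ge0.
  + by apply/measurable_EFinP; exact: measurable_annI.
  rewrite /q; case: ltP => ta; last by rewrite !mul0r mul0e mule_ge0// lee_fin ?mulr_ge0 ?ler0n.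
  rewrite mul1r muleC lee_wpmul2r// ?lee_fin ?ler0n//.
  have t0 := sqr_ge0 t.
  apply: le_trans (ih _ _ _ _ _) _; [lra|lra|].
  rewrite lee_fin -mulrA mulrCA ler_wpM2l//.
  by apply: sqrt_sub_le => //; exact: ltW.
(* The order is swapped so that the inner integral runs over the first coordinate. *)
- rewrite integral_lebN_cons_swap//; last exact/measurable_EFinP.
  apply: (@le_trans _ _ (\int[lebN n]_y ((4 * D)%:E * (cubeI d x' y)%:E))%E); last first.
    rewrite ge0_integralZl_EFin ?mulr_ge0//; last 2 first.
    + by move=> t _; rewrite lee_fin cubeI_ge0.
    + by apply/measurable_EFinP; exact: measurable_cubeI.
    rewrite integral_cubeI// -EFinM lee_fin ler_piMr ?mulr_ge0//.
    by rewrite exprn_ile1// mulr_ge0.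
  apply: sup_le_integral => y _; first by apply: integral_ge0 => t _; rewrite lee_fin.
  rewrite (eq_integral (fun t : measurableTypeR R => (cubeI d x' y)%:E *
     (((a / 2 <= t ^+ 2) && (a <= t ^+ 2 + dotp y y < b))%R%:R)%:E)%E); last first.
    by move=> t _; rewrite /f2 tnth_cons0 behead_cons EFinM.
  rewrite ge0_integralZl_EFin ?cubeI_ge0//; last first.
    apply/measurable_EFinP/measurable_boolR.
    have md : measurable_fun setT (fun t : measurableTypeR R => t ^+ 2 : R).
      exact: measurable_funX.
    have md' : measurable_fun setT (fun t : measurableTypeR R => t ^+ 2 + dotp y y : R).
      exact: measurable_funD.
    apply: measurable_and; first exact: measurable_fun_ler.
    by apply: measurable_and; [exact: measurable_fun_ler|exact: measurable_fun_ltr].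
  rewrite muleC lee_wpmul2r ?lee_fin ?cubeI_ge0//.
  by apply: annulus_section_le => //; exact: dotp_ge0.
Qed.

(** Dimension 0 is the reason for 0 < a: the space is one point of mass 1 at the origin, which lies
    in no annulus of positive inner radius. *)
Lemma annulus_pos_le n (d : R) : 0 <= d -> 2 * d <= 1 ->
  exists2 C : R, 0 <= C & forall (a b : R) (x : n.-tuple R), 0 < a -> a <= b ->
    (\int[lebN n]_y (annI d a b x y)%:E <= (C * (Num.sqrt b - Num.sqrt a))%:E)%E.
Proof.
move=> d0 d1; elim: n => [|n [C C0 ih]].
  exists 0 => // a b x a0 ab; rewrite mul0r integral0_eq// => y _.
  by rewrite /annI /dotp big_ord0 leNgt a0 mul0r.
exists (2 * C + 4); first by rewrite addr_ge0 ?mulr_ge0.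
by move=> a b x a0 ab; exact: annulus_step.
Qed.

Lemma annulus_le n (d : R) : 0 <= d -> 2 * d <= 1 ->
  exists2 C : R, 0 <= C & forall (a b : R) (x : n.+1.-tuple R), a <= b ->
    (\int[lebN n.+1]_y (annI d a b x y)%:E <= (C * (Num.sqrt b - Num.sqrt a))%:E)%E.
Proof.
move=> d0 d1; have [C C0 ih] := annulus_pos_le n d0 d1.
exists (2 * C + 4); first by rewrite addr_ge0 ?mulr_ge0.
by move=> a b x ab; exact: annulus_step.
Qed.

End Annulus.

(** * Energy identity and Schur bound *)

Section Energy.
Context {R : realType} (n : nat).
Local Notation X := (n.-tuple R).
Implicit Types (g : X -> R) (x xi : X).

Definition FT (b : bool) g x : R := \int[lebN n]_xi (g xi * cs b (dotp x xi)).

Lemma intg_cs b g x : intg (lebN n) g -> intg (lebN n) (fun xi => g xi * cs b (dotp x xi)).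
Proof.
move=> gi; apply: (intgM_bd (M := 1)) => //; last by move=> y; exact: cs_le1.
by apply: measurable_cs; exact: measurable_dotp.
Qed.

Lemma measurable_dotp2 : measurable_fun setT (fun z : X * X => dotp z.1 z.2).
Proof. by apply: measurable_dotp. Qed.

Lemma measurable_FT b g : intg (lebN n) g -> measurable_fun setT (FT b g).
Proof.
move=> gi; apply: (@measurable_Rintegral _ _ _ _ _ (lebN n)
  (fun z : X * X => g z.2 * cs b (dotp z.1 z.2))); last by move=> x; exact: intg_cs.
apply: measurable_funM; first exact: (measurableT_comp (intg_measurable gi)).
by apply: measurable_cs; exact: measurable_dotp2.
Qed.

Lemma FT_bd b g x : intg (lebN n) g -> `|FT b g x| <= \int[lebN n]_xi `|g xi|.
Proof.
move=> gi; apply: le_trans (le_normr_Rintegral measurableT (intg_cs b x gi)) _.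
apply: le_Rintegral => //.
- exact: (intg_norm (intg_cs b x gi)).
- exact: intg_norm.
- by move=> xi _; rewrite normrM ler_piMr// cs_le1.
Qed.

(** Expanding the squares with the formula for cos(s - t) and integrating in x first leaves only the
    transform of the kernel. A weighted L2 norm of a transform becomes a quadratic form in [g]
    itself. *)
Lemma energyE (d : R) g : intg (lebN n) g ->
  \int[lebN n]_x (phi d x * (FT true g x ^+ 2 + FT false g x ^+ 2)) =
  \int[lebN n]_xi (g xi * \int[lebN n]_eta (g eta * phiF d (tsub xi eta))).
Proof.
move=> gi; set G := \int[lebN n]_xi `|g xi|.
pose K1 (z : X * X) := cs true (dotp z.1 z.2) * FT true g z.1 +
                       cs false (dotp z.1 z.2) * FT false g z.1.
have mFT b : measurable_fun setT (fun z : X * X => FT b g z.1).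
  exact: (measurableT_comp (measurable_FT b gi)).
have mcs b : measurable_fun setT (fun z : X * X => cs b (dotp z.1 z.2)).
  by apply: measurable_cs; exact: measurable_dotp2.
have mK1 : measurable_fun setT K1.
  by apply: measurable_funD; apply: measurable_funM.
have K1M z : `|K1 z| <= G + G.
  apply: le_trans (ler_normD _ _) _; apply: lerD; rewrite normrM.
    by rewrite -[leRHS]mul1r ler_pM ?cs_le1 ?FT_bd.
  by rewrite -[leRHS]mul1r ler_pM ?cs_le1 ?FT_bd.
transitivity (\int[lebN n]_x (phi d x * \int[lebN n]_xi (g xi * K1 (x, xi)))).
  apply: eq_Rintegral => x _; congr (_ * _).
  rewrite (@eq_Rintegral _ _ _ _ _ (fun xi =>
    FT true g x * (g xi * cs true (dotp x xi)) +
    FT false g x * (g xi * cs false (dotp x xi)))); last first.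
    by move=> xi _; rewrite /K1/=; ring.
  rewrite RintegralD//; [|exact: (intgZl _ (intg_cs _ _ gi))..].
  by rewrite !RintegralZl//; exact: intg_cs.
rewrite (Rfubini_bd (intg_phi n d) gi mK1 K1M).
apply: eq_Rintegral => xi _; congr (_ * _).
pose K2 (z : X * X) := cos (dotp z.1 (tsub xi z.2)).
have dB x eta : dotp x (tsub xi eta) = dotp x xi - dotp x eta.
  by rewrite dotpC dotpBl dotpC [dotp eta x]dotpC.
transitivity (\int[lebN n]_x (phi d x * \int[lebN n]_eta (g eta * K2 (x, eta)))).
  apply: eq_Rintegral => x _; congr (_ * _).
  rewrite (@eq_Rintegral _ _ _ _ _ (fun eta =>
    cs true (dotp x xi) * (g eta * cs true (dotp x eta)) +
    cs false (dotp x xi) * (g eta * cs false (dotp x eta)))); last first.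
    by move=> eta _; rewrite /K2/= dB cosB; ring.
  rewrite RintegralD//; [|exact: (intgZl _ (intg_cs _ _ gi))..].
  by rewrite !RintegralZl//; exact: intg_cs.
rewrite (@Rfubini_bd _ _ _ _ _ _ _ _ _ K2 1 (intg_phi n d) gi).
- apply: eq_Rintegral => eta _; congr (_ * _).
  exact: (Rintegral_phi_cs d true (tsub xi eta)).
- apply: (measurable_cs true); apply: measurable_dotp => //.
  by apply: measurable_tsub.
- by move=> z; exact: cos_max.
Qed.

Lemma phiF_ge0 (d : R) (u : X) : 0 <= phiF d u.
Proof. by apply: prodr_ge0 => i _; exact: fejF_ge0. Qed.

Lemma phiF_le (d : R) (u : X) : 0 <= d -> phiF d u <= (fejC * d) ^+ n.
Proof.
move=> d0; rewrite -[n in leRHS]card_ord -prodr_const.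
by apply: ler_prod => i _; rewrite fejF_ge0 fejF_le.
Qed.

Lemma measurable_phiF (d : R) : measurable_fun setT (@phiF R n d).
Proof.
apply: (@measurable_fun_coord R n (fun=> fejF d)) => i.
rewrite /fejF; apply: measurable_funM => //; apply: measurable_funB => //.
  apply: measurable_funM => //; apply: measurable_funD; apply: measurableT_comp => //.
    exact: measurable_funD.
  exact: measurable_funB.
Qed.

Lemma phiF_tsubC (d : R) (x y : X) : phiF d (tsub x y) = phiF d (tsub y x).
Proof.
apply: eq_bigr => i _; rewrite !tnth_mktuple -(opprB (tnth x i)).
set t := tnth x i - tnth y i; rewrite /fejF normrN.
have -> : - t + d = - (t - d) by ring.
have -> : - t - d = - (t + d) by ring.
by rewrite !normrN [`|t - d| + _]addrC.
Qed.

(** Schur's test for a symmetric kernel, from |g(xi) g(eta)| <= (g(xi)^2 + g(eta)^2) / 2. The flag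
    [chi] marks a set that carries [g]; kept inside the kernel, it lets the row integrals see only
    that set. *)
Lemma energy_le (d : R) g (chi : X -> bool) (M : R) : 0 <= d ->
  intg (lebN n) g -> measurable_fun setT chi -> (forall xi, ~~ chi xi -> g xi = 0) ->
  (forall xi, \int[lebN n]_eta ((chi eta)%:R * phiF d (tsub xi eta))%:E <= M%:E)%E ->
  (\int[lebN n]_x (phi d x * (FT true g x ^+ 2 + FT false g x ^+ 2))%:E
    <= M%:E * \int[lebN n]_xi (g xi ^+ 2)%:E)%E.
Proof.
move=> d0 gi mchi gchi HM.
have mg := intg_measurable gi.
have mk : measurable_fun setT (fun z : X * X => phiF d (tsub z.1 z.2)).
  by apply: (measurableT_comp (measurable_phiF d)); apply: measurable_tsub.
have mkx (xi : X) : measurable_fun setT (fun eta => phiF d (tsub xi eta)).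
  by apply: (measurableT_comp (measurable_phiF d)); apply: measurable_tsub.
have kbd (u : X) : `|phiF d u| <= (fejC * d) ^+ n by rewrite ger0_norm ?phiF_ge0// phiF_le.
have gk xi : intg (lebN n) (fun eta => g eta * phiF d (tsub xi eta)).
  by apply: (intgM_bd gi (mkx xi)).
have mH : measurable_fun setT (fun xi => \int[lebN n]_eta (g eta * phiF d (tsub xi eta))).
  apply: (@measurable_Rintegral _ _ _ _ _ (lebN n)
    (fun z : X * X => g z.2 * phiF d (tsub z.1 z.2))) => //.
  by apply: measurable_funM => //; exact: (measurableT_comp mg).
have Hbd xi : `|\int[lebN n]_eta (g eta * phiF d (tsub xi eta))| <=
    (fejC * d) ^+ n * \int[lebN n]_eta `|g eta|.
  apply: le_trans (le_normr_Rintegral measurableT (gk xi)) _.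
  rewrite -RintegralZl//; last exact: (intg_norm gi).
  apply: le_Rintegral => //; first exact: (intg_norm (gk xi)).
    exact: (intgZl _ (intg_norm gi)).
  by move=> eta _; rewrite normrM mulrC ler_wpM2r.
have fi := intgM_bd gi mH Hbd.
have FTb x : `|FT true g x ^+ 2 + FT false g x ^+ 2| <= (\int[lebN n]_xi `|g xi|) ^+ 2 *+ 2.
  rewrite ger0_norm ?addr_ge0 ?sqr_ge0// mulr2n.
  by apply: lerD; rewrite -[leLHS]real_normK ?num_real// lerXn2r ?nnegrE ?FT_bd// Rintegral_ge0.
have iL : intg (lebN n) (fun x => phi d x * (FT true g x ^+ 2 + FT false g x ^+ 2)).
  apply: intgM_bd (intg_phi n d) _ FTb.
  by apply: measurable_funD; apply: measurable_funX; exact: measurable_FT.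
rewrite (intg_EFin iL) energyE//.
apply: (@le_trans _ _ (\int[lebN n]_xi `|g xi * \int[lebN n]_eta (g eta * phiF d (tsub xi eta))|%:E)%E).
  rewrite -(intg_EFin fi); apply: le_trans (lee_abs _) _.
  by apply: (@le_abse_integral _ _ _ (lebN n) setT) => //; exact: (measurable_int _ fi).
(* The two halves of the Schur bound. In each, [chi] sits on the variable whose square is absent, so
   that [k2] is the transpose of [k1] and inherits its bound from the symmetry of [phiF]. *)
pose k1 (z : X * X) : \bar R := (g z.1 ^+ 2 * ((chi z.2)%:R * phiF d (tsub z.1 z.2)))%:E.
pose k2 (z : X * X) : \bar R := (g z.2 ^+ 2 * ((chi z.1)%:R * phiF d (tsub z.1 z.2)))%:E.
have chi0 (b : bool) (u : X) : 0 <= b%:R * phiF d u by rewrite mulr_ge0 ?ler0n ?phiF_ge0.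
have k10 z : (0 <= k1 z)%E by rewrite lee_fin mulr_ge0 ?sqr_ge0.
have k20 z : (0 <= k2 z)%E by rewrite lee_fin mulr_ge0 ?sqr_ge0.
have mchiR : measurable_fun setT (fun x => (chi x)%:R : R).
  rewrite (_ : (fun x => _) = (fun x => if chi x then 1 else 0)).
    exact: measurable_fun_ifT.
  by apply/funext => x; case: (chi x).
have mg2 : measurable_fun setT (fun x => g x ^+ 2) by exact: measurable_funX.
have mk1 : measurable_fun setT k1.
  apply/measurable_EFinP; apply: measurable_funM; first exact: (measurableT_comp mg2).
  by apply: measurable_funM => //; exact: (measurableT_comp mchiR).
have mk2 : measurable_fun setT k2.
  apply/measurable_EFinP; apply: measurable_funM; first exact: (measurableT_comp mg2).
  by apply: measurable_funM => //; exact: (measurableT_comp mchiR).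
have mk1x xi : measurable_fun setT (fun eta => k1 (xi, eta)).
  by apply: measurableT_comp => //; exact: pair1_measurable.
have mk2x xi : measurable_fun setT (fun eta => k2 (xi, eta)).
  by apply: measurableT_comp => //; exact: pair1_measurable.
apply: (@le_trans _ _ (2^-1%:E * (\int[lebN n]_xi (\int[lebN n]_eta k1 (xi, eta)) +
    \int[lebN n]_xi (\int[lebN n]_eta k2 (xi, eta))))%E).
  have mF1 : measurable_fun setT (fun xi => \int[lebN n]_eta k1 (xi, eta))%E.
    exact: measurable_fun_fubini_tonelli_F.
  have mF2 : measurable_fun setT (fun xi => \int[lebN n]_eta k2 (xi, eta))%E.
    exact: measurable_fun_fubini_tonelli_F.
  rewrite -ge0_integralD//; [|by move=> xi _; exact: integral_ge0..].
  rewrite -ge0_integralZl_EFin//; last 2 first.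
  - by move=> xi _; rewrite adde_ge0// integral_ge0.
  - exact: emeasurable_funD.
  apply: sup_le_integral => xi _ //.
  rewrite -ge0_integralD// -ge0_integralZl_EFin//; last 2 first.
  - by move=> eta _; rewrite adde_ge0.
  - exact: emeasurable_funD.
  rewrite -RintegralZl//; last exact: (gk xi).
  apply: (@le_trans _ _ ((\int[lebN n]_eta `|g xi * (g eta * phiF d (tsub xi eta))|)%R%:E)).
    have := @le_normr_Rintegral _ _ _ (lebN n) setT _ measurableT (intgZl (g xi) (gk xi)).
    by rewrite -lee_fin; exact.
  rewrite -intg_EFin; last exact: (intg_norm (intgZl (g xi) (gk xi))).
  apply: sup_le_integral => eta _ //.
  rewrite /k1 /k2 -EFinD -EFinM lee_fin /= !normrM (ger0_norm (phiF_ge0 _ _)).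
  have := phiF_ge0 d (tsub xi eta); move: (phiF _ _) => q q0.
  have [cx|/gchi ->] := boolP (chi xi); last first.
    by rewrite normr0 !mul0r mulr_ge0// expr0n/= !mul0r add0r mulr_ge0 ?sqr_ge0.
  have [ce|/gchi ->] := boolP (chi eta); last first.
    by rewrite normr0 !mul0r mulr0 mulr_ge0// expr0n/= !mul0r addr0 mulr_ge0 ?sqr_ge0.
  rewrite !mul1r -mulrDl !mulrA ler_wpM2r//.
  rewrite -[g xi ^+ 2]real_normK ?num_real// -[g eta ^+ 2]real_normK ?num_real//.
  have := sqr_ge0 (`|g xi| - `|g eta|); rewrite !expr2; lra.
have B1 : (\int[lebN n]_xi (\int[lebN n]_eta k1 (xi, eta)) <=
    M%:E * \int[lebN n]_xi (g xi ^+ 2)%:E)%E.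
  rewrite muleC -ge0_integralZr//; last 3 first.
  - exact/measurable_EFinP.
  - by move=> xi _; rewrite lee_fin sqr_ge0.
  - apply: le_trans (HM point); apply: integral_ge0 => eta _; by rewrite lee_fin.
  apply: sup_le_integral => xi _; first exact: integral_ge0.
  rewrite (eq_integral (fun eta => (g xi ^+ 2)%:E *
    ((chi eta)%:R * phiF d (tsub xi eta))%:E)%E)//.
  rewrite ge0_integralZl_EFin ?sqr_ge0//; last 2 first.
  - by move=> eta _; rewrite lee_fin.
  - by apply/measurable_EFinP; exact: measurable_funM.
  by rewrite lee_wpmul2l// lee_fin sqr_ge0.
have B2 : (\int[lebN n]_xi (\int[lebN n]_eta k2 (xi, eta)) <=
    M%:E * \int[lebN n]_xi (g xi ^+ 2)%:E)%E.
  have sw := @fubini_tonelli _ _ _ _ _ (lebN n) (lebN n) k2 mk2 k20.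
  apply: (@le_trans _ _ (\int[lebN n]_eta \int[lebN n]_xi k2 (xi, eta))%E).
    by rewrite [leLHS]sw.
  apply: le_trans B1.
  apply: sup_le_integral => xi _; first by apply: integral_ge0.
  apply: sup_le_integral => eta _; first exact: k20.
  by rewrite /k1 /k2 /= phiF_tsubC.
apply: le_trans (lee_wpmul2l _ (leeD B1 B2)) _; first by rewrite lee_fin invr_ge0.
set A := (M%:E * _)%E.
have A0 : (0 <= A)%E.
  apply: le_trans B1; apply: integral_ge0 => xi _; exact: integral_ge0.
rewrite ge0_muleDr// -ge0_muleDl ?lee_fin ?invr_ge0// -EFinD.
by rewrite (_ : 2^-1 + 2^-1 = 1 :> R) ?mul1e//; lra.
Qed.

End Energy.

(** * Plancherel inequality *)

Section Plancherel.
Context {R : realType} (n : nat).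
Local Notation X := (n.-tuple R).
Implicit Types (g : X -> R) (x xi : X).

Definition FT2 g x : R := FT true g x ^+ 2 + FT false g x ^+ 2.

Lemma FT2_ge0 g x : 0 <= FT2 g x.
Proof. by rewrite addr_ge0 ?sqr_ge0. Qed.

Lemma measurable_FT2 g : intg (lebN n) g -> measurable_fun setT (FT2 g).
Proof.
by move=> gi; apply: measurable_funD; apply: measurable_funX; exact: measurable_FT.
Qed.

Lemma coord_le_enorm x i : `|tnth x i| <= enorm x.
Proof.
rewrite -sqrtr_sqr; apply: ler_wsqrtr.
rewrite /dotp (bigD1 i)//= -expr2 lerDl.
by apply: sumr_ge0 => j _; rewrite -expr2 sqr_ge0.
Qed.

Lemma phi_ge (d : R) x : 0 < d -> enorm x <= d^-1 -> (d ^+ 2 / 8) ^+ n <= phi d x.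
Proof.
move=> d0 xd; rewrite -[n in leLHS]card_ord -prodr_const.
apply: ler_prod => i _; rewrite divr_ge0 ?sqr_ge0//= fej_ge//.
rewrite mulrC -ler_pdivlMr// div1r; exact: le_trans (coord_le_enorm x i) xd.
Qed.

Lemma measurable_ball_le (K : R) : measurable [set x : X | enorm x <= K].
Proof.
have : measurable_fun setT (fun x : X => enorm x <= K).
  by apply: measurable_fun_ler => //; exact: measurable_enorm.
by move=> /(_ measurableT [set true]); rewrite setTI; exact.
Qed.

(** On the ball of radius 1/d every coordinate factor of the kernel is at least d^2 / 8, which
    trades the weighted energy for a plain integral over the ball. *)
Lemma FT_ball_le (d : R) g (chi : X -> bool) (M : R) : 0 < d ->
  intg (lebN n) g -> measurable_fun setT chi -> (forall xi, ~~ chi xi -> g xi = 0) ->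
  (forall xi, \int[lebN n]_eta ((chi eta)%:R * phiF d (tsub xi eta))%:E <= M%:E)%E ->
  (\int[lebN n]_(x in [set x | (enorm x <= d^-1)%R]) (FT2 g x)%:E
    <= ((8 / d ^+ 2) ^+ n * M)%:E * \int[lebN n]_xi (g xi ^+ 2)%:E)%E.
Proof.
move=> d0 gi mchi gchi HM.
have c0 : 0 <= (8 / d ^+ 2) ^+ n by rewrite exprn_ge0// divr_ge0 ?sqr_ge0.
have H := energy_le (ltW d0) gi mchi gchi HM.
rewrite EFinM -muleA; apply: le_trans (lee_wpmul2l _ H); last by rewrite lee_fin.
have mp : measurable_fun setT (fun x => (phi d x * FT2 g x)%:E).
  apply/measurable_EFinP; apply: measurable_funM; first exact: measurable_phi.
  exact: measurable_FT2.
have p0 x : 0 <= phi d x * FT2 g x by rewrite mulr_ge0 ?phi_ge0 ?FT2_ge0.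
rewrite -ge0_integralZl_EFin//; last by move=> x _; rewrite lee_fin; exact: p0.
rewrite [leLHS]integral_mkcond; apply: sup_le_integral => x _.
  by apply: erestrict_ge0 => y _; rewrite lee_fin FT2_ge0.
rewrite patchE; case: ifPn => [/set_mem/= xd|_]; last first.
  by rewrite -EFinM lee_fin mulr_ge0.
rewrite -EFinM lee_fin -/(FT2 g x) mulrA ler_peMl ?FT2_ge0//.
have e : (8 / d ^+ 2) ^+ n * (d ^+ 2 / 8) ^+ n = 1.
  rewrite -exprMn (_ : _ * _ = 1) ?expr1n//; field; exact: lt0r_neq0.
by rewrite -[leLHS]e ler_wpM2l// phi_ge.
Qed.

Lemma phiF_le_cube (d : R) x y : 0 <= d ->
  phiF d (tsub x y) <= (fejC * d) ^+ n * cubeI d x y.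
Proof.
move=> d0.
have -> : (fejC * d) ^+ n = \prod_(i < n) (fejC * d) by rewrite prodr_const card_ord.
rewrite -big_split /=.
apply: ler_prod => i _; rewrite fejF_ge0 tnth_mktuple /=.
case: (leP `|tnth x i - tnth y i| d) => h; first by rewrite mulr1n mulr1 fejF_le.
by rewrite mulr0n mulr0 fejF_eq0// ltW.
Qed.

(** Per coordinate, 8 / d^2 comes from the lower bound of the kernel, [fejC * d] from the height of
    the tent and 2 d from its width. The product 16 [fejC] is free of d. *)
Definition plC : R := (16 * fejC) ^+ n.

Lemma plC_ge0 : 0 <= plC.
Proof. by rewrite exprn_ge0// mulr_ge0// ltW// fejC_gt0. Qed.

Lemma FT_ball_all (d : R) g : 0 < d -> intg (lebN n) g ->
  (\int[lebN n]_(x in [set x | (enorm x <= d^-1)%R]) (FT2 g x)%:E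
    <= plC%:E * \int[lebN n]_xi (g xi ^+ 2)%:E)%E.
Proof.
move=> d0 gi.
have -> : plC = (8 / d ^+ 2) ^+ n * ((fejC * d) ^+ n * (2 * d) ^+ n).
  rewrite /plC -!exprMn; congr (_ ^+ n); field; exact: lt0r_neq0.
apply: (@FT_ball_le d g (fun=> true)) => // xi.
apply: (@le_trans _ _ (\int[lebN n]_eta (((fejC * d) ^+ n)%:E * (cubeI d xi eta)%:E))%E).
  apply: sup_le_integral => eta _; first by rewrite lee_fin mul1r phiF_ge0.
  by rewrite -EFinM lee_fin mul1r phiF_le_cube// ltW.
rewrite ge0_integralZl_EFin//.
- by rewrite integral_cubeI ?(ltW d0)// -EFinM.
- by move=> eta _; rewrite lee_fin cubeI_ge0.
- by apply/measurable_EFinP; exact: measurable_cubeI.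
- by rewrite exprn_ge0// mulr_ge0// ltW// fejC_gt0.
Qed.

(** The bound on the ball of radius 1/d does not depend on d, so d = 1/(k+1) exhausts the space. *)
Lemma plancherel_le g : intg (lebN n) g ->
  (\int[lebN n]_x (FT2 g x)%:E <= plC%:E * \int[lebN n]_xi (g xi ^+ 2)%:E)%E.
Proof.
move=> gi; pose F (k : nat) := [set x : X | enorm x <= k.+1%:R].
have ndF : nondecreasing_seq F.
  move=> k l kl; apply/subsetPset => x /= h; apply: le_trans h _.
  by rewrite ler_nat ltnS.
have UF : \bigcup_k F k = setT.
  apply/seteqP; split => // x _; exists (Num.truncn (enorm x)) => //=.
  by apply: ltW; exact: truncnS_gt.
have mF k : measurable (F k) by exact: measurable_ball_le.
have mf k : measurable_fun (F k) (fun x => (FT2 g x)%:E).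
  by apply: measurable_funTS; apply/measurable_EFinP; exact: measurable_FT2.
have := @ge0_nondecreasing_set_cvg_integral _ _ _ F (fun x => (FT2 g x)%:E) (lebN n) ndF mF mf.
rewrite UF => cv.
have {}cv := cv (fun k x _ => FT2_ge0 g x : (0 <= (FT2 g x)%:E)%E).
rewrite -(cvg_lim _ cv)//; apply: lime_le; first by apply/cvg_ex; eexists; exact: cv.
apply: nearW => k; have := @FT_ball_all (k.+1%:R^-1) g _ gi; rewrite invrK; apply.
by rewrite invr_gt0.
Qed.

End Plancherel.

Section AnnulusBound.
Context {R : realType} (n : nat).
Local Notation X := (n.+1.-tuple R).

Lemma enorm_sqr (x : X) : enorm x ^+ 2 = dotp x x.
Proof. by rewrite sqr_sqrtr// dotp_ge0. Qed.

(** The choice d = 1/3 matches the ball of radius 3 and gives the cubes the side 2/3, below the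
    limit 1 of the volume bound. The squared radii of [annI] turn back into radii, hence the factor
    b - a. *)
Lemma annulus_bound : exists2 C : R, 0 <= C & forall (a b : R) (g : X -> R),
  0 <= a -> a <= b -> intg (lebN n.+1) g ->
  (forall xi, ~~ (a <= enorm xi < b) -> g xi = 0) ->
  (\int[lebN n.+1]_(x in [set x | (enorm x <= 3)%R]) (FT2 g x)%:E
    <= (C * (b - a))%:E * \int[lebN n.+1]_xi (g xi ^+ 2)%:E)%E.
Proof.
have d0 : 0 < 3^-1 :> R by rewrite invr_gt0.
have [C C0 HC] := @annulus_le R n 3^-1 (ltW d0) ltac:(lra).
have fd0 : 0 <= (fejC * 3^-1 :> R) ^+ n.+1.
  by rewrite exprn_ge0// mulr_ge0// ?(ltW d0)// ltW// fejC_gt0.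
exists ((8 / (3^-1) ^+ 2) ^+ n.+1 * ((fejC * 3^-1) ^+ n.+1 * C)).
  by rewrite !mulr_ge0// exprn_ge0// divr_ge0// sqr_ge0.
move=> a b g a0 ab gi ga.
rewrite -[3 in X in (X <= _)%E]invrK -!mulrA.
have mchi : measurable_fun setT (fun xi : X => (a <= enorm xi) && (enorm xi < b)).
  apply: measurable_and; [apply: measurable_fun_ler|apply: measurable_fun_ltr] => //;
  exact: measurable_enorm.
apply: (FT_ball_le d0 gi mchi ga) => xi.
apply: (@le_trans _ _ (\int[lebN n.+1]_eta (((fejC * 3^-1) ^+ n.+1)%:E *
    (annI 3^-1 (a ^+ 2) (b ^+ 2) xi eta)%:E))%E).
  apply: sup_le_integral => eta _; first by rewrite lee_fin mulr_ge0 ?ler0n ?phiF_ge0.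
  rewrite -EFinM lee_fin /annI -enorm_sqr.
  have e0 : 0 <= enorm eta by exact: sqrtr_ge0.
  rewrite ler_sqr ?nnegrE// ltr_sqr ?nnegrE//; last exact: le_trans ab.
  rewrite mulrCA ler_wpM2l ?ler0n//; exact: (phiF_le_cube _ _ (ltW d0)).
rewrite ge0_integralZl_EFin//; last 2 first.
- by move=> eta _; rewrite lee_fin annI_ge0.
- by apply/measurable_EFinP; exact: measurable_annI.
rewrite [leRHS]EFinM lee_wpmul2l// ?lee_fin//.
have b0 : 0 <= b by exact: le_trans ab.
have := HC (a ^+ 2) (b ^+ 2) xi; rewrite !sqrtr_sqr !ger0_norm//; apply.
by rewrite ler_sqr ?nnegrE.
Qed.

End AnnulusBound.

(** * Localization *)

Lemma count_between (R : realType) (p q S : R) (J : nat) : `|p - q| <= S ->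
  \sum_(j < J) ((p < j%:R)%R%:R - (q < j%:R)%R%:R) ^+ 2 <= 1 + S.
Proof.
wlog pq : p q / p <= q => [H|].
  have [/H//|/ltW/H] := leP p q; rewrite distrC => {}H /H.
  by under eq_bigr do rewrite -sqrrN opprB.
rewrite distrC ger0_norm ?subr_ge0// => qS.
(* [psi] clamps j to [p, q + 1]. It never decreases, and it rises by exactly 1 at each integer with
   p < j <= q, so the count telescopes. *)
pose psi (j : nat) : R := Num.min (Num.max j%:R p) (q + 1).
apply: (@le_trans _ _ (\sum_(0 <= j < J) (psi j.+1 - psi j))).
  rewrite big_mkord; apply: ler_sum => j _.
  have psi_mono : psi j <= psi j.+1.
    rewrite /psi le_min ge_min ge_min lexx orbT andbT.
    by rewrite ge_max !le_max ler_nat leqnSn lexx orbT.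
  have [pj|jp] := ltP p j%:R; have [qj|jq] := ltP q j%:R => /=.
  - by rewrite subrr expr0n/= subr_ge0.
  - rewrite subr0 expr1n /psi -natr1 !max_l ?min_l//; lra.
  - lra.
  - by rewrite subrr expr0n/= subr_ge0.
rewrite telescope_sumr//.
have h1 : psi J <= q + 1 by rewrite ge_min lexx orbT.
have h2 : p <= psi 0 by rewrite le_min le_max lexx orbT /=; lra.
lra.
Qed.

Section WeightedCauchySchwarz.
Context d (T : measurableType d) (R : realType).
Variable mu : {measure set T -> \bar R}.

(** The last hypothesis is the pointwise inequality s^2 <= p q in discriminant form, which survives
    integration as it stands; the integrated quadratic is evaluated at its minimum. *)
Lemma Rintegral_cauchy_schwarz (p q s : T -> R) :
  intg mu p -> intg mu q -> intg mu s -> 0 < \int[mu]_x p x ->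
  (forall c x, 0 <= q x - 2 * c * s x + c ^+ 2 * p x) ->
  (\int[mu]_x s x) ^+ 2 <= (\int[mu]_x p x) * (\int[mu]_x q x).
Proof.
move=> pi qi si p0 H.
have {}H c : 0 <= \int[mu]_x q x - 2 * c * \int[mu]_x s x + c ^+ 2 * \int[mu]_x p x.
  rewrite -!RintegralZl//.
  rewrite -RintegralB//; last exact: (intgZl _ si).
  rewrite -RintegralD//; last 2 first.
  - exact: (intgB qi (intgZl _ si)).
  - exact: (intgZl _ pi).
  by apply: Rintegral_ge0 => x _; exact: H.
have := H ((\int[mu]_x s x) / (\int[mu]_x p x)).
move: p0 (\int[mu]_x s x) (\int[mu]_x q x); move: (\int[mu]_x p x) => P P0 S Q.
have -> : Q - 2 * (S / P) * S + (S / P) ^+ 2 * P = Q - S ^+ 2 / P.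
  by field; exact: lt0r_neq0.
by rewrite subr_ge0 ler_pdivrMr// mulrC.
Qed.

End WeightedCauchySchwarz.

Section Localization.
Context {R : realType} (n : nat).
Local Notation X := (n.-tuple R).
Implicit Types (x y z u xi : X) (a : X -> R).

(** The l1 length is preferred to the Euclidean one because 1 + [l1 u] is dominated by the product
    of the 1 + |u_i|, that is, by the square of the product weight. *)
Definition l1 u : R := \sum_(i < n) `|tnth u i|.

Lemma l1_ge0 u : 0 <= l1 u. Proof. exact: sumr_ge0. Qed.

Lemma dotp_le_l1 z u : dotp z u <= enorm z * l1 u.
Proof.
rewrite mulr_sumr; apply: ler_sum => i _.
apply: le_trans (ler_norm _) _; rewrite normrM ler_wpM2r//; exact: coord_le_enorm.
Qed.

Lemma enorm_tri x z u : (forall i, tnth x i = tnth z i + tnth u i) ->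
  enorm x <= enorm z + l1 u.
Proof.
move=> E; have z0 : 0 <= enorm z by exact: sqrtr_ge0.
rewrite -[leRHS]ger0_norm ?addr_ge0 ?l1_ge0// -sqrtr_sqr; apply: ler_wsqrtr.
have -> : dotp x x = dotp z z + 2 * dotp z u + dotp u u.
  rewrite /dotp mulr_sumr -!big_split; apply: eq_bigr => i _ /=; rewrite E; ring.
have zz : dotp z z = enorm z ^+ 2.
  by rewrite sqr_sqrtr//; apply: sumr_ge0 => i _; rewrite -expr2 sqr_ge0.
have uu : dotp u u <= l1 u ^+ 2.
  rewrite expr2 [leRHS]mulr_suml; apply: ler_sum => i _.
  apply: le_trans (ler_norm _) _; rewrite normrM ler_wpM2l//.
  by rewrite /l1 (bigD1 i)//= lerDl sumr_ge0.
have := dotp_le_l1 z u; rewrite zz sqrrD; lra.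
Qed.

Lemma enorm_tsub_le xi u : `|enorm xi - enorm (tsub xi u)| <= l1 u.
Proof.
have h1 : enorm xi <= enorm (tsub xi u) + l1 u.
  by apply: enorm_tri => i; rewrite tnth_mktuple subrK.
pose v : X := [tuple - tnth u i | i < n].
have h2 : enorm (tsub xi u) <= enorm xi + l1 u.
  have -> : l1 u = l1 v by apply: eq_bigr => i _; rewrite tnth_mktuple normrN.
  by apply: enorm_tri => i; rewrite !tnth_mktuple.
rewrite ler_norml; lra.
Qed.

Definition wgtn u : R := \prod_(i < n) wgt (tnth u i).

Lemma wgtn_gt0 u : 0 < wgtn u.
Proof. by apply: prodr_gt0 => i _; exact: lt_le_trans ltr01 (wgt_ge1 _). Qed.

Lemma wgtn_sqr u : 1 + l1 u <= wgtn u ^+ 2.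
Proof.
rewrite /wgtn -prodrXl.
rewrite (eq_bigr (fun i => 1 + `|tnth u i|)); last first.
  by move=> i _; rewrite sqr_sqrtr// addr_ge0.
rewrite /l1; move: (index_enum _) => s.
elim: s => [|i s ih]; first by rewrite !big_nil addr0.
rewrite !big_cons; apply: le_trans (ler_wpM2l _ ih); last by rewrite addr_ge0.
rewrite mulrDl mul1r mulrDr mulr1.
have : 0 <= `|tnth u i| * \sum_(j <- s) `|tnth u j| by rewrite mulr_ge0// sumr_ge0.
lra.
Qed.

Lemma measurable_wgtn : measurable_fun setT wgtn.
Proof. by apply: (@measurable_fun_coord R n (fun=> wgt)) => i; exact: measurable_wgt. Qed.

Definition ballI (rho : R) xi : R := (enorm xi < rho)%R%:R.

Lemma ballI_ge0 rho xi : 0 <= ballI rho xi. Proof. exact: ler0n. Qed.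
Lemma ballI_le1 rho xi : `|ballI rho xi| <= 1.
Proof. by rewrite ger0_norm ?ballI_ge0// /ballI; case: (_ < _). Qed.

Lemma measurable_ballI rho : measurable_fun setT (ballI rho).
Proof.
by apply: measurable_boolR; apply: measurable_fun_ltr => //; exact: measurable_enorm.
Qed.

Lemma intg_ballI rho : intg (lebN n) (ballI rho).
Proof.
pose o : X := [tuple 0 | i < n].
apply: (@le_intg _ _ _ _ _ (cubeI `|rho| o)); first exact: measurable_ballI.
  move=> xi; rewrite ger0_norm ?ballI_ge0// /ballI; case: ltP => h; last exact: cubeI_ge0.
  rewrite /cubeI big1// => i _; rewrite tnth_mktuple sub0r normrN.
  by rewrite (le_trans (coord_le_enorm xi i))// (le_trans (ltW h))// ler_norm.
apply: ge0_intg; [exact: measurable_cubeI|by move=> y; exact: cubeI_ge0|].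
by rewrite integral_cubeI// ltry.
Qed.

Definition topp u : X := [tuple - tnth u i | i < n].

Lemma tadd_topp xi u : tadd xi (topp u) = tsub xi u.
Proof. by apply: eq_from_tnth => i; rewrite !tnth_mktuple. Qed.

Lemma tsub_tadd xi u : tsub (tadd xi u) u = xi.
Proof. by apply: eq_from_tnth => i; rewrite !tnth_mktuple addrK. Qed.

Lemma intg_ballI_tsub rho u :
  intg (lebN n) (fun xi => ballI rho (tsub xi u)) /\
  \int[lebN n]_xi ballI rho (tsub xi u) = \int[lebN n]_xi ballI rho xi.
Proof.
have := intg_shift (topp u) (intg_ballI rho).
have -> : (fun xi => ballI rho (tadd xi (topp u))) = (fun xi => ballI rho (tsub xi u)).
  by apply/funext => xi; rewrite tadd_topp.
by [].
Qed.

Variable d : R.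
Hypothesis d0 : 0 < d.
Local Notation k := (@phi R n d).

Definition kap : R := \int[lebN n]_u k u.

Lemma kap_gt0 : 0 < kap.
Proof.
pose o : X := [tuple 0 | i < n].
have := Rintegral_phi_cs d true o.
have -> : (fun x => k x * cs true (dotp x o)) = k.
  apply/funext => x; rewrite /dotp big1 ?/cs ?cos0 ?mulr1//.
  by move=> i _; rewrite tnth_mktuple mulr0.
rewrite -/kap => ->; apply: prodr_gt0 => i _; rewrite tnth_mktuple fejF0 ?ltW//.
by rewrite mulr_gt0 ?fejC_gt0.
Qed.

(** The smoothed ball multiplier: the convolution of the kernel with the indicator of the ball. *)
Definition mus rho xi : R := \int[lebN n]_u (k u * ballI rho (tsub xi u)).

Lemma intg_kball rho xi : intg (lebN n) (fun u => k u * ballI rho (tsub xi u)).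
Proof.
apply: (intgM_bd (M := 1)) => //; [exact: intg_phi| |by move=> u; exact: ballI_le1].
by apply: (measurableT_comp (measurable_ballI rho)); exact: measurable_tsub.
Qed.

Lemma measurable_kball rho : measurable_fun setT (fun w : X * X => k w.1 * ballI rho (tsub w.2 w.1)).
Proof.
apply: measurable_funM; first exact: (measurableT_comp (measurable_phi d)).
by apply: (measurableT_comp (measurable_ballI rho)); exact: measurable_tsub.
Qed.

Lemma kball_fin rho :
  (\int[lebN n]_u \int[lebN n]_xi (k u * ballI rho (tsub xi u))%:E < +oo)%E.
Proof.
set B := \int[lebN n]_xi ballI rho xi.
rewrite (eq_integral (fun u => (B * k u)%:E)); last first.
  move=> u _; have [i1 e1] := intg_ballI_tsub rho u.
  by rewrite (intg_EFin (intgZl (k u) i1)) RintegralZl// e1 mulrC.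
by have /integrable_lty := intgZl B (intg_phi n d); exact.
Qed.

Lemma mus_ge0 rho xi : 0 <= mus rho xi.
Proof. by apply: Rintegral_ge0 => u _; rewrite mulr_ge0 ?phi_ge0 ?ballI_ge0. Qed.

Lemma measurable_mus rho : measurable_fun setT (mus rho).
Proof.
apply: (@measurable_Rintegral _ _ _ _ _ (lebN n)
  (fun w : X * X => k w.2 * ballI rho (tsub w.1 w.2))); last by move=> x; exact: intg_kball.
apply: measurable_funM; first exact: (measurableT_comp (measurable_phi d)).
by apply: (measurableT_comp (measurable_ballI rho)); exact: measurable_tsub.
Qed.

Lemma intg_mus rho : intg (lebN n) (mus rho).
Proof.
apply: ge0_intg; [exact: measurable_mus|exact: mus_ge0|].
rewrite (eq_integral (fun xi => \int[lebN n]_u (k u * ballI rho (tsub xi u))%:E)%E); last first.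
  by move=> xi _; rewrite (intg_EFin (intg_kball rho xi)).
have mE : measurable_fun setT (fun w : X * X => (k w.1 * ballI rho (tsub w.2 w.1))%:E).
  by apply/measurable_EFinP; exact: measurable_kball.
have E0 (w : X * X) : (0 <= (k w.1 * ballI rho (tsub w.2 w.1))%:E)%E.
  by rewrite lee_fin mulr_ge0 ?phi_ge0 ?ballI_ge0.
have sw := @fubini_tonelli _ _ _ _ _ (lebN n) (lebN n) _ mE E0.
by move: (kball_fin rho); rewrite [X in (X < _)%E -> _]sw.
Qed.

Lemma mus_fubini rho (h : X -> R) : measurable_fun setT h -> (forall x, `|h x| <= 1) ->
  \int[lebN n]_xi (mus rho xi * h xi) =
  \int[lebN n]_u (k u * \int[lebN n]_xi (ballI rho (tsub xi u) * h xi)).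
Proof.
move=> mh h1.
have i1 u : intg (lebN n) (fun xi => ballI rho (tsub xi u) * h xi).
  by apply: (intgM_bd (intg_ballI_tsub rho u).1 mh h1).
pose K (w : X * X) := k w.1 * (ballI rho (tsub w.2 w.1) * h w.2).
transitivity (\int[lebN n]_xi (\int[lebN n]_u K (u, xi))).
  apply: eq_Rintegral => xi _; rewrite -RintegralZr//; last exact: intg_kball.
  by apply: eq_Rintegral => u _; rewrite /K mulrA.
rewrite -(@Rfubini _ _ _ _ _ (lebN n) (lebN n) K).
- by apply: eq_Rintegral => u _; rewrite -RintegralZl//; exact: i1.
- rewrite /K; apply: measurable_funM; first exact: (measurableT_comp (measurable_phi d)).
  apply: measurable_funM; last exact: (measurableT_comp mh).
  by apply: (measurableT_comp (measurable_ballI rho)); exact: measurable_tsub.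
- apply: le_lt_trans (kball_fin rho).
  apply: sup_le_integral => u _; first exact: integral_ge0.
  apply: sup_le_integral => xi _ //.
  rewrite lee_fin /K /= mulrA normrM [in leLHS]ger0_norm ?mulr_ge0 ?phi_ge0 ?ballI_ge0//.
  by rewrite ler_piMr// mulr_ge0 ?phi_ge0 ?ballI_ge0.
- by move=> u; exact: (intgZl (k u) (i1 u)).
- move=> xi; apply: eq_integrable (intgZl (h xi) (intg_kball rho xi)) => // u _ /=.
  by rewrite /K /= mulrC mulrA.
Qed.

Lemma phi_cs_shift0 b (s : R) z : (exists i, d <= `|tnth z i|) ->
  \int[lebN n]_u (k u * cs b (s + dotp u z)) = 0.
Proof.
move=> [i zi].
have F0 : phiF d z = 0 by rewrite /phiF (bigD1 i)//= fejF_eq0 ?mul0r// ltW.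
case: b.
- rewrite (@eq_Rintegral _ _ _ _ _ (fun u => cos s * (k u * cs true (dotp u z)) -
    sin s * (k u * cs false (dotp u z)))); last by move=> u _; rewrite /cs cosD; ring.
  rewrite RintegralB//; [|exact: (intgZl _ (intg_phi_cs _ _ _))..].
  by rewrite !RintegralZl ?Rintegral_phi_cs ?F0 ?mulr0 ?subrr//; exact: intg_phi_cs.
- rewrite (@eq_Rintegral _ _ _ _ _ (fun u => sin s * (k u * cs true (dotp u z)) +
    cos s * (k u * cs false (dotp u z)))); last by move=> u _; rewrite /cs sinD; ring.
  rewrite RintegralD//; [|exact: (intgZl _ (intg_phi_cs _ _ _))..].
  by rewrite !RintegralZl ?Rintegral_phi_cs ?F0 ?mulr0 ?addr0//; exact: intg_phi_cs.
Qed.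

(** The transform of a convolution is a product. Translating xi by u separates the variables, and
    the factor contributed by the kernel is zero once some coordinate of [z] reaches d. *)
Lemma mus_cs0 rho b z : (exists i, d <= `|tnth z i|) ->
  \int[lebN n]_xi (mus rho xi * cs b (dotp z xi)) = 0.
Proof.
move=> zi.
have mc : measurable_fun setT (fun xi => cs b (dotp z xi)).
  by apply: measurable_cs; exact: measurable_dotp.
rewrite mus_fubini//; last by move=> x; exact: cs_le1.
pose K (w : X * X) := cs b (dotp z w.2 + dotp w.1 z).
transitivity (\int[lebN n]_u (k u * \int[lebN n]_xi (ballI rho xi * K (u, xi)))).
  apply: eq_Rintegral => u _; congr (_ * _).
  have i1 : intg (lebN n) (fun xi => ballI rho (tsub xi u) * cs b (dotp z xi)).
    by apply: (intgM_bd (intg_ballI_tsub rho u).1 mc) => x; exact: cs_le1.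
  rewrite -(intg_shift u i1).2; apply: eq_Rintegral => xi _.
  by rewrite tsub_tadd /K/= dotpC dotpDl [dotp xi z]dotpC.
rewrite (@Rfubini_bd _ _ _ _ _ (lebN n) (lebN n) _ _ K 1 (intg_phi n d) (intg_ballI rho)).
- rewrite (@eq_Rintegral _ _ _ _ _ (fun=> 0)); first by rewrite Rintegral_cst// mul0r.
  move=> xi _; rewrite [X in _ * X](_ : _ = 0) ?mulr0//.
  exact: (@phi_cs_shift0 b (dotp z xi) z zi).
- by apply: measurable_cs; apply: measurable_funD; exact: measurable_dotp.
- by move=> w; exact: cs_le1.
Qed.

End Localization.

(** * Dyadic chaining *)

Section Chaining.
Context {R : realType}.

(** Cauchy-Schwarz with weights (3/2)^l; the prefactor is the sum of (2/3)^l for l < L. The ratio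
    exceeds 1 to make that sum bounded, and stays below 2 to be absorbed by the gain 2^-l of the
    annuli. *)
Lemma sum_sqr_le (e : nat -> R) L :
  (\sum_(l < L) e l) ^+ 2 <= (3 - 3 * (2 / 3) ^+ L) * \sum_(l < L) (3 / 2) ^+ l * e l ^+ 2.
Proof.
elim: L => [|L ih]; first by rewrite !big_ord0 expr0n/= mulr0.
rewrite !big_ord_recr /=; set s := \sum_(l < L) e l in ih *.
set Q := \sum_(l < L) _ in ih *.
pose p : R := (2 / 3) ^+ L; pose p' : R := (3 / 2) ^+ L.
have p0 : 0 < p by rewrite exprn_gt0// divr_gt0.
have pp : p * p' = 1 by rewrite -exprMn (_ : _ * _ = 1) ?expr1n//; field.
have p1 : p <= 1 by rewrite exprn_ile1//; lra.
rewrite [(2 / 3) ^+ L.+1]exprS -/p -/p'.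
have -> : (3 - 3 * (2 / 3 * p)) = (3 - 3 * p) + p by field.
have Q0 : 0 <= Q by apply: sumr_ge0 => l _; rewrite mulr_ge0 ?sqr_ge0// exprn_ge0// divr_ge0.
set P := 3 - 3 * p in ih *.
have P0 : 0 <= P by rewrite /P; lra.
have p'0 : 0 < p' by rewrite exprn_gt0// divr_gt0.
have -> : (P + p) * (Q + p' * e L ^+ 2) = P * Q + p * Q + P * p' * e L ^+ 2 + e L ^+ 2.
  transitivity (P * Q + p * Q + P * p' * e L ^+ 2 + (p * p') * e L ^+ 2); first ring.
  by rewrite pp mul1r.
rewrite sqrrD.
(* The arithmetic-geometric mean inequality, from s^2 <= P Q and p p' = 1. *)
have cross : s * e L *+ 2 <= p * Q + P * p' * e L ^+ 2.
  have : (s * e L) ^+ 2 <= (p * Q) * (P * p' * e L ^+ 2).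
    have -> : (p * Q) * (P * p' * e L ^+ 2) = (P * Q) * e L ^+ 2.
      transitivity ((p * p') * (P * Q * e L ^+ 2)); first ring.
      by rewrite pp mul1r.
    by rewrite exprMn ler_wpM2r// sqr_ge0.
  have u0 : 0 <= p * Q by rewrite mulr_ge0// ltW.
  have v0 : 0 <= P * p' * e L ^+ 2 by apply: mulr_ge0; [apply: mulr_ge0 => //; exact: ltW|exact: sqr_ge0].
  move: (p * Q) (P * p' * e L ^+ 2) u0 v0 => u v u0 v0 h.
  have h4 : (s * e L *+ 2) ^+ 2 <= (u + v) ^+ 2.
    have := sqr_ge0 (u - v); rewrite -mulr_natr exprMn !expr2; move: h; rewrite expr2; lra.
  have [//|h5] := leP (s * e L *+ 2) (u + v).
  have uv0 := addr_ge0 u0 v0.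
  have : (u + v) ^+ 2 < (s * e L *+ 2) ^+ 2.
    by rewrite ltr_sqr ?nnegrE//; exact: ltW (le_lt_trans uv0 h5).
  by rewrite ltNge h4.
lra.
Qed.

Variable V : R -> R.
Definition dyad (r : R) (L : nat) : R := (Num.truncn (2 ^+ L * r))%:R / 2 ^+ L.

Lemma dyad_le r L : 0 <= r -> dyad r L <= r.
Proof.
move=> r0; rewrite ler_pdivrMr ?exprn_gt0// mulrC truncn_le//.
by rewrite mulr_ge0// exprn_ge0.
Qed.

Lemma dyad_gt r L : 0 <= r -> r < dyad r L + (2 ^+ L)^-1.
Proof.
move=> r0; rewrite -div1r -mulrDl ltr_pdivlMr ?exprn_gt0// mulrC natr1.
exact: truncnS_gt.
Qed.

(** The index of [dyad r l] on the next finer grid, of step 2^-(l+1); hence the factor 2. *)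
Definition dyad_idx (r : R) (l : nat) : nat := (2 * Num.truncn (2 ^+ l * r))%N.

(** From one level to the next the dyadic approximation either stays put or moves by one step of the
    finer grid, so each increment of [V] is zero or the one listed. The constants come from (p +
    q)^2 <= 2 p^2 + 2 q^2 and the bound 3 on the geometric prefactor. *)
Lemma chain_dyad r L : 0 <= r ->
  V (dyad r L) ^+ 2 <= 2 * V (Num.truncn r)%:R ^+ 2 +
  6 * \sum_(l < L) (3 / 2) ^+ l * (V ((dyad_idx r l).+1%:R / 2 ^+ l.+1) -
    V ((dyad_idx r l)%:R / 2 ^+ l.+1)) ^+ 2.
Proof.
move=> r0; set B := \sum_(l < L) _; pose i := dyad_idx r.
pose e l := V (dyad r l.+1) - V (dyad r l).
have eL : V (dyad r L) = V (dyad r 0) + \sum_(l < L) e l.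
  by rewrite -(big_mkord xpredT e) /e telescope_sumr// addrC subrK.
have e_le l : e l ^+ 2 <= (V ((i l).+1%:R / 2 ^+ l.+1) - V ((i l)%:R / 2 ^+ l.+1)) ^+ 2.
  have E0 : dyad r l = (i l)%:R / 2 ^+ l.+1.
    by rewrite /dyad /i /dyad_idx natrM exprS; field; rewrite expf_neq0.
  rewrite /e E0.
  have x0 : 0 <= 2 ^+ l * r by rewrite mulr_ge0// exprn_ge0.
  have y0 : 0 <= 2 ^+ l.+1 * r by rewrite mulr_ge0// exprn_ge0.
  have h1 : (Num.truncn (2 ^+ l * r))%:R <= 2 ^+ l * r by rewrite truncn_le.
  have h2 := truncnS_gt (2 ^+ l * r).
  have : Num.truncn (2 ^+ l.+1 * r) = i l \/ Num.truncn (2 ^+ l.+1 * r) = (i l).+1.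
    have h3 : (Num.truncn (2 ^+ l.+1 * r))%:R <= 2 ^+ l.+1 * r by rewrite truncn_le.
    have h4 := truncnS_gt (2 ^+ l.+1 * r).
    have h5 : (i l < (Num.truncn (2 ^+ l.+1 * r)).+1)%N.
      rewrite -(ltr_nat R) /i /dyad_idx natrM (le_lt_trans _ h4)// exprS -mulrA ler_pM2l//.
    have h6 : (Num.truncn (2 ^+ l.+1 * r) < (i l).+2)%N.
      rewrite -(ltr_nat R) (le_lt_trans h3)//.
      have -> : (i l).+2%:R = 2 * (Num.truncn (2 ^+ l * r))%:R + 2 :> R.
        by rewrite /i /dyad_idx -natrM -natrD addn2.
      rewrite exprS -mulrA; move: h2; rewrite -natr1; lra.
    move: h5 h6; rewrite !ltnS leq_eqVlt => /orP[/eqP ->|h5 h6]; first by left.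
    by right; apply/eqP; rewrite eqn_leq h5 h6.
  rewrite /dyad => -[->|->]; first by rewrite subrr expr0n/= sqr_ge0.
  by [].
have e0 : V (dyad r 0) ^+ 2 <= V (Num.truncn r)%:R ^+ 2.
  by rewrite /dyad expr0 mul1r divr1.
have eS : (\sum_(l < L) e l) ^+ 2 <= 3 * B.
  apply: le_trans (sum_sqr_le e L) _.
  have SB : \sum_(l < L) (3 / 2) ^+ l * e l ^+ 2 <= B.
    apply: ler_sum => l _.
    by rewrite ler_wpM2l// exprn_ge0// divr_ge0.
  have S0 : 0 <= \sum_(l < L) (3 / 2) ^+ l * e l ^+ 2.
    by apply: sumr_ge0 => l _; rewrite mulr_ge0 ?sqr_ge0// exprn_ge0// divr_ge0.
  apply: (@le_trans _ _ (3 * \sum_(l < L) (3 / 2) ^+ l * e l ^+ 2)); last by rewrite ler_pM2l.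
  rewrite ler_wpM2r// gerBl mulr_ge0// exprn_ge0// divr_ge0//.
rewrite eL; move: (V (Num.truncn r)%:R ^+ 2) e0 B eS => A e0 B eS {e_le eL}.
move: (V (dyad r 0)) (\sum_(l < L) e l) e0 eS => p q hp hq.
move: hp hq; rewrite !expr2 => hp hq.
have := sqr_ge0 (p - q); rewrite expr2; lra.
Qed.

Lemma dyad_cvg r : 0 <= r -> dyad r L @[L --> \oo] --> r.
Proof.
move=> r0.
have c0 : (fun L => r - (2 ^+ L)^-1) @ \oo --> r.
  rewrite -[X in _ --> X]subr0; apply: cvgB; first exact: cvg_cst.
  have := @cvg_geometric R 1 (2^-1); rewrite ger0_norm// => /(_ _).
  rewrite invf_lt1// ltr1n => /(_ isT).
  by rewrite /geometric /=; under eq_fun do rewrite mul1r exprVn.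
apply: (squeeze_cvgr _ c0 (cvg_cst r)); apply: nearW => L.
by rewrite dyad_le// andbT lerBlDr ltW// dyad_gt.
Qed.

End Chaining.

(** * Square summability of the localized multipliers *)

Section Localization2.
Context {R : realType} (n : nat).
Local Notation X := (n.-tuple R).
Implicit Types (x y z u xi : X) (a : X -> R) (rho : R).
Variable d : R.
Hypothesis d0 : 0 < d.
Local Notation k := (@phi R n d).

Definition mm rho xi : R := kap n d * ballI rho xi - mus d rho xi.

Lemma intg_mm rho : intg (lebN n) (mm rho).
Proof. by apply: intgB; [exact/intgZl/intg_ballI|exact: intg_mus]. Qed.

Lemma mmE rho xi : mm rho xi = \int[lebN n]_u (k u * (ballI rho xi - ballI rho (tsub xi u))).
Proof.
rewrite /mm /kap /mus -RintegralZr//; last exact: intg_phi.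
rewrite -RintegralB//; last exact: intg_kball.
  by apply: eq_Rintegral => u _; rewrite mulrBr.
apply: (intgM_bd (intg_phi n d)) => // u; exact: ballI_le1.
Qed.

Lemma wgtn_ge1 u : 1 <= wgtn u.
Proof.
rewrite /wgtn; elim/big_ind: _ => [//|p q p1 q1|i _]; last exact: wgt_ge1.
exact: mulr_ege1.
Qed.

Definition Wk : R := \int[lebN n]_u (k u * wgtn u).

Lemma Wk_gt0 : 0 < Wk.
Proof.
apply: lt_le_trans (kap_gt0 n d0) _; apply: le_Rintegral => //.
- exact: intg_phi.
- exact: intg_phi_wgt.
by move=> u _; rewrite ler_peMr ?phi_ge0// wgtn_ge1.
Qed.

(** Cauchy-Schwarz splits the integrand of each multiplier between k w and k (dj)^2 / w, with w =
    [wgtn]. Summed over j, the squares (dj)^2 are at most 1 + [l1 u], hence at most w^2; the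
    division leaves k w again, and the two factors are both [Wk]. *)
Lemma mm_sum_le J xi : \sum_(j < J) mm j%:R xi ^+ 2 <= Wk ^+ 2.
Proof.
pose dj (j : nat) u := ballI j%:R xi - ballI j%:R (tsub xi u).
have mdj j : measurable_fun setT (dj j).
  apply: measurable_funB => //.
  by apply: (measurableT_comp (measurable_ballI _)); exact: measurable_tsub.
have mw : measurable_fun setT (fun u : X => (wgtn u)^-1).
  by apply: (measurableT_comp measurable_inv); exact: measurable_wgtn.
have w1 := wgtn_ge1.
have djb j u : `|dj j u| <= 1.
  rewrite /dj /ballI; case: (_ < _); case: (_ < _) => /=; rewrite ?subrr ?subr0 ?sub0r ?normrN ?normr0 ?normr1//.
pose q j u := k u * (dj j u ^+ 2 / wgtn u).
have qi j : intg (lebN n) (q j).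
  apply: (intgM_bd (M := 1) (intg_phi n d)).
    by apply: measurable_funM => //; exact: measurable_funX.
  move=> u; rewrite normrM normrX normfV [`|wgtn u|]gtr0_norm ?wgtn_gt0//.
  by rewrite ler_pdivrMr ?wgtn_gt0// mul1r (le_trans _ (w1 u))// exprn_ile1.
have si j : intg (lebN n) (fun u => k u * dj j u).
  by apply: (intgM_bd (M := 1) (intg_phi n d)).
have H j : mm j%:R xi ^+ 2 <= Wk * \int[lebN n]_u q j u.
  rewrite mmE; apply: (Rintegral_cauchy_schwarz (intg_phi_wgt n d) (qi j) (si j) Wk_gt0).
  move=> c u; rewrite /q.
  have -> : k u * (dj j u ^+ 2 / wgtn u) - 2 * c * (k u * dj j u) + c ^+ 2 * (k u * wgtn u) =
      k u / wgtn u * (dj j u - c * wgtn u) ^+ 2.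
    by field; rewrite gt_eqF ?wgtn_gt0.
  by rewrite mulr_ge0 ?sqr_ge0// divr_ge0 ?phi_ge0// ltW// wgtn_gt0.
apply: (@le_trans _ _ (\sum_(j < J) Wk * \int[lebN n]_u q j u)).
  by apply: ler_sum => j _; exact: H.
rewrite -mulr_sumr expr2 ler_pM2l ?Wk_gt0//.
rewrite -(@Rintegral_sum _ _ _ (lebN n) _ _ (fun j : 'I_J => q j)) //.
apply: le_Rintegral => //.
- exact: (@intg_sum _ _ _ (lebN n) _ _ (fun j : 'I_J => q j)).
- exact: intg_phi_wgt.
move=> u _; rewrite /q -mulr_sumr ler_wpM2l ?phi_ge0//.
rewrite -mulr_suml ler_pdivrMr ?wgtn_gt0// -expr2.
apply: le_trans (wgtn_sqr u); apply: count_between; exact: enorm_tsub_le.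
Qed.

(** Real and imaginary parts of e^{i(x,xi)} times the transform of [a] at xi, with x - y kept inside
    so that the separation of x from the support stays visible. Integrated over a ball, this is the
    unnormalized partial sum [Hf]. *)
Definition Bf b a x xi : R := \int[lebN n]_y (a y * cs b (dotp (tsub x y) xi)).

Definition Hf rho b a x : R := \int[lebN n]_xi (ballI rho xi * Bf b a x xi).

Lemma BfE b a x xi : intg (lebN n) a -> Bf b a x xi =
  if b then FT true a xi * cs true (dotp x xi) + FT false a xi * cs false (dotp x xi)
  else FT true a xi * cs false (dotp x xi) - FT false a xi * cs true (dotp x xi).
Proof.
move=> ai; rewrite /FT -!RintegralZr//; try exact: intg_cs.
have iZ b1 b2 : intg (lebN n) (fun y => a y * cs b1 (dotp xi y) * cs b2 (dotp x xi)).
  apply: (intgM_bd (M := 1)); [exact: intg_cs|exact: measurable_cst|].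
  by move=> y; exact: cs_le1.
case: b.
  rewrite -RintegralD//; [|exact: iZ..].
  apply: eq_Rintegral => y _; rewrite dotpBl /cs cosB [dotp y xi]dotpC; ring.
rewrite -RintegralB//; [|exact: iZ..].
by apply: eq_Rintegral => y _; rewrite dotpBl /cs sinB [dotp y xi]dotpC; ring.
Qed.

Lemma Bf_bd b a x xi : intg (lebN n) a -> `|Bf b a x xi| <= \int[lebN n]_y `|a y|.
Proof.
move=> ai.
have i1 : intg (lebN n) (fun y => a y * cs b (dotp (tsub x y) xi)).
  apply: (intgM_bd (M := 1)) => //; last by move=> y; exact: cs_le1.
  by apply: measurable_cs; apply: measurable_dotp => //; exact: measurable_tsub.
apply: le_trans (le_normr_Rintegral measurableT i1) _.
apply: le_Rintegral => //; [exact: (intg_norm i1)|exact: intg_norm|].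
by move=> y _; rewrite normrM ler_piMr// cs_le1.
Qed.

Lemma measurable_Bf b a x : intg (lebN n) a -> measurable_fun setT (Bf b a x).
Proof.
move=> ai; rewrite (_ : Bf b a x = fun xi => if b then FT true a xi * cs true (dotp x xi) + FT false a xi * cs false (dotp x xi)
  else FT true a xi * cs false (dotp x xi) - FT false a xi * cs true (dotp x xi)); last first.
  by apply/funext => xi; exact: BfE.
have mF c := measurable_FT c ai.
have mC c : measurable_fun setT (fun xi => cs c (dotp x xi)).
  by apply: measurable_cs; exact: measurable_dotp.
by case: b; [apply: measurable_funD|apply: measurable_funB]; apply: measurable_funM.
Qed.

(** By Fubini the [mus] part is an integral over y of a(y) times the transform of [mus] at x - y.
    For each y either a(y) = 0 or that transform vanishes. *)
Lemma loc_identity b rho a x : intg (lebN n) a ->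
  (forall y, a y = 0 \/ exists i, d <= `|tnth x i - tnth y i|) ->
  kap n d * Hf rho b a x = \int[lebN n]_xi (mm rho xi * Bf b a x xi).
Proof.
move=> ai sep.
have i1 : intg (lebN n) (fun xi => ballI rho xi * Bf b a x xi).
  by apply: (intgM_bd (intg_ballI _ rho) (measurable_Bf b x ai)) => xi; exact: Bf_bd.
have i2 : intg (lebN n) (fun xi => mus d rho xi * Bf b a x xi).
  by apply: (intgM_bd (intg_mus _ d rho) (measurable_Bf b x ai)) => xi; exact: Bf_bd.
rewrite (@eq_Rintegral _ _ _ _ _ (fun xi => kap n d * (ballI rho xi * Bf b a x xi) -
   mus d rho xi * Bf b a x xi)); last by move=> xi _; rewrite /mm; ring.
rewrite RintegralB//; last exact: (intgZl _ i1).
rewrite RintegralZl//.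
suff -> : \int[lebN n]_xi (mus d rho xi * Bf b a x xi) = 0 by rewrite subr0.
rewrite (@Rfubini_bd _ _ _ _ _ (lebN n) (lebN n) _ _
  (fun w : X * X => cs b (dotp (tsub x w.2) w.1)) 1 (intg_mus _ d rho) ai).
- rewrite (@eq_Rintegral _ _ _ _ _ (fun=> 0)); first by rewrite Rintegral_cst// mul0r.
  move=> y _; have [->|[i xy]] := sep y; first by rewrite mul0r.
  have H : exists i, d <= `|tnth (tsub x y) i| by exists i; rewrite tnth_mktuple.
  rewrite [X in _ * X](_ : _ = 0) ?mulr0//.
  exact: (@mus_cs0 _ _ _ d0 rho b (tsub x y) H).
- by apply: measurable_cs; apply: measurable_dotp => //; exact: measurable_tsub.
- by move=> w; exact: cs_le1.
Qed.

Lemma intg_mmFT rho c a : intg (lebN n) a -> intg (lebN n) (fun xi => mm rho xi * FT c a xi).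
Proof.
move=> ai; apply: (intgM_bd (intg_mm rho) (measurable_FT c ai)) => xi; exact: FT_bd.
Qed.

Lemma loc_sqr rho a x : intg (lebN n) a ->
  (forall y, a y = 0 \/ exists i, d <= `|tnth x i - tnth y i|) ->
  kap n d ^+ 2 * (Hf rho true a x ^+ 2 + Hf rho false a x ^+ 2) <=
  2 * (FT2 (fun xi => mm rho xi * FT true a xi) x + FT2 (fun xi => mm rho xi * FT false a xi) x).
Proof.
move=> ai sep; rewrite mulrDr -!exprMn !loc_identity//.
set g1 := fun xi => mm rho xi * FT true a xi.
set g2 := fun xi => mm rho xi * FT false a xi.
have gi1 : intg (lebN n) g1 by exact: intg_mmFT.
have gi2 : intg (lebN n) g2 by exact: intg_mmFT.
have -> : \int[lebN n]_xi (mm rho xi * Bf true a x xi) = FT true g1 x + FT false g2 x.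
  rewrite /FT -RintegralD//; [|exact: intg_cs..].
  by apply: eq_Rintegral => xi _; rewrite BfE// /g1 /g2; ring.
have -> : \int[lebN n]_xi (mm rho xi * Bf false a x xi) = FT false g1 x - FT true g2 x.
  rewrite /FT -RintegralB//; [|exact: intg_cs..].
  by apply: eq_Rintegral => xi _; rewrite BfE// /g1 /g2; ring.
rewrite /FT2; move: (FT true g1 x) (FT false g1 x) (FT true g2 x) (FT false g2 x) => p q r s.
have := sqr_ge0 (p - s); have := sqr_ge0 (q + r); rewrite !expr2; lra.
Qed.

End Localization2.

Section Localization3.
Context {R : realType} (n : nat).
Local Notation X := (n.+1.-tuple R).

(** Plancherel is applied twice, from x to xi and from xi to y, with the square-summable multipliers
    in between; this accounts for the two factors [P] and for [W ^+ 2]. *)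
Lemma localization (r : R) : r < 3 -> exists2 L : R, 0 <= L & forall (a : X -> R) (J : nat),
  intg (lebN n.+1) a -> (forall y, enorm y < 3 -> a y = 0) ->
  (\sum_(j < J) \int[lebN n.+1]_(x in [set x | (enorm x <= r)%R])
    (Hf j%:R true a x ^+ 2 + Hf j%:R false a x ^+ 2)%:E <=
   L%:E * \int[lebN n.+1]_y (a y ^+ 2)%:E)%E.
Proof.
(* If all coordinates of y - x were smaller than this d, then [l1] of y - x would be below 3 - r,
   which is impossible for |x| <= r and |y| >= 3. *)
move=> r3; pose d := (3 - r) / n.+1%:R.
have d0 : 0 < d by rewrite divr_gt0// subr_gt0.
have k0 := @kap_gt0 R n.+1 d d0; set kp := @kap R n.+1 d in k0.
have P0 := @plC_ge0 R n.+1; set P := @plC R n.+1 in P0.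
have W0 := @Wk_gt0 R n.+1 d d0; set W := @Wk R n.+1 d in W0.
exists (2 / kp ^+ 2 * P * (W ^+ 2 * P)).
  apply: mulr_ge0; last by rewrite mulr_ge0 ?sqr_ge0.
  by apply: mulr_ge0 => //; rewrite divr_ge0 ?sqr_ge0.
move=> a J ai a3.
have sep (x y : X) : enorm x <= r -> a y = 0 \/ exists i, d <= `|tnth x i - tnth y i|.
  move=> xr; have [/a3|y3] := ltP (enorm y) 3; [by left|right].
  apply: contrapT => /forallNP H.
  pose u : X := tsub y x.
  have : enorm y <= enorm x + l1 u by apply: enorm_tri => i; rewrite tnth_mktuple addrC subrK.
  have : l1 u < \sum_(i < n.+1) d.
    apply: ltr_sum; first by apply/hasP; exists ord0 => //; rewrite mem_index_enum.
    by move=> i _; rewrite tnth_mktuple distrC ltNge; apply/negP; exact: H.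
  rewrite sumr_const card_ord -mulr_natr /d divfK ?pnatr_eq0//; lra.
pose m2 (j : nat) (xi : X) : R := mm d j%:R xi ^+ 2 * FT2 a xi.
have m20 j xi : 0 <= m2 j xi by rewrite mulr_ge0 ?sqr_ge0 ?FT2_ge0.
have mm2 j : measurable_fun setT (m2 j).
  apply: measurable_funM; last exact: measurable_FT2.
  by apply: measurable_funX; exact: (intg_measurable (intg_mm n.+1 d j%:R)).
have step j : (\int[lebN n.+1]_(x in [set x | (enorm x <= r)%R])
    (Hf j%:R true a x ^+ 2 + Hf j%:R false a x ^+ 2)%:E <=
    (2 / kp ^+ 2 * P)%:E * \int[lebN n.+1]_xi (m2 j xi)%:E)%E.
  pose g1 (xi : X) := mm d j%:R xi * FT true a xi.
  pose g2 (xi : X) := mm d j%:R xi * FT false a xi.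
  have gi1 : intg (lebN n.+1) g1 by exact: intg_mmFT.
  have gi2 : intg (lebN n.+1) g2 by exact: intg_mmFT.
  have mq1 : measurable_fun setT (fun x => (FT2 g1 x)%:E).
    by apply/measurable_EFinP; exact: measurable_FT2.
  have mq2 : measurable_fun setT (fun x => (FT2 g2 x)%:E).
    by apply/measurable_EFinP; exact: measurable_FT2.
  apply: (@le_trans _ _ (\int[lebN n.+1]_x ((2 / kp ^+ 2)%:E * ((FT2 g1 x)%:E + (FT2 g2 x)%:E)))%E).
    rewrite [leLHS]integral_mkcond; apply: sup_le_integral => x _.
      by apply: erestrict_ge0 => y _; rewrite lee_fin addr_ge0 ?sqr_ge0.
    rewrite -EFinD -EFinM patchE; case: ifPn => [/set_mem/= xr|_]; last first.
      by rewrite lee_fin mulr_ge0 ?divr_ge0 ?sqr_ge0// addr_ge0 ?FT2_ge0.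
    rewrite lee_fin mulrAC ler_pdivlMr ?exprn_gt0// mulrC.
    by apply: loc_sqr => // y; exact: sep.
  rewrite ge0_integralZl_EFin//; last 3 first.
  - by move=> x _; rewrite adde_ge0// lee_fin FT2_ge0.
  - exact: emeasurable_funD.
  - by rewrite divr_ge0// sqr_ge0.
  rewrite ge0_integralD//; last 2 first.
  - by move=> x _; rewrite lee_fin FT2_ge0.
  - by move=> x _; rewrite lee_fin FT2_ge0.
  rewrite [in leRHS]EFinM -muleA; apply: lee_wpmul2l.
    by rewrite lee_fin divr_ge0// sqr_ge0.
  apply: le_trans (leeD (plancherel_le gi1) (plancherel_le gi2)) _.
  rewrite -ge0_muleDr ?integral_ge0//; try by move=> x _; rewrite lee_fin sqr_ge0.
  rewrite lee_wpmul2l// -ge0_integralD//.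
  - rewrite le_eqVlt; apply/orP; left; apply/eqP; apply: eq_integral => xi _.
    by rewrite -EFinD /g1 /g2 /m2 /FT2; congr EFin; ring.
  - by move=> x _; rewrite lee_fin sqr_ge0.
  - by apply/measurable_EFinP; apply: measurable_funX; exact: (intg_measurable gi1).
  - by move=> x _; rewrite lee_fin sqr_ge0.
  - by apply/measurable_EFinP; apply: measurable_funX; exact: (intg_measurable gi2).
apply: le_trans (lee_sum _ (fun (j : 'I_J) _ => step j)) _.
rewrite -ge0_sume_distrr; last by move=> j _; apply: integral_ge0 => x _; rewrite lee_fin.
rewrite [in leRHS]EFinM -muleA; apply: lee_wpmul2l.
  by rewrite lee_fin mulr_ge0// divr_ge0// sqr_ge0.
rewrite -(@ge0_integral_sum _ _ _ (lebN n.+1) _ measurableT _ (fun (j : 'I_J) x => (m2 j x)%:E)); last 2 first.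
- by move=> j; exact/measurable_EFinP.
- by move=> j x _; rewrite lee_fin.
apply: (@le_trans _ _ (\int[lebN n.+1]_xi ((W ^+ 2)%:E * (FT2 a xi)%:E))%E).
  apply: sup_le_integral => xi _.
    by apply: sume_ge0 => j _; rewrite lee_fin.
  rewrite sumEFin -EFinM lee_fin /m2 -mulr_suml ler_wpM2r ?FT2_ge0//.
  exact: mm_sum_le.
rewrite ge0_integralZl_EFin ?sqr_ge0//; last 2 first.
- by move=> x _; rewrite lee_fin FT2_ge0.
- by apply/measurable_EFinP; exact: measurable_FT2.
rewrite [(W ^+ 2 * P)%:E]EFinM -muleA; apply: lee_wpmul2l; last exact: plancherel_le.
by rewrite lee_fin sqr_ge0.
Qed.

End Localization3.

(** * The maximal estimate *)

Section Square.
Context {R : realType} (n : nat).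
Local Notation X := (n.-tuple R).
Implicit Types (p q : X -> R) (x xi : X).

(** [VR] and [VI] are the real and imaginary parts of the integral of (p + iq) e^{i(x,xi)}; p and q
    will be those of fhat, cut to a ball or an annulus. *)
Definition VR p q x : R := FT true p x - FT false q x.
Definition VI p q x : R := FT false p x + FT true q x.
Definition V2 p q x : R := VR p q x ^+ 2 + VI p q x ^+ 2.

Lemma V2_ge0 p q x : 0 <= V2 p q x.
Proof. by rewrite addr_ge0 ?sqr_ge0. Qed.

Lemma V2_le p q x : V2 p q x <= 2 * (FT2 p x + FT2 q x).
Proof.
rewrite /V2 /VR /VI /FT2; move: (FT true p x) (FT false p x) (FT true q x) (FT false q x) => a b c e.
have := sqr_ge0 (a + e); have := sqr_ge0 (b - c); rewrite !expr2; lra.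
Qed.

Lemma measurable_V2 p q : intg (lebN n) p -> intg (lebN n) q ->
  measurable_fun setT (V2 p q).
Proof.
move=> pi qi; apply: measurable_funD; apply: measurable_funX;
  [apply: measurable_funB|apply: measurable_funD]; exact: measurable_FT.
Qed.

Lemma FTB b p q x : intg (lebN n) p -> intg (lebN n) q ->
  FT b (fun xi => p xi - q xi) x = FT b p x - FT b q x.
Proof.
move=> pi qi; rewrite /FT -RintegralB//; [|exact: intg_cs..].
by apply: eq_Rintegral => xi _; rewrite mulrBl.
Qed.

Lemma VRB p q p' q' x : intg (lebN n) p -> intg (lebN n) q ->
  intg (lebN n) p' -> intg (lebN n) q' ->
  VR (fun xi => p xi - p' xi) (fun xi => q xi - q' xi) x = VR p q x - VR p' q' x.
Proof. by move=> *; rewrite /VR !FTB//; ring. Qed.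

Lemma VIB p q p' q' x : intg (lebN n) p -> intg (lebN n) q ->
  intg (lebN n) p' -> intg (lebN n) q' ->
  VI (fun xi => p xi - p' xi) (fun xi => q xi - q' xi) x = VI p q x - VI p' q' x.
Proof. by move=> *; rewrite /VI !FTB//; ring. Qed.

Lemma intg_ballM rho p : measurable_fun setT p ->
  (\int[lebN n]_xi (p xi ^+ 2)%:E < +oo)%E -> intg (lebN n) (fun xi => ballI rho xi * p xi).
Proof.
move=> mp p2.
apply: (@le_intg _ _ _ _ _ (fun xi => ballI rho xi + p xi ^+ 2)).
- by apply: measurable_funM => //; exact: measurable_ballI.
- move=> xi; rewrite normrM [X in X * _]ger0_norm ?ballI_ge0// /ballI.
  case: (_ < _) => /=; last by rewrite mul0r add0r sqr_ge0.
  rewrite mul1r -[p xi ^+ 2]real_normK ?num_real//.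
  have := sqr_ge0 (`|p xi| - 1); have := normr_ge0 (p xi); rewrite !expr2; lra.
apply: intgD; first exact: intg_ballI.
by apply: ge0_intg => //; [exact: measurable_funX|move=> xi; exact: sqr_ge0].
Qed.

Lemma integral_V2_le p q : intg (lebN n) p -> intg (lebN n) q ->
  (\int[lebN n]_x (V2 p q x)%:E <= (2 * @plC R n)%:E *
    (\int[lebN n]_xi (p xi ^+ 2)%:E + \int[lebN n]_xi (q xi ^+ 2)%:E))%E.
Proof.
move=> pi qi.
have m1 : measurable_fun setT (fun x => (FT2 p x)%:E).
  by apply/measurable_EFinP; exact: measurable_FT2.
have m2 : measurable_fun setT (fun x => (FT2 q x)%:E).
  by apply/measurable_EFinP; exact: measurable_FT2.
apply: (@le_trans _ _ (\int[lebN n]_x (2%:E * ((FT2 p x)%:E + (FT2 q x)%:E)))%E).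
  apply: sup_le_integral => x _; first by rewrite lee_fin V2_ge0.
  by rewrite -EFinD -EFinM lee_fin V2_le.
rewrite ge0_integralZl_EFin//; last 2 first.
- by move=> x _; rewrite adde_ge0// lee_fin FT2_ge0.
- exact: emeasurable_funD.
rewrite EFinM -muleA lee_wpmul2l// ge0_integralD//; last 2 first.
- by move=> x _; rewrite lee_fin FT2_ge0.
- by move=> x _; rewrite lee_fin FT2_ge0.
rewrite ge0_muleDr; last 2 first.
- by apply: integral_ge0 => x _; rewrite lee_fin sqr_ge0.
- by apply: integral_ge0 => x _; rewrite lee_fin sqr_ge0.
by apply: leeD; exact: plancherel_le.
Qed.

End Square.

(** * Transforms of integrable data A + iB *)

Section Transfer.
Context {R : realType} (n : nat).
Local Notation X := (n.-tuple R).
Variables (c : R) (A B : X -> R).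
Hypothesis c0 : 0 <= c.
Hypothesis Ai : intg (lebN n) A.
Hypothesis Bi : intg (lebN n) B.

(** Real part, with [ImF] as imaginary part, of c times the integral of (A + iB) e^{-i(x,xi)}. *)
Definition ReF (xi : X) : R := c * (FT true A xi + FT false B xi).
Definition ImF (xi : X) : R := c * (FT true B xi - FT false A xi).

Lemma measurable_ReF : measurable_fun setT ReF.
Proof. by apply: measurable_funM => //; apply: measurable_funD; exact: measurable_FT. Qed.
Lemma measurable_ImF : measurable_fun setT ImF.
Proof. by apply: measurable_funM => //; apply: measurable_funB; exact: measurable_FT. Qed.

Lemma ReImF_sqr xi : ReF xi ^+ 2 + ImF xi ^+ 2 <= 2 * c ^+ 2 * (FT2 A xi + FT2 B xi).
Proof.
rewrite /ReF /ImF /FT2 !exprMn -mulrDr [leRHS](_ : _ = c ^+ 2 *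
  (2 * (FT true A xi ^+ 2 + FT false A xi ^+ 2 + (FT true B xi ^+ 2 + FT false B xi ^+ 2)))); last by ring.
apply: ler_wpM2l; first exact: sqr_ge0.
move: (FT true A xi) (FT false A xi) (FT true B xi) (FT false B xi) => a b e g.
have := sqr_ge0 (a - g); have := sqr_ge0 (e + b); rewrite !expr2; lra.
Qed.

Lemma ReImF_integral : (\int[lebN n]_xi (ReF xi ^+ 2 + ImF xi ^+ 2)%:E <=
  (2 * c ^+ 2 * @plC R n)%:E *
  (\int[lebN n]_y (A y ^+ 2)%:E + \int[lebN n]_y (B y ^+ 2)%:E))%E.
Proof.
have m1 : measurable_fun setT (fun x => (FT2 A x)%:E).
  by apply/measurable_EFinP; exact: measurable_FT2.
have m2 : measurable_fun setT (fun x => (FT2 B x)%:E).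
  by apply/measurable_EFinP; exact: measurable_FT2.
have k0 : 0 <= 2 * c ^+ 2 by rewrite mulr_ge0 ?sqr_ge0.
apply: (@le_trans _ _ (\int[lebN n]_x ((2 * c ^+ 2)%:E * ((FT2 A x)%:E + (FT2 B x)%:E)))%E).
  apply: sup_le_integral => x _; first by rewrite lee_fin addr_ge0 ?sqr_ge0.
  by rewrite -EFinD -EFinM lee_fin ReImF_sqr.
rewrite ge0_integralZl_EFin//; last 2 first.
- by move=> x _; rewrite adde_ge0// lee_fin FT2_ge0.
- exact: emeasurable_funD.
rewrite [in leRHS]EFinM -muleA lee_wpmul2l ?lee_fin// ge0_integralD//; last 2 first.
- by move=> x _; rewrite lee_fin FT2_ge0.
- by move=> x _; rewrite lee_fin FT2_ge0.
rewrite ge0_muleDr; last 2 first.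
- by apply: integral_ge0 => x _; rewrite lee_fin sqr_ge0.
- by apply: integral_ge0 => x _; rewrite lee_fin sqr_ge0.
by apply: leeD; exact: plancherel_le.
Qed.

Lemma intg_ballReF rho : intg (lebN n) (fun xi => ballI rho xi * ReF xi).
Proof.
apply: (@intgM_bd _ _ _ _ _ _ (c * (\int[lebN n]_y `|A y| + \int[lebN n]_y `|B y|))).
- exact: intg_ballI.
- exact: measurable_ReF.
move=> xi; rewrite /ReF normrM (ger0_norm c0) ler_wpM2l//.
by apply: le_trans (ler_normD _ _) _; apply: lerD; exact: FT_bd.
Qed.

Lemma intg_ballImF rho : intg (lebN n) (fun xi => ballI rho xi * ImF xi).
Proof.
apply: (@intgM_bd _ _ _ _ _ _ (c * (\int[lebN n]_y `|B y| + \int[lebN n]_y `|A y|))).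
- exact: intg_ballI.
- exact: measurable_ImF.
move=> xi; rewrite /ImF normrM (ger0_norm c0) ler_wpM2l//.
by apply: le_trans (ler_normB _ _) _; apply: lerD; exact: FT_bd.
Qed.

Lemma intg_ballBf (rho : R) b (a : X -> R) (x : X) : intg (lebN n) a ->
  intg (lebN n) (fun xi => ballI rho xi * Bf b a x xi).
Proof.
move=> ai.
by apply: (intgM_bd (intg_ballI n rho) (measurable_Bf b x ai)) => xi; exact: Bf_bd.
Qed.

(** Transforming forward and then back over a ball recombines, through [BfE], into the partial sums
    [Hf] that the localization estimates. *)
Lemma V2_F_le rho x :
  V2 (fun xi => ballI rho xi * ReF xi) (fun xi => ballI rho xi * ImF xi) x <=
  2 * c ^+ 2 * ((Hf rho true A x ^+ 2 + Hf rho false A x ^+ 2) +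
                (Hf rho true B x ^+ 2 + Hf rho false B x ^+ 2)).
Proof.
have iB := intg_ballBf rho.
have -> : V2 (fun xi => ballI rho xi * ReF xi) (fun xi => ballI rho xi * ImF xi) x =
   (c * (Hf rho true A x - Hf rho false B x)) ^+ 2 +
   (c * (Hf rho false A x + Hf rho true B x)) ^+ 2.
  rewrite /V2 /VR /VI /FT /Hf; congr (_ ^+ 2 + _ ^+ 2).
    rewrite -RintegralB//; [|exact: (intg_cs _ _ (intg_ballReF rho))|exact: (intg_cs _ _ (intg_ballImF rho))].
    rewrite -RintegralB//; [|exact: iB..].
    rewrite -RintegralZl//; last exact: (intgB (iB _ _ _ Ai) (iB _ _ _ Bi)).
    by apply: eq_Rintegral => xi _; rewrite !BfE// /ReF /ImF; ring.
  rewrite -RintegralD//; [|exact: (intg_cs _ _ (intg_ballReF rho))|exact: (intg_cs _ _ (intg_ballImF rho))].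
  rewrite -RintegralD//; [|exact: iB..].
  rewrite -RintegralZl//; last exact: (intgD (iB _ _ _ Ai) (iB _ _ _ Bi)).
  by apply: eq_Rintegral => xi _; rewrite !BfE// /ReF /ImF; ring.
rewrite !exprMn -mulrDr [leRHS](_ : _ = c ^+ 2 * (2 *
  ((Hf rho true A x ^+ 2 + Hf rho false A x ^+ 2) +
   (Hf rho true B x ^+ 2 + Hf rho false B x ^+ 2)))); last by ring.
apply: ler_wpM2l; first exact: sqr_ge0.
move: (Hf rho true A x) (Hf rho false A x) (Hf rho true B x) (Hf rho false B x) => a b e g.
have := sqr_ge0 (a + g); have := sqr_ge0 (b - e); rewrite !expr2; lra.
Qed.

End Transfer.

Local Arguments lebN : simpl never.

(** * Square sums over balls and dyadic annuli, and the majorant *)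

Section Maximal.
Context {R : realType} (n : nat).
Local Notation X := (n.+1.-tuple R).
Local Notation mu := (@lebN R n.+1).
Implicit Types (p q A B : X -> R) (x xi : X).

Definition bp (rho : R) p xi : R := ballI rho xi * p xi.

Definition sqi p : \bar R := (\int[mu]_xi (p xi ^+ 2)%:E)%E.

Lemma sqi_ge0 p : (0 <= sqi p)%E.
Proof. by apply: integral_ge0 => x _; rewrite lee_fin sqr_ge0. Qed.

Lemma integral_sub_le (r : R) (f : X -> R) (h : \bar R) : measurable_fun setT f ->
  (forall x, 0 <= f x) -> (\int[mu]_x (f x)%:E <= h)%E ->
  (\int[mu]_(x in [set x | (enorm x <= r)%R]) (f x)%:E <= h)%E.
Proof.
move=> mf f0; apply: le_trans; apply: ge0_subset_integral => //.
- exact: measurable_ball_le.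
- exact/measurable_EFinP.
- by move=> x _; rewrite lee_fin.
Qed.

Lemma sqi_bp rho p : measurable_fun setT p -> (sqi (bp rho p) <= sqi p)%E.
Proof.
move=> mp; apply: sup_le_integral => xi _; first by rewrite lee_fin sqr_ge0.
rewrite lee_fin exprMn ler_piMl ?sqr_ge0//.
by rewrite /ballI; case: (_ < _); rewrite ?expr1n ?expr0n.
Qed.

Variables (c : R).
Hypothesis c0 : 0 <= c.

(** Here p + iq stands for fhat and is approximated in L2 by transforms of A + iB. The approximant
    is localized. The error has no support property, so each of the J balls pays for it through
    Plancherel; the factor J is harmless because J stays fixed while the error tends to 0. *)
Lemma ball_sum_bound (r : R) : r < 3 -> exists2 L : R, 0 <= L &
  forall p q A B (J : nat), measurable_fun setT p -> measurable_fun setT q ->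
  (sqi p < +oo)%E -> (sqi q < +oo)%E -> intg mu A -> intg mu B ->
  (forall y, enorm y < 3 -> A y = 0) -> (forall y, enorm y < 3 -> B y = 0) ->
  (\sum_(j < J) \int[mu]_(x in [set x | (enorm x <= r)%R])
      (V2 (bp j%:R p) (bp j%:R q) x)%:E <=
   L%:E * (sqi A + sqi B) + (J%:R * (4 * @plC R n.+1))%:E *
     (sqi (fun xi => p xi - ReF c A B xi)%R + sqi (fun xi => q xi - ImF c A B xi)%R))%E.
Proof.
move=> r3; have [L L0 HL] := @localization R n r r3.
exists (4 * c ^+ 2 * L); first by rewrite !mulr_ge0 ?sqr_ge0.
move=> p q A B J mp mq p2 q2 Ai Bi A3 B3.
set e1 := fun xi => p xi - ReF c A B xi; set e2 := fun xi => q xi - ImF c A B xi.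
have mB : measurable [set x : X | enorm x <= r] by exact: measurable_ball_le.
have me1 : measurable_fun setT e1 by apply: measurable_funB => //; exact: measurable_ReF.
have me2 : measurable_fun setT e2 by apply: measurable_funB => //; exact: measurable_ImF.
have ip rho : intg mu (bp rho p) by exact: intg_ballM.
have iq rho : intg mu (bp rho q) by exact: intg_ballM.
have iR rho : intg mu (bp rho (ReF c A B)) by exact: intg_ballReF.
have iI rho : intg mu (bp rho (ImF c A B)) by exact: intg_ballImF.
have bE1 rho : bp rho e1 = fun xi => bp rho p xi - bp rho (ReF c A B) xi.
  by apply/funext => xi; rewrite /bp /e1 mulrBr.
have bE2 rho : bp rho e2 = fun xi => bp rho q xi - bp rho (ImF c A B) xi.
  by apply/funext => xi; rewrite /bp /e2 mulrBr.
have ie1 rho : intg mu (bp rho e1) by rewrite bE1; exact: intgB.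
have ie2 rho : intg mu (bp rho e2) by rewrite bE2; exact: intgB.
pose HH (j : nat) a x : R := Hf j%:R true a x ^+ 2 + Hf j%:R false a x ^+ 2.
have HH0 j a x : 0 <= HH j a x by rewrite addr_ge0 ?sqr_ge0.
have mHf rho b a : intg mu a -> measurable_fun setT (Hf rho b a).
  move=> ai; have mBf : measurable_fun setT (fun w : X * X => Bf b a w.1 w.2).
    rewrite (_ : (fun w => _) = fun w : X * X => if b then FT true a w.2 * cs true (dotp w.1 w.2) + FT false a w.2 * cs false (dotp w.1 w.2)
      else FT true a w.2 * cs false (dotp w.1 w.2) - FT false a w.2 * cs true (dotp w.1 w.2)); last first.
      by apply/funext => w; exact: BfE.
    have mF b' : measurable_fun setT (fun w : X * X => FT b' a w.2).
      exact: (measurableT_comp (measurable_FT b' ai)).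
    have mC b' : measurable_fun setT (fun w : X * X => cs b' (dotp w.1 w.2)).
      by apply: measurable_cs; exact: measurable_dotp2.
    by case: b; [apply: measurable_funD|apply: measurable_funB]; apply: measurable_funM.
  apply: (@measurable_Rintegral _ _ _ _ _ mu (fun w : X * X => ballI rho w.2 * Bf b a w.1 w.2)).
    by apply: measurable_funM => //; exact: (measurableT_comp (measurable_ballI rho)).
  by move=> x; exact: intg_ballBf.
have mHH j a : intg mu a -> measurable_fun [set x : X | enorm x <= r] (fun x => (HH j a x)%:E).
  move=> ai; apply: measurable_funTS; apply/measurable_EFinP.
  by apply: measurable_funD; apply: measurable_funX; exact: mHf.
have step (j : nat) : (\int[mu]_(x in [set x | (enorm x <= r)%R]) (V2 (bp j%:R p) (bp j%:R q) x)%:E <=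
    (4 * c ^+ 2)%:E * (\int[mu]_(x in [set x | (enorm x <= r)%R]) (HH j A x)%:E +
                       \int[mu]_(x in [set x | (enorm x <= r)%R]) (HH j B x)%:E) +
    (4 * @plC R n.+1)%:E * (sqi e1 + sqi e2))%E.
  pose v x := V2 (bp j%:R e1) (bp j%:R e2) x.
  have mv : measurable_fun setT v by exact: measurable_V2.
  apply: (@le_trans _ _ (\int[mu]_(x in [set x | (enorm x <= r)%R])
     ((4 * c ^+ 2)%:E * ((HH j A x)%:E + (HH j B x)%:E) + 2%:E * (v x)%:E))%E).
    apply: sup_le_integral => x _; first by rewrite lee_fin V2_ge0.
    rewrite -EFinD lee_fin.
    have h := V2_F_le c0 Ai Bi j%:R x.
    have e : V2 (bp j%:R p) (bp j%:R q) x <=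
       2 * V2 (bp j%:R (ReF c A B)) (bp j%:R (ImF c A B)) x + 2 * v x.
      rewrite /v bE1 bE2 /V2 VRB// VIB//.
      move: (VR _ _ x) (VR _ _ x) (VI _ _ x) (VI _ _ x) => s t u w.
      have := sqr_ge0 (s - 2 * t); have := sqr_ge0 (u - 2 * w).
      have := sqr_ge0 (t - 2 * s); have := sqr_ge0 (w - 2 * u); rewrite !expr2; lra.
    apply: le_trans e _; rewrite lerD2r.
    rewrite [leRHS](_ : _ = 2 * (2 * c ^+ 2 * (HH j A x + HH j B x))); last by ring.
    by rewrite ler_pM2l.
  rewrite ge0_integralD//; last 4 first.
  - move=> x _; apply: mule_ge0; first by rewrite lee_fin mulr_ge0 ?sqr_ge0.
    by apply: adde_ge0; rewrite lee_fin.
  - by apply: measurable_funeM; apply: emeasurable_funD; exact: mHH.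
  - by move=> x _; apply: mule_ge0 => //; rewrite lee_fin V2_ge0.
  - by apply: measurable_funeM; apply: measurable_funTS; exact/measurable_EFinP.
  apply: leeD.
    rewrite ge0_integralZl_EFin//; last 3 first.
    - by move=> x _; apply: adde_ge0; rewrite lee_fin.
    - by apply: emeasurable_funD; exact: mHH.
    - by rewrite mulr_ge0 ?sqr_ge0.
    rewrite ge0_integralD//; [by move=> x _; rewrite lee_fin|exact: mHH|by move=> x _; rewrite lee_fin|exact: mHH].
  rewrite ge0_integralZl_EFin//; last 2 first.
  - by move=> x _; rewrite lee_fin V2_ge0.
  - by apply: measurable_funTS; exact/measurable_EFinP.
  rewrite (_ : 4 * @plC R n.+1 = 2 * (2 * @plC R n.+1)); last by ring.
  rewrite [in leRHS]EFinM -muleA lee_wpmul2l//.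
  apply: integral_sub_le => //; first by move=> x; exact: V2_ge0.
  apply: le_trans (integral_V2_le (ie1 _) (ie2 _)) _.
  apply: lee_wpmul2l; first by rewrite lee_fin mulr_ge0// plC_ge0.
  by apply: leeD; exact: sqi_bp.
apply: le_trans (lee_sum _ (fun (j : 'I_J) _ => step j)) _.
rewrite big_split; apply: leeD.
  rewrite -ge0_sume_distrr; last first.
    by move=> j _; apply: adde_ge0; apply: integral_ge0 => x _; rewrite lee_fin.
  rewrite [in leRHS]EFinM -muleA; apply: lee_wpmul2l; first by rewrite lee_fin mulr_ge0 ?sqr_ge0.
  rewrite big_split ge0_muleDr ?sqi_ge0//.
  by apply: leeD; exact: HL.
rewrite [in leRHS]EFinM -muleA; set Y := (_%:E * (sqi e1 + sqi e2))%E.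
have Y0 : (0 <= Y)%E.
  apply: mule_ge0; first by rewrite lee_fin mulr_ge0 ?plC_ge0.
  by apply: adde_ge0; exact: sqi_ge0.
elim: (J) => [|m ih]; first by rewrite big_ord0 mul0e.
rewrite big_ord_recr -natr1 EFinD ge0_muleDl ?lee_fin// mul1e.
exact: leeD.
Qed.

(** Grid radii of step 2^-(l+1): level l hosts the move from [dyad r l] to [dyad r l.+1], hence the
    shift. *)
Definition dlo (l i : nat) : R := i%:R / 2 ^+ l.+1.

Definition ap (l i : nat) p xi : R := bp (dlo l i.+1) p xi - bp (dlo l i) p xi.

Lemma dlo_ge0 l i : 0 <= dlo l i.
Proof. by rewrite divr_ge0// exprn_ge0. Qed.

Lemma dloS l i : dlo l i.+1 = dlo l i + (2 ^+ l.+1)^-1.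
Proof. by rewrite /dlo -natr1 mulrDl mul1r. Qed.

Lemma dlo_leS l i : dlo l i <= dlo l i.+1.
Proof. by rewrite dloS lerDl invr_ge0 exprn_ge0. Qed.

Lemma ballI_mono (s t : R) xi : s <= t -> ballI s xi <= ballI t xi.
Proof.
move=> st; rewrite /ballI ler_nat; case: (ltP _ s) => // h.
by rewrite (lt_le_trans h st).
Qed.

Lemma ap_sqr l i p xi :
  ap l i p xi ^+ 2 = (ballI (dlo l i.+1) xi - ballI (dlo l i) xi) * p xi ^+ 2.
Proof.
rewrite /ap /bp -mulrBl exprMn; congr (_ * _).
have := @ballI_mono _ _ xi (dlo_leS l i); rewrite /ballI.
by case: (_ < _); case: (_ < _) => /=; rewrite ?subrr ?subr0 ?expr1n ?expr0n//= ler10.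
Qed.

Lemma ap_supp l i p xi : ~~ (dlo l i <= enorm xi < dlo l i.+1) -> ap l i p xi = 0.
Proof.
rewrite /ap /bp -mulrBl negb_and -ltNge -leNgt /ballI => /orP[h|h].
  by rewrite h (lt_le_trans h (dlo_leS l i)) subrr mul0r.
have h' := le_trans (dlo_leS l i) h.
by rewrite !ltNge h h' /= subrr mul0r.
Qed.

(** The annuli of one level are disjoint; their indicators telescope. *)
Lemma sum_sqi_ap l p M : measurable_fun setT p ->
  (\sum_(i < M) sqi (ap l i p) <= sqi p)%E.
Proof.
move=> mp.
rewrite -(@ge0_integral_sum _ _ _ mu _ measurableT _ (fun (i : 'I_M) x => (ap l i p x ^+ 2)%:E)); last 2 first.
- move=> i; apply/measurable_EFinP; apply: measurable_funX; apply: measurable_funB;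
  by apply: measurable_funM => //; exact: measurable_ballI.
- by move=> i x _; rewrite lee_fin sqr_ge0.
apply: sup_le_integral => x _; first by apply: sume_ge0 => i _; rewrite lee_fin sqr_ge0.
rewrite sumEFin lee_fin (eq_bigr _ (fun (i : 'I_M) _ => ap_sqr l i p x)) -mulr_suml.
rewrite ler_piMl ?sqr_ge0//.
rewrite -(big_mkord xpredT (fun i => ballI (dlo l i.+1) x - ballI (dlo l i) x)).
rewrite (telescope_sumr (fun i => ballI (dlo l i) x))//.
apply: (@le_trans _ _ (ballI (dlo l M) x)); first by rewrite gerBl ballI_ge0.
by apply: le_trans (ler_norm _) _; exact: ballI_le1.
Qed.

Lemma geo_le M : \sum_(l < M) (3 / 4) ^+ l <= 4 :> R.
Proof.
suff -> : \sum_(l < M) (3 / 4) ^+ l = 4 - 4 * (3 / 4) ^+ M :> R.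
  by rewrite gerBl mulr_ge0// exprn_ge0// divr_ge0.
elim: M => [|M ih]; first by rewrite big_ord0 expr0; ring.
by rewrite big_ord_recr/= ih exprS; field.
Qed.

Lemma intg_ap l i p : measurable_fun setT p -> (sqi p < +oo)%E -> intg mu (ap l i p).
Proof. by move=> mp p2; apply: intgB; exact: intg_ballM. Qed.

(** Every annulus of a level is summed, so the index no longer depends on the radius, and
    disjointness makes this free. The weight (3/2)^l times the gain 2^-l is (3/4)^l, whose sum is at
    most 4. *)
Lemma ann_sum_bound (r : R) : r < 3 -> exists2 C : R, 0 <= C &
  forall p q (M : nat), measurable_fun setT p -> measurable_fun setT q ->
  (sqi p < +oo)%E -> (sqi q < +oo)%E ->
  (\sum_(l < M) ((3 / 2) ^+ l)%:E * \sum_(i < M) \int[mu]_(x in [set x | (enorm x <= r)%R])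
      (V2 (ap l i p) (ap l i q) x)%:E <= C%:E * (sqi p + sqi q))%E.
Proof.
move=> r3; have [C C0 HC] := @annulus_bound R n.
exists (4 * C); first by rewrite mulr_ge0.
move=> p q M mp mq p2 q2.
have step l i : (\int[mu]_(x in [set x | (enorm x <= r)%R]) (V2 (ap l i p) (ap l i q) x)%:E
    <= (C / 2 ^+ l)%:E * (sqi (ap l i p) + sqi (ap l i q)))%E.
  have ip := intg_ap l i mp p2; have iq := intg_ap l i mq q2.
  have mE f : intg mu f -> measurable_fun [set x : X | enorm x <= 3] (fun x => (FT2 f x)%:E).
    by move=> fi; apply: measurable_funTS; apply/measurable_EFinP; exact: measurable_FT2.
  have m3 : measurable [set x : X | enorm x <= 3] by exact: measurable_ball_le.
  apply: (@le_trans _ _ (\int[mu]_(x in [set x | (enorm x <= 3)%R]) (V2 (ap l i p) (ap l i q) x)%:E)%E).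
    apply: ge0_subset_integral => //.
    - exact: measurable_ball_le.
    - by apply: measurable_funTS; apply/measurable_EFinP; exact: measurable_V2.
    - by move=> x _; rewrite lee_fin V2_ge0.
    - by move=> x /= h; rewrite (le_trans h)// ltW.
  apply: (@le_trans _ _ (\int[mu]_(x in [set x | (enorm x <= 3)%R])
      (2%:E * ((FT2 (ap l i p) x)%:E + (FT2 (ap l i q) x)%:E)))%E).
    apply: sup_le_integral => x _; first by rewrite lee_fin V2_ge0.
    by rewrite -EFinD -EFinM lee_fin V2_le.
  rewrite ge0_integralZl_EFin//; last 2 first.
  - by move=> x _; rewrite adde_ge0// lee_fin FT2_ge0.
  - by apply: emeasurable_funD; exact: mE.
  rewrite ge0_integralD//; [|by move=> x _; rewrite lee_fin FT2_ge0|exact: mE|by move=> x _; rewrite lee_fin FT2_ge0|exact: mE].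
  have e : C * (dlo l i.+1 - dlo l i) = C / 2 ^+ l / 2.
    by rewrite dloS addrC addKr exprS invfM; field; rewrite expf_neq0.
  have h1 := HC _ _ _ (dlo_ge0 l i) (dlo_leS l i) ip (@ap_supp l i p).
  have h2 := HC _ _ _ (dlo_ge0 l i) (dlo_leS l i) iq (@ap_supp l i q).
  rewrite e in h1 h2.
  apply: le_trans (lee_wpmul2l _ (leeD h1 h2)) _ => //.
  rewrite -ge0_muleDr ?sqi_ge0// muleA -EFinM.
  by rewrite (_ : 2 * (C / 2 ^+ l / 2) = C / 2 ^+ l)//; field; rewrite expf_neq0.
have Cl l : 0 <= C / 2 ^+ l by rewrite divr_ge0// exprn_ge0.
apply: (@le_trans _ _ (\sum_(l < M) ((3 / 2) ^+ l * (C / 2 ^+ l))%:E * (sqi p + sqi q))%E).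
  apply: lee_sum => l _; rewrite EFinM -muleA; apply: lee_wpmul2l.
    by rewrite lee_fin exprn_ge0// divr_ge0.
  apply: le_trans (lee_sum _ (fun (i : 'I_M) _ => step l i)) _.
  rewrite -ge0_sume_distrr; last by move=> i _; rewrite adde_ge0// sqi_ge0.
  apply: lee_wpmul2l; first by rewrite lee_fin.
  by rewrite big_split; apply: leeD; exact: sum_sqi_ap.
rewrite -ge0_sume_distrl; last first.
  by move=> l _; rewrite lee_fin mulr_ge0// exprn_ge0// divr_ge0.
apply: lee_wpmul2r; first by rewrite adde_ge0// sqi_ge0.
rewrite sumEFin lee_fin (eq_bigr (fun l : 'I_M => C * (3 / 4) ^+ l)).
  by rewrite -mulr_sumr mulrC ler_wpM2r// geo_le.
move=> l _; rewrite (_ : 3 / 4 = 3 / 2 / 2 :> R); last by field.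
by rewrite [in RHS]expr_div_n mulrCA.
Qed.

(** The constants 2 and 6 and the weights are those of [chain_dyad]. *)
Definition GM p q (M : nat) x : R :=
  2 * (\sum_(j < M) V2 (bp j%:R p) (bp j%:R q) x) +
  6 * \sum_(l < M) (3 / 2) ^+ l * \sum_(i < M) V2 (ap l i p) (ap l i q) x.

Lemma GM_ge0 p q M x : 0 <= GM p q M x.
Proof.
rewrite addr_ge0// mulr_ge0// sumr_ge0// => l _; first exact: V2_ge0.
by rewrite mulr_ge0 ?exprn_ge0 ?divr_ge0// sumr_ge0// => i _; exact: V2_ge0.
Qed.

Lemma measurable_GM p q M : measurable_fun setT p -> measurable_fun setT q ->
  (sqi p < +oo)%E -> (sqi q < +oo)%E -> measurable_fun setT (GM p q M).
Proof.
move=> mp mq p2 q2.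
have m1 j : measurable_fun setT (V2 (bp j%:R p) (bp j%:R q)).
  by apply: measurable_V2; exact: intg_ballM.
have m2 l i : measurable_fun setT (V2 (ap l i p) (ap l i q)).
  by apply: measurable_V2; exact: intg_ap.
apply: measurable_funD; apply: measurable_funM => //.
  by apply: measurable_sum => j.
by apply: measurable_sum => l; apply: measurable_funM => //; apply: measurable_sum => i.
Qed.

Lemma integral_GM p q M r : measurable_fun setT p -> measurable_fun setT q ->
  (sqi p < +oo)%E -> (sqi q < +oo)%E ->
  (\int[mu]_(x in [set x | (enorm x <= r)%R]) (GM p q M x)%:E =
   2%:E * (\sum_(j < M) \int[mu]_(x in [set x | (enorm x <= r)%R])
      (V2 (bp j%:R p) (bp j%:R q) x)%:E) +
   6%:E * \sum_(l < M) ((3 / 2) ^+ l)%:E * \sum_(i < M)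
     \int[mu]_(x in [set x | (enorm x <= r)%R]) (V2 (ap l i p) (ap l i q) x)%:E)%E.
Proof.
move=> mp mq p2 q2; set D := [set x | _].
have mD : measurable D by exact: measurable_ball_le.
have m1 j : measurable_fun D (fun x => (V2 (bp j%:R p) (bp j%:R q) x)%:E).
  apply: measurable_funTS; apply/measurable_EFinP.
  by apply: measurable_V2; exact: intg_ballM.
have m2 l i : measurable_fun D (fun x => (V2 (ap l i p) (ap l i q) x)%:E).
  apply: measurable_funTS; apply/measurable_EFinP.
  by apply: measurable_V2; exact: intg_ap.
have w0 (l : nat) : 0 <= (3 / 2) ^+ l :> R by rewrite exprn_ge0// divr_ge0.
pose S1 x : \bar R := (\sum_(j < M) (V2 (bp j%:R p) (bp j%:R q) x)%:E)%E.
pose S3 (l : nat) x : \bar R := (\sum_(i < M) (V2 (ap l i p) (ap l i q) x)%:E)%E.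
pose S2 x : \bar R := (\sum_(l < M) ((3 / 2) ^+ l)%:E * S3 l x)%E.
have S10 x : (0 <= S1 x)%E by apply: sume_ge0 => j _; rewrite lee_fin V2_ge0.
have S30 l x : (0 <= S3 l x)%E by apply: sume_ge0 => j _; rewrite lee_fin V2_ge0.
have S20 x : (0 <= S2 x)%E by apply: sume_ge0 => l _; rewrite mule_ge0 ?lee_fin.
have mS1 : measurable_fun D S1 by apply: emeasurable_sum => j.
have mS3 l : measurable_fun D (S3 l) by apply: emeasurable_sum => j.
have mS2 : measurable_fun D S2.
  by apply: emeasurable_sum => l; exact: measurable_funeM.
rewrite (eq_integral (fun x => 2%:E * S1 x + 6%:E * S2 x)%E); last first.
  move=> x _; rewrite /GM EFinD !EFinM -sumEFin; congr (_ + 6%:E * _)%E.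
  by rewrite -sumEFin; apply: eq_bigr => l _; rewrite EFinM -sumEFin.
rewrite ge0_integralD//; last 4 first.
- by move=> x _; rewrite mule_ge0.
- exact: measurable_funeM.
- by move=> x _; rewrite mule_ge0.
- exact: measurable_funeM.
rewrite !ge0_integralZl_EFin//.
congr (_ * _ + _ * _)%E.
  by rewrite ge0_integral_sum// => j x _; rewrite lee_fin V2_ge0.
rewrite ge0_integral_sum//; last 2 first.
- by move=> l; exact: measurable_funeM.
- by move=> l x _; rewrite mule_ge0 ?lee_fin.
apply: eq_bigr => l _; rewrite ge0_integralZl_EFin//; congr (_ * _)%E.
by rewrite ge0_integral_sum// => j x _; rewrite lee_fin V2_ge0.
Qed.

Lemma sqi_split p (h : X -> R) : measurable_fun setT p -> measurable_fun setT h ->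
  (sqi p <= 2%:E * sqi h + 2%:E * sqi (fun xi => p xi - h xi)%R)%E.
Proof.
move=> mp mh.
have m1 : measurable_fun setT (fun xi => (h xi ^+ 2)%:E).
  by apply/measurable_EFinP; exact: measurable_funX.
have m2 : measurable_fun setT (fun xi => ((p xi - h xi) ^+ 2)%:E).
  by apply/measurable_EFinP; apply: measurable_funX; exact: measurable_funB.
have z1 xi : (0 <= (h xi ^+ 2)%:E)%E by rewrite lee_fin sqr_ge0.
have z2 xi : (0 <= ((p xi - h xi) ^+ 2)%:E)%E by rewrite lee_fin sqr_ge0.
rewrite /sqi -!ge0_integralZl_EFin// -ge0_integralD//; last 4 first.
- by move=> xi _; rewrite mule_ge0.
- exact: measurable_funeM.
- by move=> xi _; rewrite mule_ge0.
- exact: measurable_funeM.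
apply: sup_le_integral => xi _; first by rewrite lee_fin sqr_ge0.
rewrite -!EFinM -EFinD lee_fin.
have := sqr_ge0 (p xi - 2 * h xi); rewrite !expr2; lra.
Qed.

End Maximal.

Lemma mem_setb (T : Type) (b : T -> bool) (x : T) : (x \in [set y | b y]) = b x.
Proof. by apply/idP/idP => [/set_mem//|h]; exact/mem_set. Qed.

(** * From the majorant to the spectral expansion *)

Section Final.
Context {R : realType} (n : nat).
Local Notation X := (n.+1.-tuple R).
Local Notation mu := (@lebN R n.+1).
Implicit Types (p q : X -> R) (x xi : X).

(** The truncations [A k] and [B k] approximate with [M] fixed, so the error disappears in the limit
    and [K] does not depend on [M]. *)
Lemma GM_bound (c r : R) : 0 <= c -> r < 3 -> exists2 K : R, 0 <= K &
  forall p q (A B : nat -> X -> R) (e : R) (M : nat),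
  measurable_fun setT p -> measurable_fun setT q ->
  (sqi p < +oo)%E -> (sqi q < +oo)%E ->
  (forall k, intg mu (A k)) -> (forall k, intg mu (B k)) ->
  (forall k y, enorm y < 3 -> A k y = 0) -> (forall k y, enorm y < 3 -> B k y = 0) ->
  (forall k, sqi (A k) + sqi (B k) <= e%:E)%E ->
  ((fun k => sqi (fun xi => p xi - ReF c (A k) (B k) xi)%R +
             sqi (fun xi => q xi - ImF c (A k) (B k) xi)%R)%E @ \oo --> 0%E) ->
  (\int[mu]_(x in [set x | (enorm x <= r)%R]) (GM p q M x)%:E <= (K * e)%:E)%E.
Proof.
move=> c0 r3.
have [L L0 HL] := @ball_sum_bound R n c c0 r r3.
have [C C0 HC] := @ann_sum_bound R n r r3.
have P0 := @plC_ge0 R n.+1; set P := @plC R n.+1 in P0 HL.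
(* The balls give 2 L. For the annuli, 24 is the product of the 6 in [GM], the 2 in [sqi_split] and
   the 2 in [ReImF_integral]. *)
exists (2 * L + 24 * C * (c ^+ 2 * P)).
  by apply: addr_ge0; [exact: mulr_ge0|rewrite !mulr_ge0 ?sqr_ge0].
move=> p q A B e M mp mq p2 q2 Ai Bi A3 B3 Ee.
set D := (fun k : nat => _); move=> /fine_cvgP[Dfin Dcvg].
(* The total coefficient of the approximation error [dk], for this fixed [M]. *)
pose K' := 2 * (M%:R * (4 * P)) + 12 * C.
have K'0 : 0 <= K' by rewrite addr_ge0 ?mulr_ge0.
apply/lee_addgt0Pr => eps eps0.
have e'0 : 0 < eps / (K' + 1) by rewrite divr_gt0// ltr_wpDl.
have /cvgrPdist_lt/(_ _ e'0) Dlt := Dcvg.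
near \oo => k.
have Dk : D k \is a fin_num by near: k.
have Dk1 : `|0 - (fine \o D) k| < eps / (K' + 1) by near: k.
have D0 : (0 <= D k)%E by rewrite /D adde_ge0 ?sqi_ge0.
pose dk := fine (D k).
have DkE : D k = dk%:E by rewrite fineK.
have dk0 : 0 <= dk by rewrite -lee_fin -DkE.
have Dk2 : K' * dk <= eps.
  move: Dk1; rewrite sub0r normrN /= -/dk ger0_norm// ltr_pdivlMr ?ltr_wpDl// => h.
  by rewrite mulrC (le_trans _ (ltW h))// ler_wpM2l// lerDl.
have S1 : (\sum_(j < M) \int[mu]_(x in [set x | (enorm x <= r)%R])
      (V2 (bp j%:R p) (bp j%:R q) x)%:E <= (L * e + M%:R * (4 * P) * dk)%:E)%E.
  apply: le_trans (HL p q (A k) (B k) M mp mq p2 q2 (Ai k) (Bi k) (A3 k) (B3 k)) _.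
  rewrite [X in (_ + _ * X <= _)%E](_ : _ = dk%:E)// EFinD !EFinM; apply: leeD.
    by apply: lee_wpmul2l; rewrite ?lee_fin.
  by [].
have mRe := @measurable_ReF R n.+1 c (A k) (B k) (Ai k) (Bi k).
have mIm := @measurable_ImF R n.+1 c (A k) (B k) (Ai k) (Bi k).
have SF : (sqi (ReF c (A k) (B k)) + sqi (ImF c (A k) (B k)) <= (2 * c ^+ 2 * P * e)%:E)%E.
  have := @ReImF_integral R n.+1 c (A k) (B k) (Ai k) (Bi k).
  under eq_integral do rewrite EFinD.
  rewrite ge0_integralD//; last 4 first.
  - by move=> y _; rewrite lee_fin sqr_ge0.
  - by apply/measurable_EFinP; exact: measurable_funX.
  - by move=> y _; rewrite lee_fin sqr_ge0.
  - by apply/measurable_EFinP; exact: measurable_funX.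
  move=> h; apply: le_trans h _; rewrite [in leRHS]EFinM; apply: lee_wpmul2l; last exact: Ee.
  by rewrite lee_fin !mulr_ge0 ?sqr_ge0.
have SG : (sqi p + sqi q <= (2 * (2 * c ^+ 2 * P * e) + 2 * dk)%:E)%E.
  apply: le_trans (leeD (sqi_split mp mRe) (sqi_split mq mIm)) _.
  apply: (@le_trans _ _ (2%:E * (sqi (ReF c (A k) (B k)) + sqi (ImF c (A k) (B k))) +
      2%:E * D k)%E).
    have AC (u v w z : \bar R) : (0 <= u)%E -> (0 <= v)%E -> (0 <= w)%E -> (0 <= z)%E ->
        (2%:E * u + 2%:E * v + (2%:E * w + 2%:E * z) = 2%:E * (u + w) + 2%:E * (v + z))%E.
      by move=> u0 v0 w0 z0; rewrite !ge0_muleDr// [LHS]addeACA.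
    by rewrite [leLHS]AC ?sqi_ge0.
  rewrite [leRHS]EFinD; apply: leeD; rewrite [leRHS]EFinM.
    exact: lee_wpmul2l.
  by rewrite DkE.
have S2 := le_trans (HC p q M mp mq p2 q2) (lee_wpmul2l (C0 : (0 <= C%:E)%E) SG).
rewrite integral_GM//.
apply: le_trans (leeD (lee_wpmul2l _ S1) (lee_wpmul2l _ S2)) _ => //.
rewrite -!EFinM -!EFinD lee_fin.
move: Dk2; rewrite /K'; lra.
Unshelve. all: by end_near. Qed.

(** Balls are defined by a strict inequality and [dyad] approaches rho from below: a point with |xi|
    < rho is eventually inside, one with |xi| >= rho never is. Dominated convergence applies. *)
Lemma FT_dyad_cvg b p x rho : 0 <= rho -> measurable_fun setT p -> (sqi p < +oo)%E ->
  FT b (bp (dyad rho L) p) x @[L --> \oo] --> FT b (bp rho p) x.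
Proof.
move=> rho0 mp p2.
have ip t : intg mu (bp t p) by exact: intg_ballM.
apply: fine_cvg; rewrite -(intg_EFin (intg_cs b x (ip rho))).
apply: (@dominated_cvg _ _ _ mu setT measurableT
  (fun L xi => (bp (dyad rho L) p xi * cs b (dotp x xi))%:E)
  (fun xi => (bp rho p xi * cs b (dotp x xi))%:E)
  (fun xi => `|bp rho p xi|%:E)) => //.
- move=> L; apply/measurable_EFinP; exact: (intg_measurable (intg_cs b x (ip _))).
- move=> xi _; apply: cvg_near_cst.
  have [h|h] := ltP (enorm xi) rho.
    near=> L; rewrite /bp /ballI h.
    have -> // : enorm xi < dyad rho L.
    by near: L; exact: (cvgr_gt _ (dyad_cvg rho0) _ h).
  apply: nearW => L; rewrite /bp /ballI !ltNge h.
  by rewrite (le_trans (dyad_le L rho0) h).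
- exact: (intg_norm (ip rho)).
- move=> L xi _; rewrite /= lee_fin normrM.
  apply: (@le_trans _ _ (`|bp (dyad rho L) p xi|)); first by rewrite ler_piMr// cs_le1.
  rewrite /bp !normrM ler_wpM2r// !ger0_norm ?ballI_ge0//.
  by apply: ballI_mono; exact: dyad_le.
Unshelve. all: by end_near. Qed.

(** Chaining bounds the dyadic radii, and left continuity then reaches rho. All values of [M] are
    needed because the number of terms used grows with rho and with the depth L. *)
Lemma V2_le_GM p q x rho (s : R) : 0 <= rho ->
  measurable_fun setT p -> measurable_fun setT q -> (sqi p < +oo)%E -> (sqi q < +oo)%E ->
  (forall M, GM p q M x <= s) -> V2 (bp rho p) (bp rho q) x <= s.
Proof.
move=> rho0 mp mq p2 q2 Hs.
have ip t : intg mu (bp t p) by exact: intg_ballM.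
have iq t : intg mu (bp t q) by exact: intg_ballM.
have dy L : V2 (bp (dyad rho L) p) (bp (dyad rho L) q) x <= s.
  have h1 := chain_dyad (fun t => VR (bp t p) (bp t q) x) L rho0.
  have h2 := chain_dyad (fun t => VI (bp t p) (bp t q) x) L rho0.
  (* Large enough that [Num.truncn rho] and every [dyad_idx rho l] with l <= L lie below L + m. *)
  pose m := ((Num.truncn rho).+1 + (dyad_idx rho L).+1)%N.
  apply: le_trans (Hs (L + m)%N).
  have kk (l : nat) : (l <= L)%N -> (dyad_idx rho l < L + m)%N.
    move=> lL; rewrite /m addnA addnS ltnS; apply: leq_trans (leq_addl _ _).
    rewrite /dyad_idx leq_mul2l; apply/orP; right; apply: le_truncn.
    by apply: ler_wpM2r => //; apply: ler_weXn2l => //; rewrite ler1n.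
  have jM : (Num.truncn rho < L + m)%N by rewrite /m addnCA; exact: leq_addr.
  have b1 : V2 (bp (Num.truncn rho)%:R p) (bp (Num.truncn rho)%:R q) x <=
      \sum_(j < L + m) V2 (bp j%:R p) (bp j%:R q) x.
    rewrite (bigD1 (Ordinal jM))//= lerDl; apply: sumr_ge0 => j _; exact: V2_ge0.
  have b2 : \sum_(l < L) (3 / 2) ^+ l * V2 (ap l (dyad_idx rho l) p) (ap l (dyad_idx rho l) q) x <=
      \sum_(l < L + m) (3 / 2) ^+ l * \sum_(i < L + m) V2 (ap l i p) (ap l i q) x.
    have w0 (l : nat) : 0 <= (3 / 2) ^+ l :> R by rewrite exprn_ge0// divr_ge0.
    rewrite [leRHS]big_split_ord /=; apply: (@le_trans _ _ (\sum_(l < L) (3 / 2) ^+ l * \sum_(i < L + m) V2 (ap l i p) (ap l i q) x)).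
      apply: ler_sum => l _; apply: ler_wpM2l => //.
      rewrite (bigD1 (Ordinal (kk l (ltnW (ltn_ord l)))))//= lerDl.
      by apply: sumr_ge0 => j _; exact: V2_ge0.
    rewrite lerDl; apply: sumr_ge0 => l _; rewrite mulr_ge0//.
    by apply: sumr_ge0 => j _; exact: V2_ge0.
  have e : \sum_(l < L) (3 / 2) ^+ l * V2 (ap l (dyad_idx rho l) p) (ap l (dyad_idx rho l) q) x =
      \sum_(l < L) (3 / 2) ^+ l * (VR (bp (@dlo R l (dyad_idx rho l).+1) p) (bp (@dlo R l (dyad_idx rho l).+1) q) x -
         VR (bp (@dlo R l (dyad_idx rho l)) p) (bp (@dlo R l (dyad_idx rho l)) q) x) ^+ 2 +
      \sum_(l < L) (3 / 2) ^+ l * (VI (bp (@dlo R l (dyad_idx rho l).+1) p) (bp (@dlo R l (dyad_idx rho l).+1) q) x -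
         VI (bp (@dlo R l (dyad_idx rho l)) p) (bp (@dlo R l (dyad_idx rho l)) q) x) ^+ 2.
    rewrite -big_split; apply: eq_bigr => l _; rewrite [RHS]/= -mulrDr; congr (_ * _).
    by rewrite -VRB// -VIB//.
  cbv beta in h1, h2.
  rewrite /GM; move: h1 h2 b1 b2; rewrite e /V2 /dlo; lra.
have cv : V2 (bp (dyad rho L) p) (bp (dyad rho L) q) x @[L --> \oo] --> V2 (bp rho p) (bp rho q) x.
  rewrite /V2 /VR /VI !expr2.
  apply: cvgD; apply: cvgM.
  - by apply: cvgB; exact: FT_dyad_cvg.
  - by apply: cvgB; exact: FT_dyad_cvg.
  - by apply: cvgD; exact: FT_dyad_cvg.
  - by apply: cvgD; exact: FT_dyad_cvg.
rewrite -(cvg_lim (@Rhausdorff R) cv); apply: limr_le; first by apply/cvg_ex; eexists; exact: cv.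
by apply: nearW => L; exact: dy.
Qed.

Lemma GM_nd p q x : {homo (fun M => GM p q M x) : a b / (a <= b)%N >-> a <= b}.
Proof.
move=> a b /subnK <-; rewrite addnC; set m := (b - a)%N.
have w0 (l : nat) : 0 <= (3 / 2) ^+ l :> R by rewrite exprn_ge0// divr_ge0.
have V0 l i := @V2_ge0 R n.+1 (ap l i p) (ap l i q) x.
apply: lerD; rewrite ler_pM2l//.
  by rewrite [leRHS]big_split_ord lerDl sumr_ge0// => j _; exact: V2_ge0.
rewrite [leRHS]big_split_ord /=.
apply: (@le_trans _ _ (\sum_(l < a) (3 / 2) ^+ l * \sum_(i < a + m) V2 (ap l i p) (ap l i q) x)).
  apply: ler_sum => l _; apply: ler_wpM2l => //.
  by rewrite [leRHS]big_split_ord lerDl sumr_ge0.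
by rewrite lerDl sumr_ge0// => l _; rewrite mulr_ge0// sumr_ge0.
Qed.

Lemma cnorm_sqr (z : R[i]) : cnorm z ^+ 2 = complex.Re z ^+ 2 + complex.Im z ^+ 2.
Proof. by rewrite sqr_sqrtr// addr_ge0 ?sqr_ge0. Qed.

Lemma cnorm_ge0 (z : R[i]) : 0 <= cnorm z. Proof. exact: sqrtr_ge0. Qed.

(** The order m only reparametrizes the radius, rho = lam^(1/(2m)), so the supremum over lambda is
    controlled by balls of all radii. *)
Lemma Elam_V2 m (lam : R) (f : X -> R[i]) x : (1 <= m)%N -> 0 < lam ->
  measurable_fun setT (fun xi => complex.Re (fourierL2 f xi)) ->
  measurable_fun setT (fun xi => complex.Im (fourierL2 f xi)) ->
  (sqi (fun xi => complex.Re (fourierL2 f xi)) < +oo)%E ->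
  (sqi (fun xi => complex.Im (fourierL2 f xi)) < +oo)%E ->
  exists2 rho : R, 0 <= rho & cnorm (Elam m lam f x) ^+ 2 = fnorm_const R n.+1 ^+ 2 *
    V2 (bp rho (fun xi => complex.Re (fourierL2 f xi))) (bp rho (fun xi => complex.Im (fourierL2 f xi))) x.
Proof.
set g := fourierL2 f; move=> m1 lam0 mp mq p2 q2.
set p := fun xi => complex.Re (g xi); set q := fun xi => complex.Im (g xi).
pose rho := lam `^ ((2 * m)%:R^-1).
have rho0 : 0 <= rho by exact: powR_ge0.
exists rho => //.
have m2 : (0 < 2 * m)%N by rewrite muln_gt0.
have rhoE : rho ^+ (2 * m) = lam.
  have nz : (2 * m)%:R != 0 :> R by rewrite pnatr_eq0 -lt0n.
  by rewrite -powR_mulrn// /rho -powRrM mulVf// powRr1// ltW.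
have SE xi : (enorm xi ^+ (2 * m) < lam) = (enorm xi < rho).
  by rewrite -rhoE ltr_pXn2r// nnegrE ?sqrtr_ge0.
have ip : intg mu (bp rho p) by exact: intg_ballM.
have iq : intg mu (bp rho q) by exact: intg_ballM.
rewrite cnorm_sqr /Elam /=.
have E1 : fine (\int[mu]_(xi in [set xi | (enorm xi ^+ (2 * m) < lam)%R])
    (complex.Re (g xi * cexpi (dotp x xi)))%:E)%E = VR (bp rho p) (bp rho q) x.
  rewrite -/(Rintegral mu _ _) Rintegral_mkcond /VR /FT -RintegralB//; [|exact: intg_cs..].
  apply: eq_Rintegral => xi _; rewrite patchE (mem_setb (fun z : X => enorm z ^+ (2 * m) < lam)) SE /bp /ballI /p /q.
  by case: (g xi) => u v; case: (enorm xi < rho) => /=; rewrite ?mul1r ?mul0r ?subrr.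
have E2 : fine (\int[mu]_(xi in [set xi | (enorm xi ^+ (2 * m) < lam)%R])
    (complex.Im (g xi * cexpi (dotp x xi)))%:E)%E = VI (bp rho p) (bp rho q) x.
  rewrite -/(Rintegral mu _ _) Rintegral_mkcond /VI /FT -RintegralD//; [|exact: intg_cs..].
  apply: eq_Rintegral => xi _; rewrite patchE (mem_setb (fun z : X => enorm z ^+ (2 * m) < lam)) SE /bp /ballI /p /q.
  by case: (g xi) => u v; case: (enorm xi < rho) => /=; rewrite ?mul1r ?mul0r ?addr0.
rewrite E1 E2 /V2 !mul0r subr0 addr0; ring.
Qed.

(** f vanishes on |y| < 3 only almost everywhere, while the localization asks for zeros everywhere;
    the cutoff corrects f on that null set without changing the transforms of its truncations. *)
Definition clip (f : X -> R) (k : nat) y : R := ballI k%:R y * (f y * (3 <= enorm y)%R%:R).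

Lemma fourier1_trunc (f : X -> R[i]) k : cmeasurable f ->
  {ae mu, forall y, enorm y < 3 -> f y = 0} ->
  intg mu (clip (fun y => complex.Re (f y)) k) -> intg mu (clip (fun y => complex.Im (f y)) k) ->
  forall xi, fourier1 (trunc k f) xi =
   Complex (ReF (fnorm_const R n.+1) (clip (fun y => complex.Re (f y)) k) (clip (fun y => complex.Im (f y)) k) xi)
           (ImF (fnorm_const R n.+1) (clip (fun y => complex.Re (f y)) k) (clip (fun y => complex.Im (f y)) k) xi).
Proof.
move=> [mr mi] f3; set A := clip _ k; set B := clip _ k => Ai Bi xi.
have mc b : measurable_fun setT (fun y => cs b (dotp xi y)).
  by apply: measurable_cs; exact: measurable_dotp.
have mbl : measurable_fun setT (@ballI R n.+1 k%:R) by exact: measurable_ballI.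
have tE y : trunc k f y = Complex (ballI k%:R y * complex.Re (f y)) (ballI k%:R y * complex.Im (f y)).
  rewrite /trunc /ballI indicE (mem_setb (fun z : X => enorm z < k%:R)).
  case: (f y) => u v; case: (enorm y < k%:R) => /=; congr Complex; rewrite /= ?mul1r ?mul0r ?subr0 ?addr0//.
have aeE (h1 h2 : X -> R) : measurable_fun setT h1 -> measurable_fun setT h2 ->
   (forall y, (enorm y < 3 -> f y = 0) -> h1 y = h2 y) ->
   fine (\int[mu]_y (h1 y)%:E)%E = \int[mu]_y h2 y.
  move=> mh1 mh2 hh; rewrite /Rintegral; congr fine; apply: ae_eq_integral => //.
  - exact/measurable_EFinP.
  - exact/measurable_EFinP.
  - by apply: filterS f3 => z hz _; congr EFin; apply: hh.
have key y : (enorm y < 3 -> f y = 0) ->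
   A y = ballI k%:R y * complex.Re (f y) /\ B y = ballI k%:R y * complex.Im (f y).
  move=> hy; rewrite /A /B /clip; have [y3|y3] := ltP (enorm y) 3.
    by rewrite hy// /= !mul0r !mulr0.
  by rewrite !mulr1.
have mA := intg_measurable Ai; have mB := intg_measurable Bi.
rewrite /fourier1 /cint.
rewrite (aeE _ (fun y => A y * cs true (dotp xi y) + B y * cs false (dotp xi y))); last 3 first.
- under eq_fun do rewrite tE /= cosN sinN.
  by apply: measurable_funB; apply: measurable_funM => //; [exact: measurable_funM|
    apply: (measurable_cs true); exact: measurable_dotp|exact: measurable_funM|
    apply: measurable_funN; apply: (measurable_cs false); exact: measurable_dotp].
- by apply: measurable_funD; apply: measurable_funM.
- move=> y /key[-> ->]; rewrite tE /= cosN sinN [dotp y xi]dotpC; ring.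
rewrite (aeE _ (fun y => B y * cs true (dotp xi y) - A y * cs false (dotp xi y))); last 3 first.
- under eq_fun do rewrite tE /= cosN sinN.
  by apply: measurable_funD; apply: measurable_funM => //; [exact: measurable_funM|
    apply: measurable_funN; apply: (measurable_cs false); exact: measurable_dotp|exact: measurable_funM|
    apply: (measurable_cs true); exact: measurable_dotp].
- by apply: measurable_funB; apply: measurable_funM.
- move=> y /key[-> ->]; rewrite tE /= cosN sinN [dotp y xi]dotpC; ring.
rewrite RintegralD//; [|exact: intg_cs..].
rewrite RintegralB//; [|exact: intg_cs..].
rewrite /ReF /ImF /FT; congr Complex => /=; ring.
Qed.

End Final.

(** * Conclusion *)

Unset Implicit Arguments.

Theorem theorem1p2 (R : realType) (N m : nat) :
  (1 <= N)%N -> (1 <= m)%N ->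
  forall r : R, r < 3 ->
  exists c : R,
  forall f : N.-tuple R -> R[i],
    L2 f ->
    {ae lebN N, forall x, (enorm x < 3)%R -> f x = 0} ->
    (\int[lebN N]_(x in [set x | (enorm x <= r)%R]) (Estar m f x * Estar m f x)
      <= c%:E * \int[lebN N]_(x in [set x | (3 <= enorm x)%R]) ((cnorm (f x)) ^+ 2)%:E)%E.
Proof.
case: N => [//|n] _ m1 r r3.
pose mu := @lebN R n.+1.
pose c := @fnorm_const R n.+1.
have c0 : 0 <= c by rewrite invr_ge0 exprn_ge0// sqrtr_ge0.
have [K K0 HK] := @GM_bound R n c r c0 r3.
exists (c ^+ 2 * K) => f [mf f2] f3; have [mr mi] := mf.
pose E := (\int[mu]_(x in [set x | (3 <= enorm x)%R]) ((cnorm (f x)) ^+ 2)%:E)%E.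
rewrite -/mu -/E.
have E0 : (0 <= E)%E by apply: integral_ge0 => x _; rewrite lee_fin sqr_ge0.
have mcn (h : n.+1.-tuple R -> R[i]) : cmeasurable h ->
    measurable_fun setT (fun x => (cnorm (h x) ^+ 2)%:E).
  move=> [h1 h2]; under eq_fun do rewrite cnorm_sqr.
  by apply/measurable_EFinP; apply: measurable_funD; exact: measurable_funX.
have m3 : measurable [set x : n.+1.-tuple R | 3 <= enorm x].
  have : measurable_fun setT (fun x : n.+1.-tuple R => 3 <= enorm x).
    by apply: measurable_fun_ler => //; exact: measurable_enorm.
  by move=> /(_ measurableT [set true]); rewrite setTI; exact.
have Efin : (E < +oo)%E.
  apply: le_lt_trans f2; apply: ge0_subset_integral => //.
  - exact: mcn.
  - by move=> x _; rewrite lee_fin sqr_ge0.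
have [[g0 Hg0]|nog] := pselect (exists g, is_L2_fourier f g); last first.
  have F0 : fourierL2 f = fun _ => 0.
    by apply: xgetPN => g Hg; apply: nog; exists g.
  rewrite integral0_eq; first by rewrite mule_ge0// lee_fin mulr_ge0// sqr_ge0.
  move=> x _; suff -> : Estar m f x = 0%E by rewrite mule0.
  have H lam : (cnorm (Elam m lam f x))%:E = 0%E.
    rewrite /Elam F0 /cint integral0_eq; last by move=> xi _; rewrite mul0r.
    rewrite integral0_eq; last by move=> xi _; rewrite mul0r.
    by rewrite /cnorm /= !mulr0 subr0 addr0 expr0n/= addr0 sqrtr0.
  apply/eqP; rewrite eq_le; apply/andP; split.
    by apply: ge_ereal_sup => _ [lam _ <-]; rewrite H.
  by apply: ereal_sup_ubound; exists 1 => //=; exact: ltr01.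
have [[mg g2] hD] : is_L2_fourier f (fourierL2 f).
  exact: (xgetPex _ (ex_intro _ g0 Hg0)).
have [mp mq] := mg.
set g := fourierL2 f in mg g2 hD mp mq.
pose p xi := complex.Re (g xi); pose q xi := complex.Im (g xi).
have sq1 (h : n.+1.-tuple R -> R[i]) :
    (\int[mu]_x (cnorm (h x) ^+ 2)%:E < +oo)%E -> (sqi (fun x => complex.Re (h x)) < +oo)%E.
  apply: le_lt_trans; apply: sup_le_integral => x _; first by rewrite lee_fin sqr_ge0.
  by rewrite lee_fin cnorm_sqr lerDl sqr_ge0.
have sq2 (h : n.+1.-tuple R -> R[i]) :
    (\int[mu]_x (cnorm (h x) ^+ 2)%:E < +oo)%E -> (sqi (fun x => complex.Im (h x)) < +oo)%E.
  apply: le_lt_trans; apply: sup_le_integral => x _; first by rewrite lee_fin sqr_ge0.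
  by rewrite lee_fin cnorm_sqr lerDr sqr_ge0.
have p2 : (sqi p < +oo)%E by exact: sq1.
have q2 : (sqi q < +oo)%E by exact: sq2.
pose A := clip (fun x => complex.Re (f x)); pose B := clip (fun x => complex.Im (f x)).
have iclip (h : n.+1.-tuple R -> R) k : measurable_fun setT h -> (sqi h < +oo)%E ->
    intg mu (clip h k).
  move=> mh h2; apply: intg_ballM.
    apply: measurable_funM => //; apply: measurable_boolR.
    by apply: measurable_fun_ler => //; exact: measurable_enorm.
  apply: le_lt_trans h2; apply: sup_le_integral => x _; first by rewrite lee_fin sqr_ge0.
  rewrite lee_fin exprMn ler_piMr ?sqr_ge0//.
  by case: (3 <= enorm x); rewrite ?expr1n ?expr0n.
have Ai k : intg mu (A k) by apply: iclip => //; exact: sq1.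
have Bi k : intg mu (B k) by apply: iclip => //; exact: sq2.
have clip3 (h : n.+1.-tuple R -> R) k y : enorm y < 3 -> clip h k y = 0.
  by move=> y3; rewrite /clip leNgt y3 !mulr0.
pose e := fine E.
have EE : E = e%:E by rewrite fineK// ge0_fin_numE.
have msq (h : n.+1.-tuple R -> R) : measurable_fun setT h ->
    measurable_fun setT (fun x => (h x ^+ 2)%:E).
  by move=> mh; apply/measurable_EFinP; exact: measurable_funX.
have Ee k : (sqi (A k) + sqi (B k) <= e%:E)%E.
  rewrite -EE /sqi -ge0_integralD//; last 4 first.
  - by move=> x _; rewrite lee_fin sqr_ge0.
  - exact: msq (intg_measurable (Ai k)).
  - by move=> x _; rewrite lee_fin sqr_ge0.
  - exact: msq (intg_measurable (Bi k)).
  rewrite /E [leRHS]integral_mkcond; apply: sup_le_integral => x _.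
    by rewrite adde_ge0// lee_fin sqr_ge0.
  rewrite patchE -EFinD /A /B /clip (mem_setb (fun z : n.+1.-tuple R => 3 <= enorm z)).
  case: (3 <= enorm x) => /=; last by rewrite !mulr0 expr0n/= addr0.
  rewrite lee_fin cnorm_sqr !mulr1 !exprMn -mulrDr ler_piMl ?addr_ge0 ?sqr_ge0//.
  by rewrite /ballI; case: (_ < _); rewrite ?expr1n ?expr0n.
have hD' : ((fun k => sqi (fun xi => p xi - ReF c (A k) (B k) xi)%R +
    sqi (fun xi => q xi - ImF c (A k) (B k) xi)%R)%E @ \oo --> 0%E).
  rewrite [X in X @ _](_ : _ = fun k => (\int[mu]_xi ((cnorm (fourier1 (trunc k f) xi - g xi)) ^+ 2)%:E)%E)//.
  apply/funext => k; rewrite /sqi -ge0_integralD//; last 4 first.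
  - by move=> x _; rewrite lee_fin sqr_ge0.
  - by apply: msq; apply: measurable_funB => //; exact: measurable_ReF.
  - by move=> x _; rewrite lee_fin sqr_ge0.
  - by apply: msq; apply: measurable_funB => //; exact: measurable_ImF.
  apply: eq_integral => xi _; rewrite (fourier1_trunc mf f3 (Ai k) (Bi k)) cnorm_sqr -EFinD.
  by rewrite /p /q; case: (g xi) => u v /=; congr EFin; rewrite -/c -/A -/B; ring.
have HG M := HK p q A B e M mp mq p2 q2 Ai Bi (fun k y => @clip3 _ k y) (fun k y => @clip3 _ k y) Ee hD'.
have mB : measurable [set x : n.+1.-tuple R | enorm x <= r] by exact: measurable_ball_le.
pose GG (M : nat) x : \bar R := (c ^+ 2 * GM p q M x)%:E.
have mG M := @measurable_GM R n p q M mp mq p2 q2.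
have GG0 M x : (0 <= GG M x)%E by rewrite lee_fin mulr_ge0 ?sqr_ge0 ?GM_ge0.
have ndG x : nondecreasing_seq (GG ^~ x).
  by move=> a b ab; rewrite lee_fin ler_wpM2l ?sqr_ge0//; exact: GM_nd.
(* A pointwise bound: an infinite limit leaves nothing to prove, and a finite one bounds every
   [GM p q M x], so [V2_le_GM] covers all radii at once. *)
have Es x : (Estar m f x * Estar m f x <= limn (GG ^~ x))%E.
  have GGle M : (GG M x <= limn (GG ^~ x))%E.
    apply: lime_ge; first exact: (ereal_nondecreasing_is_cvgn (ndG x)).
    by exists M => // k Mk; exact: ndG.
  have lim0 : (0 <= limn (GG ^~ x))%E by exact: le_trans (GG0 0%N x) (GGle 0%N).
  have [limfin|] := boolP (limn (GG ^~ x) \is a fin_num); last first.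
    by rewrite ge0_fin_numE// -leNgt leye_eq => /eqP ->; rewrite leey.
  pose s := fine (limn (GG ^~ x)).
  have sE : limn (GG ^~ x) = s%:E by rewrite fineK.
  have s0 : 0 <= s by rewrite -lee_fin -sE.
  have Ele lam : 0 < lam -> cnorm (Elam m lam f x) <= Num.sqrt s.
    move=> lam0; have [rho rho0 Erho] := @Elam_V2 R n m lam f x m1 lam0 mp mq p2 q2.
    rewrite -[leLHS]ger0_norm ?cnorm_ge0// -sqrtr_sqr; apply: ler_wsqrtr.
    rewrite Erho -/c; have [->|cn0] := eqVneq c 0; first by rewrite expr0n/= mul0r.
    have cp : 0 < c ^+ 2 by rewrite exprn_even_gt0.
    rewrite mulrC -ler_pdivlMr//; apply: V2_le_GM => // M.
    by rewrite ler_pdivlMr// mulrC -lee_fin -sE; exact: GGle.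
  have Ees : (Estar m f x <= (Num.sqrt s)%:E)%E.
    by apply: ge_ereal_sup => _ [lam lam0 <-]; rewrite lee_fin; exact: Ele.
  have Es0 : (0 <= Estar m f x)%E.
    apply: (@le_trans _ _ (cnorm (Elam m 1 f x))%:E); first by rewrite lee_fin cnorm_ge0.
    by apply: ereal_sup_ubound; exists 1 => //=; exact: ltr01.
  apply: le_trans (lee_pmul Es0 Es0 Ees Ees) _.
  by rewrite -EFinM -expr2 sqr_sqrtr// sE.
(* From here on the integrand is a monotone limit of measurable functions, so monotone convergence
   reduces the claim to a fixed [M]. *)
apply: (@le_trans _ _ (\int[mu]_(x in [set x | (enorm x <= r)%R]) limn (GG ^~ x))%E).
  apply: sup_le_integral => x _ //.
  by rewrite mule_ge0//; apply: (@le_trans _ _ (cnorm (Elam m 1 f x))%:E);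
    rewrite ?lee_fin ?cnorm_ge0//; apply: ereal_sup_ubound; exists 1 => //=; exact: ltr01.
have mGG M : measurable_fun [set x : n.+1.-tuple R | enorm x <= r] (GG M).
  by apply: measurable_funTS; apply/measurable_EFinP; apply: measurable_funM.
rewrite (monotone_convergence mu mB mGG (fun M x _ => GG0 M x) (fun x _ => ndG x)).
apply: lime_le.
  apply: ereal_nondecreasing_is_cvgn => a b ab.
  by apply: sup_le_integral => x _ //; exact: ndG.
apply: nearW => M; rewrite /GG; under eq_integral do rewrite EFinM.
rewrite ge0_integralZl_EFin ?sqr_ge0//; last 2 first.
- by move=> x _; rewrite lee_fin GM_ge0.
- by apply: measurable_funTS; exact/measurable_EFinP.
rewrite [in leRHS]EFinM -muleA EE; apply: lee_wpmul2l; first by rewrite lee_fin sqr_ge0.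
by rewrite -EFinM; exact: HG.
Qed.
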